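(* Let $w(t)=1+\log_+\frac1t$ for $t>0$. Then $X_w=\mathrm{bmo}$ (as spaces of functions on $\mathbb{R}^n$), and for $f\in\mathrm{bmo}$ $$\|f\|_{\mathrm{bmo}}\approx \|f\|_{\mathrm{BMO}}+\sup_{t>0}\frac{\|P_tf\|_{L^\infty}}{1+\log_+\frac1t}\approx \|f\|_{\mathrm{BMO}}+\sup_B\frac{1}{w(r(B))\,|B|}\left|\int_Bf(x)\,dx\right|,$$ where the last supremum is over all Euclidean balls $B\subset\mathbb{R}^n$, $r(B)$ denotes the radius of $B$ and $|B|$ its Lebesgue measure, and the implicit constants do not depend on $f$.
   Context: $\log_+ s=\max(\log s,0)$. $A\approx B$ means that each quantity is bounded by a constant multiple of the other. Let $\phi$ be a Schwartz function on $\mathbb{R}^n$ with $\widehat\phi$ supported in a ball centred at $0$ and $\int\phi\neq0$, and let $P_tf=\widehat\phi(tD)f$, the Fourier multiplier operator with symbol $\widehat\phi(t\xi)$. For a weight $w$ on $(0,\infty)$, $X_w$ is the space of functions $f\in\mathrm{BMO}$ such that $\|f\|_{X_w}:=\|f\|_{\mathrm{BMO}}+\sup_{t>0}\frac{\|P_tf\|_{L^\infty}}{w(t)}<\infty$. $\mathrm{BMO}$ is the usual space of functions of bounded mean oscillation. $\mathrm{bmo}$ is the class of locally integrable functions with $\|f\|_{\mathrm{bmo}}:=\|f\|_{\mathrm{BMO}}+\|\widehat\Theta(D)f\|_{L^\infty}<\infty$, where $\widehat\Theta$ is a fixed bump function equal to $1$ in a neighbourhood of the origin and $\widehat\Theta(D)$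 is the Fourier multiplier operator with symbol $\widehat\Theta(\xi)$; different choices give equivalent norms. *)

(* Defs.v *)
From HB Require Import structures.
From mathcomp Require Import all_boot all_order all_algebra.
From mathcomp Require Import all_classical all_reals all_analysis.
From mathcomp Require Import ess_sup_inf.
From mathcomp Require Import complex.

Set Implicit Arguments.
Unset Strict Implicit.
Unset Printing Implicit Defensive.

Import Order.TTheory GRing.Theory Num.Theory.
Import numFieldNormedType.Exports.

Local Open Scope classical_set_scope.
Local Open Scope ring_scope.
Local Open Scope complex_scope.

(* The Borel (= product) sigma-algebra on the row vectors, generated by the
   coordinates as the library does for tuples. *)
Definition rV_display : measure_display. Proof. exact. Qed.

Section measurable_rV.
Context {R : realType} (n : nat).

Let coor : 'I_n -> 'rV[R]_n -> measurableTypeR R := fun i x => x ord0 i.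

Let rV_set0 : g_sigma_preimage coor set0.
Proof. exact: sigma_algebra0. Qed.

Let rV_setC A : g_sigma_preimage coor A -> g_sigma_preimage coor (~` A).
Proof. exact: sigma_algebraC. Qed.

Let rV_bigcup (F : (set 'rV[R]_n)^nat) :
  (forall i, g_sigma_preimage coor (F i)) ->
  g_sigma_preimage coor (\bigcup_i (F i)).
Proof. exact: sigma_algebra_bigcup. Qed.

HB.instance Definition _ := @isMeasurable.Build rV_display
  'rV[R]_n (g_sigma_preimage coor) rV_set0 rV_setC rV_bigcup.

Lemma measurable_coor (i : 'I_n) :
  measurable_fun setT (fun x : 'rV[R]_n => x ord0 i : measurableTypeR R).
Proof.
move=> _ Y mY; rewrite setTI; apply: sub_sigma_algebra => /=.
rewrite -bigcup_seq/=; exists i => /=; first by rewrite mem_index_enum.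
by exists Y => //; rewrite setTI.
Qed.

Lemma measurable_fun_rVP d (T : measurableType d) (f : T -> 'rV[R]_n) :
  (forall i, measurable_fun setT (fun t => f t ord0 i : measurableTypeR R)) ->
  measurable_fun setT f.
Proof.
move=> mf _ A mA; rewrite setTI.
suff : image_set_system setT f measurable A by rewrite /image_set_system/= setTI.
move: A mA; apply: smallest_sub.
  exact/sigma_algebra_image/sigma_algebra_measurable.
rewrite -bigcup_seq/=; apply: bigcup_sub => i _ _ [Y mY <-].
rewrite /image_set_system/= !setTI.
by have := mf i measurableT Y mY; rewrite setTI.
Qed.

End measurable_rV.

Section lebesgue_rV.
Context {R : realType}.

Definition rV_cons n (p : measurableTypeR R * 'rV[R]_n) : 'rV[R]_n.+1 :=
  row_mx (const_mx p.1 : 'rV_1) p.2.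

Lemma rV_cons0 n (p : measurableTypeR R * 'rV[R]_n) :
  rV_cons p ord0 (@lshift 1 n ord0) = p.1.
Proof. by rewrite [LHS](@row_mxEl _ 1 1 n) mxE. Qed.

Lemma rV_consS n (p : measurableTypeR R * 'rV[R]_n) j :
  rV_cons p ord0 (@rshift 1 n j) = p.2 ord0 j.
Proof. exact: (@row_mxEr _ 1 1 n). Qed.

Lemma measurable_rV_cons n : measurable_fun setT (@rV_cons n).
Proof.
apply: measurable_fun_rVP => i.
have [j ->|j ->] := split_ordP (i : 'I_(1 + n)).
  rewrite (ord1 j) (_ : (fun _ => _) = fst)//; apply/funext => p.
  exact: rV_cons0.
rewrite (_ : (fun _ => _) = (fun x : 'rV[R]_n => x ord0 j) \o snd).
  exact: (measurableT_comp (measurable_coor j)).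
by apply/funext => p; exact: rV_consS.
Qed.

Section successor.
Variables (n : nat) (m : {sigma_finite_measure set 'rV[R]_n -> \bar R}).

Definition lebesgue_rVS : set 'rV[R]_n.+1 -> \bar R :=
  pushforward (@lebesgue_measure R \x m)%E (@rV_cons n).

Let lebesgue_rVS0 : lebesgue_rVS set0 = 0%E.
Proof. by rewrite /lebesgue_rVS /pushforward preimage_set0 measure0. Qed.

Let lebesgue_rVS_ge0 A : (0 <= lebesgue_rVS A)%E.
Proof. exact: (measure_ge0 (@lebesgue_measure R \x m)%E). Qed.

Let lebesgue_rVS_sigma_additive : semi_sigma_additive lebesgue_rVS.
Proof.
move=> F mF tF mUF; rewrite /lebesgue_rVS /pushforward preimage_bigcup.
apply: measure_semi_sigma_additive.
- by move=> k; rewrite -[X in measurable X]setTI; exact: measurable_rV_cons.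
- apply/trivIsetP => /= i j _ _ ij; rewrite -preimage_setI.
  by move/trivIsetP : tF => /(_ _ _ _ _ ij) ->//; rewrite preimage_set0.
- rewrite -preimage_bigcup -[X in measurable X]setTI.
  exact: measurable_rV_cons.
Qed.

HB.instance Definition _ := isMeasure.Build _ _ _
  lebesgue_rVS lebesgue_rVS0 lebesgue_rVS_ge0 lebesgue_rVS_sigma_additive.

Let lebesgue_rVS_sigma_finite : sigma_finite setT lebesgue_rVS.
Proof.
have /sigma_finiteP[F [TF ndF Foo]] := sigma_finiteT (@lebesgue_measure R).
have /sigma_finiteP[G [TG ndG Goo]] := sigma_finiteT m.
pose uncons (v : 'rV[R]_n.+1) : measurableTypeR R * 'rV[R]_n :=
  (v ord0 ord0, \row_j v ord0 (rshift 1 j)).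
have consK p : uncons (rV_cons p) = p.
  case: p => x v; rewrite /uncons; congr pair.
    rewrite (_ : ord0 = lshift n ord0 :> 'I_(1 + n)); last exact: val_inj.
    exact: rV_cons0.
  by apply/rowP => j; rewrite mxE rV_consS.
have muncons : measurable_fun setT uncons.
  apply: measurable_fun_pair; first exact: measurable_coor.
  apply: measurable_fun_rVP => i; under eq_fun do rewrite mxE.
  exact: measurable_coor.
exists (fun k => uncons @^-1` (F k `*` G k)).
  apply/esym; rewrite -subTset => v _.
  have [i _ Fi] : (\bigcup_i F i) (uncons v).1 by rewrite -TF.
  have [j _ Gj] : (\bigcup_i G i) (uncons v).2 by rewrite -TG.
  exists (maxn i j) => //; split.
  - by move: Fi; exact/subsetPset/ndF/leq_maxl.
  - by move: Gj; exact/subsetPset/ndG/leq_maxr.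
move=> k; have [mF Fk] := Foo k; have [mG Gk] := Goo k; split.
  by rewrite -[X in measurable X]setTI; apply: muncons => //; exact: measurableX.
rewrite /lebesgue_rVS /pushforward -comp_preimage.
rewrite (_ : uncons \o _ = idfun); last by apply/funext => p; exact: consK.
by rewrite preimage_id product_measure1E// lte_mul_pinfty// ge0_fin_numE.
Qed.

HB.instance Definition _ := @Measure_isSigmaFinite.Build _ _ _
  lebesgue_rVS lebesgue_rVS_sigma_finite.

End successor.

(* Lebesgue measure on R^n. *)
Fixpoint lebesgue_rV n : {sigma_finite_measure set 'rV[R]_n -> \bar R} :=
  match n return {sigma_finite_measure set 'rV[R]_n -> \bar R} with
  | 0 => @dirac _ 'rV[R]_0 0 R
  | k.+1 => lebesgue_rVS (lebesgue_rV k)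
  end.

End lebesgue_rV.

Section euclidean.
Context {R : realType} {n : nat}.
Implicit Types (x y : 'rV[R]_n).

Definition dotrv x y : R := \sum_(i < n) x ord0 i * y ord0 i.

(* The norm that the library puts on 'rV[R]_n is the sup norm. *)
Definition enorm x : R := Num.sqrt (dotrv x x).

Definition eball x (r : R) : set 'rV[R]_n := [set y | enorm (y - x) < r].

End euclidean.

Section complex_integral.
Context {R : realType} {n : nat}.
Implicit Types (D : set 'rV[R]_n) (f : 'rV[R]_n -> R[i]).

Local Notation mu := (@lebesgue_rV R n).

Definition cmeasurable_fun D f :=
  measurable_fun D (fun x => complex.Re (f x)) /\
  measurable_fun D (fun x => complex.Im (f x)).

Definition cintegrable D f :=
  mu.-integrable D (fun x => (complex.Re (f x))%:E) /\
  mu.-integrable D (fun x => (complex.Im (f x))%:E).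

Definition cintegral D f : R[i] :=
  (\int[mu]_(x in D) complex.Re (f x)) +i* (\int[mu]_(x in D) complex.Im (f x)).

Definition Linfty_norm f : \bar R :=
  ess_sup mu (fun x => (ComplexField.Normc.normc (f x))%:E).

(* Functions are handled through Borel representatives: every
   Lebesgue-measurable function is almost everywhere equal to one. *)
Definition clocally_integrable f :=
  cmeasurable_fun setT f /\ forall K, compact K -> cintegrable K f.

End complex_integral.

Section schwartz.
Context {R : realType} {n : nat}.

(* d/dx_i applied for the indices i of s, the last one first. *)
Definition partials (s : seq 'I_n) (u : 'rV[R]_n -> R) : 'rV[R]_n -> R :=
  foldr (fun i v x => 'D_(delta_mx ord0 i) v x) u s.

Definition smooth (u : 'rV[R]_n -> R) :=
  forall s : seq 'I_n, continuous (partials s u) /\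
    forall i x, derivable (partials s u) x (delta_mx ord0 i).

Definition schwartz_real (u : 'rV[R]_n -> R) :=
  smooth u /\
  forall (a : 'I_n -> nat) (s : seq 'I_n), exists C : R,
    forall x : 'rV[R]_n,
      `|(\prod_(i < n) x ord0 i ^+ a i) * partials s u x| <= C.

Definition schwartz (phi : 'rV[R]_n -> R[i]) :=
  schwartz_real (fun x => complex.Re (phi x)) /\
  schwartz_real (fun x => complex.Im (phi x)).

End schwartz.

Section fourier.
Context {R : realType} {n : nat}.
Implicit Types (phi psi m f g : 'rV[R]_n -> R[i]).

Definition expi (t : R) : R[i] := cos t +i* sin t.

(* The normalisation for which D = - i grad has symbol xi. *)
Definition fourier phi : 'rV[R]_n -> R[i] :=
  fun xi => cintegral setT (fun x => phi x * expi (- dotrv x xi)).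

Definition tempered f :=
  cmeasurable_fun setT f /\
  forall psi, schwartz psi -> cintegrable setT (fun x => f x * psi x).

(* m(D) f = g, that is, the Fourier transforms of the tempered distributions
   f and g are related by  g^ = m f^.  Tested against a Schwartz function psi,
   the two sides are <g^, psi> = <g, psi^> and
   <m f^, psi> = <f^, m psi> = <f, (m psi)^>.  Multiplication by the symbol m
   has to preserve Schwartz functions, as it does for m Schwartz. *)
Definition is_fourier_multiplier m f g :=
  [/\ tempered f, tempered g & forall psi, schwartz psi ->
    cintegral setT (fun x => g x * fourier psi x) =
    cintegral setT (fun x => f x * fourier (fun xi => m xi * psi xi) x)].

(* The L^oo norm of the distribution m(D) f. As m(D) f determines a function g
   up to almost everywhere equality, the infimum is over at most one value; it
   is +oo when m(D) f is not a function. *)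
Definition multiplier_Linfty m f : \bar R :=
  ereal_inf [set Linfty_norm g | g in is_fourier_multiplier m f].

(* || P_t f ||_oo for P_t = phi^ (t D) *)
Definition P_Linfty phi (t : R) f : \bar R :=
  multiplier_Linfty (fun xi => fourier phi (t *: xi)) f.

End fourier.

Section spaces.
Context {R : realType} {n : nat}.
Implicit Types (phi Theta f : 'rV[R]_n -> R[i]) (B : set 'rV[R]_n) (w : R -> R).

Local Notation mu := (@lebesgue_rV R n).
Local Notation normc := (@ComplexField.Normc.normc R).

Definition vol B : R := fine (mu B).

Definition average f B : R[i] := ((vol B)^-1)%:C * cintegral B f.

Definition mean_oscillation f B : \bar R :=
  (((vol B)^-1)%:E * \int[mu]_(x in B) (normc (f x - average f B))%:E)%E.

Definition BMO_norm f : \bar R :=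
  ereal_sup [set z | exists c r, 0 < r /\ z = mean_oscillation f (eball c r)].

Definition BMO : set ('rV[R]_n -> R[i]) :=
  [set f | clocally_integrable f /\ (BMO_norm f < +oo)%E].

Definition sup_P w phi f : \bar R :=
  ereal_sup [set z | exists2 t : R, 0 < t &
    z = (P_Linfty phi t f * ((w t)^-1)%:E)%E].

Definition X_norm w phi f : \bar R := (BMO_norm f + sup_P w phi f)%E.

Definition X_space w phi : set ('rV[R]_n -> R[i]) :=
  [set f | BMO f /\ (X_norm w phi f < +oo)%E].

Definition bmo_norm Theta f : \bar R :=
  (BMO_norm f + multiplier_Linfty (fourier Theta) f)%E.

Definition bmo Theta : set ('rV[R]_n -> R[i]) :=
  [set f | clocally_integrable f /\ (bmo_norm Theta f < +oo)%E].

Definition sup_ball w f : \bar R :=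
  ereal_sup [set z | exists c r, 0 < r /\
    z = ((w r * vol (eball c r))^-1 * normc (cintegral (eball c r) f))%:E].

Definition ball_norm w f : \bar R :=
  (BMO_norm f + sup_ball w f)%E.

End spaces.

Definition log_weight {R : realType} (t : R) : R := 1 + Num.max (ln t^-1) 0.

Definition comparable_on {T : Type} {R : realType} (S : set T)
    (A B : T -> \bar R) :=
  exists2 C : R, 0 < C & forall f, S f ->
    (A f <= C%:E * B f)%E /\ (B f <= C%:E * A f)%E.

Definition bounded_support {R : realType} {n : nat} (m : 'rV[R]_n -> R[i]) :=
  exists r : R, forall xi, r < enorm xi -> m xi = 0.

(* Main.v *)
(* All three norms are compared with the last one, through averages over balls.
   A function of bounded mean oscillation satisfies
     \int (1 + |y|)^(-N) |f(c + r y) - f_{B(c, r)}| dy <= C ||f||_BMO,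
   by a sum over dyadic balls. Hence every dilated kernel that decays fast,
   paired with f at centre c and scale r, gives the average f_{B(c, r)} times the
   mean of the kernel, up to O(||f||_BMO).
   - Since P_t f = f * phi_t, the averages at scale t control ||P_t f||_oo.
   - Conversely let g = P_t f and r >= t. Testing the definition of P_t f against
     the modulated Gaussian whose Fourier transform is a Gaussian centred at c
     with width r bounds the pairing of f with phi_t * (that Gaussian) by
     ||g||_oo; this kernel decays fast at scale r uniformly in t <= r and its mean
     is a nonzero multiple of the integral of phi, so ||g||_oo and ||f||_BMO
     control f_{B(c, r)}. Fourier inversion and the uniqueness of g are not needed.
   - With t = r this gives the averages from sup_t ||P_t f||_oo / w(t). With
     Theta and t = 1 it gives the averages over balls of radius r >= 1, and for
     r < 1 one doubles the ball about log(1/r) times, at the cost of a multiple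
     of ||f||_BMO each time. *)

Require Import Defs.
From HB Require Import structures.
From mathcomp Require Import all_boot all_order all_algebra.
From mathcomp Require Import all_classical all_reals all_analysis.
From mathcomp Require Import measurable_realfun ess_sup_inf.
From mathcomp Require Import complex.
From mathcomp Require Import ring lra.

Set Implicit Arguments.
Unset Strict Implicit.
Unset Printing Implicit Defensive.

Import Order.TTheory GRing.Theory Num.Theory.
Import numFieldNormedType.Exports.

Local Open Scope classical_set_scope.
Local Open Scope ring_scope.

(** * Measure theory on R^n *)

(** The norm [multiplier_Linfty] is an infimum over functions g tied to f only through pairings with
    Schwartz functions, and this decides what each direction must supply. An upper bound has to
    exhibit a g: the convolution is shown to be tempered and to satisfy every pairing, by Fubini's
    theorem for a function f of which only weighted integrability is known. A lower bound may choose
    one test function; the Gaussian is chosen because its transform follows by hand from a linear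
    differential equation, up to a positive constant.

    The exponent [decay] = 2n + 2 is spent as follows. Each coordinate takes 2 units, through (1 +
    |x|_1)^2 >= 1 + x_i^2, so that the weight is integrable by induction on the dimension. In the
    dyadic sum, 2^(-k(2n+2)) meets the volume 2^(kn) of the k-th ball and the drift 1 + k <= 2^k of
    the averages, and at least 2^(-k) is left. *)

Section rV_measurability.
Context {R : realType} {n : nat}.
Implicit Types (x y : 'rV[R]_n).

(** [ball] refers to the sup norm, so it is a finite intersection of coordinate slabs. *)
Lemma measurable_ball_rV x e : measurable (ball x e).
Proof.
(* Positivity of the radius is part of the ball predicate, so these balls are empty in every
   dimension. *)
have [e0|e0] := ltP 0 e; last first.
  rewrite (_ : ball x e = set0) ?measurable0//.
  by apply/seteqP; split => // y [e1 _]; have := lt_le_trans e1 e0; rewrite ltxx.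
rewrite (_ : ball x e = \big[setI/setT]_(j < n)
  ((fun y : 'rV[R]_n => y ord0 j : measurableTypeR R) @^-1` ball (x ord0 j) e)).
  apply: bigsetI_measurable => j _; rewrite -[X in measurable X]setTI.
  by apply: measurable_coor => //; exact: (@measurable_ball R).
rewrite -bigcap_seq; apply/seteqP; split => y.
- by move=> [_ xy] j _; exact: (xy _).
- by move=> xy; split => // i j; rewrite (ord1 i); apply: xy; rewrite /= mem_index_enum.
Qed.

(** The sigma-algebra is generated by coordinates, so an open set is written as the countable union
    of the sup balls inside it that have rational centre and radius 1/(m+1); [pickle] enumerates
    them. *)
Lemma open_measurable_rV (A : set 'rV[R]_n) : open A -> measurable A.
Proof.
move=> oA.
pose B k : set 'rV[R]_n :=
  if @unpickle ('rV[rat]_n * nat)%type k is Some (q, m) then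
    let b := @ball R _ (map_mx ratr q : 'rV[R]_n) m.+1%:R^-1 in
    if `[< b `<=` A >] then b else set0 else set0.
rewrite (_ : A = \bigcup_k B k).
  apply: bigcup_measurable => k _; rewrite /B.
  case: unpickle => [[q m]|]; last exact: measurable0.
  by case: asboolP => _; [exact: measurable_ball_rV|exact: measurable0].
apply/seteqP; split => [x Ax|x [k _]]; last first.
  rewrite /B; case: unpickle => [[q m]|//].
  by case: asboolP => // + ?; exact.
have /nbhs_ballP[e /= e0 xeA] : nbhs x A by exact: open_nbhs_nbhs.
(* Half of [e], because a point of the rational ball is reached from x through the rational
   centre. *)
have [m me] : exists m, m.+1%:R^-1 < e / 2.
  have := @near_infty_natSinv_lt R (PosNum (divr_gt0 e0 (ltr0n _ 2))).
  by move=> [m _ /(_ m (leqnn m))] me; exists m.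
have /choice[q qx] : forall j : 'I_n, exists q : rat, `|x ord0 j - ratr q| < m.+1%:R^-1.
  move=> j; have : x ord0 j - m.+1%:R^-1 < x ord0 j + m.+1%:R^-1.
    by rewrite ltrBlDr -addrA ltrDl addr_gt0// invr_gt0.
  move=> /rat_in_itvoo[q]; rewrite in_itv/= => /andP[q1 q2]; exists q.
  move: q1 q2; set e1 := _^-1 => q1 q2.
  by rewrite ltr_norml; apply/andP; split; lra.
exists (pickle (\row_j q j, m)) => //; rewrite /B pickleK.
case: asboolP => [_|[]].
  by split; [rewrite invr_gt0|move=> i j; rewrite (ord1 i) !mxE /ball/= distrC].
move=> y [_ qy]; apply: xeA; split => // i j; rewrite (ord1 i).
have := qy ord0 j; rewrite !mxE /ball/= => qyj.
rewrite (splitr e) (le_lt_trans (ler_distD (ratr (q j)) _ _))// ltrD//.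
  exact: lt_trans (qx j) me.
exact: lt_trans me.
Qed.

Lemma continuous_measurable_rV (u : 'rV[R]_n -> R) :
  continuous u -> measurable_fun setT u.
Proof.
move=> cu; apply: (measurability (@RGenOInfty.G R)).
  exact: RGenOInfty.measurableE.
move=> _ [_ [x ->] <-]; rewrite setTI; apply: open_measurable_rV.
by apply: open_comp => [? _|]; [exact: cu|rewrite set_itvE; exact: open_gt].
Qed.

End rV_measurability.

(** * Change of variables under translations and dilations *)

Section affine_change_of_variables.
Context {R : realType}.
Local Open Scope ereal_scope.

Lemma measurable_affine (a s : R) :
  measurable_fun setT (fun t : measurableTypeR R => (a + s * t)%R : measurableTypeR R).
Proof. by apply: measurable_funD => //; exact: measurable_funM. Qed.

(** Uniqueness of Lebesgue measure: the rescaled image measure is compared with it on half-open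
    intervals only. *)
Lemma lebesgue_measure_affine (a s : R) A : s != 0%R -> measurable A ->
  lebesgue_measure A = `|s|%:E *
    @lebesgue_measure R ((fun t : measurableTypeR R => (a + s * t)%R : measurableTypeR R) @^-1` A).
Proof.
move=> s0 mA.
pose aff (t : measurableTypeR R) : measurableTypeR R := (a + s * t)%R.
have maff : measurable_fun setT aff by exact: measurable_affine.
pose k : {nonneg R} := NngNum (normr_ge0 s).
pose m1 : {measure set (measurableTypeR R) -> \bar R} :=
  measure_function_pushforward__canonical__measure_function_Measure
    (@lebesgue_measure R) maff.
rewrite -[RHS]/(mscale k m1 A).
apply: (@lebesgue_measure_unique R (mscale k m1)) => [{mA}_ [[b c]] _ <-|//].
rewrite -[RHS]/(`|s|%:E * lebesgue_measure (aff @^-1` _)) lebesgue_measure_itv/= lte_fin.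
have [{}s0|{}s0|/eqP] := ltgtP 0%R s; last by rewrite eq_sym (negbTE s0).
- rewrite (_ : aff @^-1` _ = `](b - a) / s, (c - a) / s]%classic)%R; last first.
    apply/seteqP; split => t; rewrite /aff/= !in_itv/=;
      by rewrite ltr_pdivrMr// ler_pdivlMr// ltrBlDl lerBrDl mulrC.
  rewrite lebesgue_measure_itv/= lte_fin ltr_pM2r ?invr_gt0// ltrD2r.
  case: ifPn => _; last by rewrite mule0.
  rewrite -!EFinB -EFinM gtr0_norm//; congr EFin; field; exact: lt0r_neq0.
(* A negative factor exchanges the endpoints, hence the interval is open on the other side; its
   length is unaffected. *)
- rewrite (_ : aff @^-1` _ = `[(c - a) / s, (b - a) / s[%classic)%R; last first.
    apply/seteqP; split => t; rewrite /aff/= !in_itv/=;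
      by rewrite ler_ndivrMr// ltr_ndivlMr// ltrBlDl lerBrDl mulrC andbC.
  rewrite lebesgue_measure_itv/= lte_fin ltr_nM2r ?invr_lt0// ltrD2r.
  case: ifPn => _; last by rewrite mule0.
  rewrite -!EFinB -EFinM ltr0_norm//; congr EFin; field; exact: ltr0_neq0.
Qed.

Lemma ge0_integral_affine1 (a s : R) (F : R -> \bar R) : s != 0%R ->
  measurable_fun setT F -> (forall t, 0 <= F t) ->
  \int[lebesgue_measure]_t F (a + s * t)%R =
  (`|s|^-1)%:E * \int[lebesgue_measure]_t F t.
Proof.
move=> s0 mF F0.
pose aff (t : measurableTypeR R) : measurableTypeR R := (a + s * t)%R.
have maff : measurable_fun setT aff by exact: measurable_affine.
pose k : {nonneg R} := NngNum (normr_ge0 s).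
pose m1 : {measure set (measurableTypeR R) -> \bar R} :=
  measure_function_pushforward__canonical__measure_function_Measure
    (@lebesgue_measure R) maff.
have -> : \int[lebesgue_measure]_t F t = \int[mscale k m1]_t F t.
  apply: eq_measure_integral => A mA _; rewrite /mscale/= /pushforward.
  by rewrite (lebesgue_measure_affine a s0 mA).
rewrite ge0_integral_mscale// muleA -EFinM mulVf ?normr_eq0// mul1e.
by rewrite /m1/= (ge0_integral_pushforward maff).
Qed.

(** Tonelli's theorem for the product measure whose image under [rV_cons] defines
    [lebesgue_rV n.+1]; it carries the inductions on the dimension. *)
Lemma ge0_integral_rVS n (F : 'rV[R]_n.+1 -> \bar R) :
  measurable_fun setT F -> (forall x, 0 <= F x) ->
  \int[lebesgue_rV n.+1]_x F x =
  \int[lebesgue_measure]_a \int[lebesgue_rV n]_v F (rV_cons (a, v)).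
Proof.
move=> mF F0; have mc := @measurable_rV_cons R n.
transitivity (\int[pushforward (lebesgue_measure \x lebesgue_rV n) (@rV_cons R n)]_x F x).
  by apply: eq_measure_integral.
rewrite (ge0_integral_pushforward mc)// preimage_setT.
by rewrite fubini_tonelli1//; [exact: (measurableT_comp mF mc)|move=> x; exact: F0].
Qed.

Lemma rV0_all_equal (x y : 'rV[R]_0) : x = y.
Proof. by apply/rowP; case. Qed.

Lemma measurable_rV_affine n (z : 'rV[R]_n) (s : R) :
  measurable_fun setT (fun y : 'rV[R]_n => (z + s *: y)%R).
Proof.
apply: measurable_fun_rVP => i; under eq_fun do rewrite !mxE.
by apply: measurable_funD => //; apply: measurable_funM => //; exact: measurable_coor.
Qed.

Lemma rV_cons_affine n (z : 'rV[R]_n.+1) (s a : R) (v : 'rV[R]_n) :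
  (z + s *: rV_cons (a, v) =
   rV_cons ((z ord0 (@lshift 1 n ord0) + s * a)%R,
     \row_j z ord0 (@rshift 1 n j) + s *: v))%R.
Proof.
apply/rowP => i; have [j ->|j ->] := split_ordP (i : 'I_(1 + n)).
  by rewrite (ord1 j) mxE [X in (_ + X)%R]mxE !rV_cons0.
by rewrite mxE [X in (_ + X)%R]mxE !rV_consS !mxE.
Qed.

(** An affine map of this kind acts on each coordinate separately, so every induction step
    contributes one factor 1/|s|. *)
Lemma ge0_integral_affine n (z : 'rV[R]_n) (s : R) (F : 'rV[R]_n -> \bar R) :
  s != 0%R -> measurable_fun setT F -> (forall x, 0 <= F x) ->
  \int[lebesgue_rV n]_y F (z + s *: y)%R =
  (`|s| ^- n)%:E * \int[lebesgue_rV n]_y F y.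
Proof.
move=> s0; elim: n z F => [|n ih] z F mF F0.
  rewrite expr0 invr1 mul1e; apply: eq_integral => y _; congr F.
  exact: rV0_all_equal.
rewrite ge0_integral_rVS//; last first.
  exact: (measurableT_comp mF (measurable_rV_affine _ _)).
rewrite ge0_integral_rVS//.
pose G a := \int[lebesgue_rV n]_v F (rV_cons (a, v)).
have mFc : measurable_fun setT (fun p => F (@rV_cons R n p)).
  exact: (measurableT_comp mF (@measurable_rV_cons R n)).
have mG : measurable_fun setT G.
  exact: (measurable_fun_fubini_tonelli_F (fun p => F (@rV_cons R n p))).
have G0 a : 0 <= G a by exact: integral_ge0.
transitivity (\int[lebesgue_measure]_a ((`|s| ^- n)%:E *
    G (z ord0 (@lshift 1 n ord0) + s * a)%R)).
  apply: eq_integral => a _; under eq_integral do rewrite rV_cons_affine.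
  rewrite (ih _ (fun v => F (rV_cons (_, v))))//.
  by apply: measurableT_comp mFc _; exact: measurable_pair1.
pose Gs (a : measurableTypeR R) := G (z ord0 (@lshift 1 n ord0) + s * a)%R.
have mGs : measurable_fun setT Gs := measurableT_comp mG (measurable_affine _ _).
have sn0 : 0 <= (`|s| ^- n)%:E by rewrite lee_fin invr_ge0 exprn_ge0.
rewrite (ge0_integralZl _ measurableT mGs (fun a _ => G0 _) sn0).
rewrite (ge0_integral_affine1 _ s0 mG G0) muleA -EFinM.
by rewrite exprSr invfM.
Qed.

End affine_change_of_variables.

Lemma ge0_le_integralT d (T : measurableType d) (R : realType)
    (mu : {measure set T -> \bar R}) (f g : T -> \bar R) :
  measurable_fun setT f -> measurable_fun setT g ->
  (forall x, 0 <= f x)%E -> (forall x, f x <= g x)%E ->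
  (\int[mu]_x f x <= \int[mu]_x g x)%E.
Proof.
move=> mf mg f0 fg; apply: ge0_le_integral => // x _; exact: fg.
Qed.

Lemma ge0_integralZ_EFin d (T : measurableType d) (R : realType)
    (mu : {measure set T -> \bar R}) (k : R) (g : T -> R) :
  0 <= k -> (forall x, 0 <= g x) -> measurable_fun setT (fun x => (g x)%:E) ->
  (\int[mu]_x (k * g x)%:E = k%:E * \int[mu]_x (g x)%:E)%E.
Proof.
move=> k0 g0 mg; under eq_integral do rewrite EFinM.
by rewrite (ge0_integralZl_EFin _ measurableT)// => x _; rewrite lee_fin.
Qed.

(** * The norms on R^n and the polynomial weights *)

Section weights.
Context {R : realType} {n : nat}.
Implicit Types (x y : 'rV[R]_n).

(** The l^1 norm is additive along [rV_cons], which suits induction on the dimension; [enorm] is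
    kept for the balls. *)
Definition norm1 x : R := \sum_(i < n) `|x ord0 i|.

Lemma norm1_ge0 x : 0 <= norm1 x.
Proof. exact: sumr_ge0. Qed.

Lemma norm1D x y : norm1 (x + y) <= norm1 x + norm1 y.
Proof.
rewrite /norm1 -big_split/=; apply: ler_sum => i _; rewrite mxE; exact: ler_normD.
Qed.

Lemma norm1Z (a : R) x : norm1 (a *: x) = `|a| * norm1 x.
Proof. by rewrite /norm1 mulr_sumr; apply: eq_bigr => i _; rewrite mxE normrM. Qed.

Lemma norm1N x : norm1 (- x) = norm1 x.
Proof. by rewrite -scaleN1r norm1Z normrN1 mul1r. Qed.

Lemma coord_le_norm1 x i : `|x ord0 i| <= norm1 x.
Proof. by rewrite /norm1 (bigD1 i)//= lerDl sumr_ge0. Qed.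

Lemma dotrv_ge0 x : 0 <= dotrv x x.
Proof. by apply: sumr_ge0 => i _; rewrite -expr2 sqr_ge0. Qed.

Lemma enorm_ge0 x : 0 <= enorm x.
Proof. exact: sqrtr_ge0. Qed.

Lemma enormZ (a : R) x : enorm (a *: x) = `|a| * enorm x.
Proof.
rewrite /enorm -sqrtr_sqr -sqrtrM ?sqr_ge0//; congr Num.sqrt.
by rewrite /dotrv mulr_sumr; apply: eq_bigr => i _; rewrite !mxE; ring.
Qed.

Lemma coord_le_enorm x i : `|x ord0 i| <= enorm x.
Proof.
rewrite -sqrtr_sqr ler_sqrt ?dotrv_ge0//.
rewrite /dotrv (bigD1 i)//= expr2 lerDl sumr_ge0// => j _.
by rewrite -expr2 sqr_ge0.
Qed.

Lemma norm1_le_enorm x : norm1 x <= n%:R * enorm x.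
Proof.
rewrite mulr_natl (_ : _ *+ n = \sum_(i < n) enorm x); last by rewrite sumr_const card_ord.
by apply: ler_sum => i _; exact: coord_le_enorm.
Qed.

Lemma enorm_le_norm1 x : enorm x <= norm1 x.
Proof.
rewrite -[leRHS]ger0_norm ?norm1_ge0// -sqrtr_sqr ler_sqrt ?sqr_ge0//.
rewrite expr2 {1}/norm1 mulr_suml; apply: ler_sum => i _.
apply: (le_trans (ler_norm _)); rewrite normrM.
by apply: ler_wpM2l => //; exact: coord_le_norm1.
Qed.

Definition weight (N : nat) x : R := ((1 + norm1 x) ^+ N)^-1.

Lemma onenorm1_gt0 x : 0 < 1 + norm1 x.
Proof. by rewrite ltr_pwDl// norm1_ge0. Qed.

Lemma onenorm1_ge1 x : 1 <= 1 + norm1 x.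
Proof. by rewrite lerDl norm1_ge0. Qed.

Lemma weight_gt0 N x : 0 < weight N x.
Proof. by rewrite invr_gt0 exprn_gt0// onenorm1_gt0. Qed.

Lemma weight_ge0 N x : 0 <= weight N x.
Proof. exact/ltW/weight_gt0. Qed.

Lemma weight_le1 N x : weight N x <= 1.
Proof. by rewrite invf_le1 ?exprn_gt0 ?onenorm1_gt0// exprn_ege1// onenorm1_ge1. Qed.

Lemma weightD N M x : weight (N + M) x = weight N x * weight M x.
Proof. by rewrite /weight exprD invfM. Qed.

Lemma weight_le N M x : (N <= M)%N -> weight M x <= weight N x.
Proof.
by move=> /subnKC <-; rewrite weightD ler_piMr ?weight_ge0 ?weight_le1.
Qed.

(** Peetre's inequality, from 1 + |x| <= (1 + |x + y|)(1 + |y|). It removes a shift from a weight at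
    a polynomial cost. *)
Lemma weight_peetre N x y : weight N (x + y) <= (1 + norm1 y) ^+ N * weight N x.
Proof.
rewrite /weight -[leLHS]mul1r ler_pdivrMr ?exprn_gt0 ?onenorm1_gt0//.
rewrite mulrAC ler_pdivlMr ?exprn_gt0 ?onenorm1_gt0// mul1r -exprMn.
rewrite lerXn2r ?nnegrE ?mulr_ge0 ?(ltW (onenorm1_gt0 _))//.
have := norm1D (x + y) (- y); rewrite addrK norm1N.
by have := norm1_ge0 (x + y); have := norm1_ge0 y; nra.
Qed.

Lemma norm1_scale_le (t : R) y : 1 + norm1 (t *: y) <= (1 + `|t|) * (1 + norm1 y).
Proof. by rewrite norm1Z; have := norm1_ge0 y; have := normr_ge0 t; nra. Qed.

Lemma measurable_norm1 : measurable_fun setT norm1.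
Proof.
apply: measurable_sum => i; apply: measurableT_comp => //.
exact: measurable_coor.
Qed.

Lemma measurable_weight N : measurable_fun setT (weight N).
Proof.
have -> : weight N = (fun t : R => t `^ (-1)) \o (fun x => (1 + norm1 x) ^+ N).
  by apply/funext => x /=; rewrite powR_inv1// exprn_ge0// ltW// onenorm1_gt0.
apply: measurableT_comp; first exact: measurable_powR.
by apply: measurable_funX; apply: measurable_funD => //; exact: measurable_norm1.
Qed.

Lemma measurable_comp_continuous d (T : measurableType d) (D : set T) (h : R -> R)
  (f : T -> R) : continuous h -> measurable_fun D f -> measurable_fun D (h \o f).
Proof. by move=> ch mf; apply: measurableT_comp mf; exact: continuous_measurable_fun. Qed.

Lemma measurable_enorm : measurable_fun setT (@enorm R n).
Proof.
have -> : @enorm R n = Num.sqrt \o (fun x => dotrv x x) by [].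
apply: measurable_comp_continuous; first exact: sqrt_continuous.
by apply: measurable_sum => i; apply: measurable_funM; exact: measurable_coor.
Qed.

Lemma measurable_eball x r : measurable (eball x r).
Proof.
rewrite (_ : eball x r = (fun y => enorm (- x + 1 *: y)) @^-1` [set t | t < r]).
  rewrite -[X in measurable X]setTI.
  apply: (measurableT_comp measurable_enorm (measurable_rV_affine (- x) 1)) => //.
  by rewrite -set_itvNyo; exact: measurable_itv.
by apply/seteqP; split => y; rewrite /eball/= scale1r addrC.
Qed.

End weights.

(** * Integrability of the weights *)

Section weight_integrals.
Context {R : realType}.
Local Open Scope ereal_scope.

Lemma norm1_cons n (a : R) (v : 'rV[R]_n) :
  norm1 (rV_cons (a, v)) = (`|a| + norm1 v)%R.
Proof.
rewrite /norm1 -[X in (\sum_(i < X) _)%R]/(1 + n)%N big_split_ord/= big_ord1.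
by rewrite rV_cons0/=; congr (_ + _)%R; apply: eq_bigr => i _; rewrite rV_consS.
Qed.

Lemma integral_oneDsqrV_lty :
  \int[@lebesgue_measure R]_t ((1 + t ^+ 2)^-1)%:E < +oo.
Proof.
have q0 (t : R) : (0 <= (oneDsqr t)^-1)%R.
  by rewrite invr_ge0 (le_trans ler01)// oneDsqr_ge1.
have qN : (fun t : R => (oneDsqr t)^-1)%R =1 (fun t => (oneDsqr t)^-1)%R \o -%R.
  by move=> t /=; rewrite /oneDsqr sqrrN.
rewrite (ge0_symfun_integralT q0 continuous_oneDsqrV qN).
rewrite (_ : [set x | (0 <= x)%R] = `[0%R, +oo[%classic); last first.
  by apply/seteqP; split => t /=; rewrite in_itv/= andbT.
by rewrite integral0y_oneDsqr -EFinM ltry.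
Qed.

(** Two powers per coordinate suffice, because 1/(1 + t^2) is integrable on the line and the
    remaining powers go to the other coordinates. *)
Lemma integral_weight_lty n N : (n.*2 <= N)%N ->
  \int[lebesgue_rV n]_x (weight N x)%:E < +oo :> \bar R.
Proof.
have mw m M : measurable_fun setT (fun x : 'rV[R]_m => (weight M x)%:E).
  by apply/measurable_EFinP; exact: measurable_weight.
have w0 m M (x : 'rV[R]_m) : 0 <= (weight M x)%:E by rewrite lee_fin weight_ge0.
move=> nN; apply: (@le_lt_trans _ _ (\int[lebesgue_rV n]_x (weight n.*2 x)%:E)).
  apply: ge0_le_integralT; [exact: mw|exact: mw|exact: w0|].
  by move=> x; rewrite lee_fin weight_le.
elim: n {N nN} => [|n ih].
  apply: (@le_lt_trans _ _ (\int[@lebesgue_rV R 0]_x (cst 1%E) x)).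
    apply: ge0_le_integralT => //; first exact: mw.
    by move=> x; rewrite lee_fin weight_le1.
  by rewrite integral_cst// mul1e /= diracE; exact: ltry.
rewrite ge0_integral_rVS//.
set I := \int[lebesgue_rV n]_x _ in ih.
have I0 : 0 <= I by exact: integral_ge0.
have mW : measurable_fun setT (fun p : measurableTypeR R * 'rV[R]_n =>
    (weight n.+1.*2 (rV_cons p))%:E).
  exact: (measurableT_comp (mw _ _) (@measurable_rV_cons R n)).
have mq : measurable_fun setT (fun t : measurableTypeR R => ((1 + t ^+ 2)^-1)%:E : \bar R).
  apply/measurable_EFinP.
  exact: (continuous_measurable_fun (@continuous_oneDsqrV R)).
have q0 (t : R) : (0 <= (1 + t ^+ 2)^-1)%R.
  by rewrite invr_ge0 addr_ge0// sqr_ge0.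
apply: (@le_lt_trans _ _ (\int[lebesgue_measure]_t (((1 + t ^+ 2)^-1)%:E * I))).
  apply: ge0_le_integralT.
  - exact: (measurable_fun_fubini_tonelli_F _ mW).
  - exact: emeasurable_funM.
  - by move=> t; exact: integral_ge0.
  move=> a; rewrite -ge0_integralZl//; [|exact: mw|by rewrite lee_fin].
  apply: ge0_le_integralT.
  - by apply: measurableT_comp mW _; exact: measurable_pair1.
  - by apply: emeasurable_funM; [exact: measurable_cst|exact: mw].
  - by [].
  (* Two of the powers are bounded using [a] alone, the other 2n using [v] alone. *)
  move=> v; rewrite -EFinM lee_fin doubleS -addn2 addnC weightD /weight norm1_cons.
  have vge0 := norm1_ge0 v.
  apply: ler_pM => //; rewrite ?invr_ge0 ?exprn_ge0 ?addr_ge0//.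
    rewrite lef_pV2 ?posrE ?exprn_gt0 ?ltr_pwDl ?addr_ge0 ?sqr_ge0//.
    by rewrite -[(a ^+ 2)%R]real_normK ?num_real//; have := normr_ge0 a; nra.
  rewrite lef_pV2 ?posrE ?exprn_gt0 ?ltr_pwDl ?addr_ge0//.
  by rewrite lerXn2r ?nnegrE ?addr_ge0// lerD2l lerDr.
have q0' (t : measurableTypeR R) : setT t -> 0 <= ((1 + t ^+ 2)^-1)%:E by rewrite lee_fin.
rewrite (ge0_integralZr _ measurableT mq q0' I0).
rewrite lte_mul_pinfty//; first exact: integral_ge0.
by rewrite ge0_fin_numE ?integral_oneDsqrV_lty ?integral_ge0.
Qed.

End weight_integrals.

(** * Volumes of Euclidean balls *)

Section balls.
Context {R : realType}.
Local Open Scope ereal_scope.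

(** Nontriviality of the measure gives balls positive volume and makes essential suprema of
    nonnegative functions nonnegative. *)
Lemma lebesgue_rV_setT_gt0 n : 0 < @lebesgue_rV R n setT.
Proof.
elim: n => [|n ih]; first by rewrite /= diracT.
suff -> : @lebesgue_rV R n.+1 setT = @lebesgue_measure R setT * @lebesgue_rV R n setT.
  by rewrite -set_itvNyy lebesgue_measure_itv/= mule_gt0// addye.
rewrite -[LHS]/(pushforward (@lebesgue_measure R \x lebesgue_rV n)%E (@rV_cons R n) setT).
by rewrite /pushforward preimage_setT -setXTT product_measure1E.
Qed.

Context {n : nat}.
Local Notation mu := (@lebesgue_rV R n).
Implicit Types (c z : 'rV[R]_n) (s r : R) (F : 'rV[R]_n -> \bar R).

(** Positive and negative parts are transformed separately. The final case analysis factors a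
    positive real out of their difference even when both integrals are infinite. *)
Lemma integral_affine_in z s (A : set 'rV[R]_n) F : s != 0%R ->
  measurable A -> measurable_fun A F ->
  \int[mu]_(x in A) F x = (`|s| ^+ n)%:E *
    \int[mu]_(y in (fun y => z + s *: y)%R @^-1` A) F (z + s *: y)%R.
Proof.
move=> s0.
pose aff (y : 'rV[R]_n) : 'rV[R]_n := (z + s *: y)%R.
have sn0 : (0 < `|s| ^+ n)%R by rewrite exprn_gt0// normr_gt0.
have ge0 (B : set 'rV[R]_n) G : measurable B -> measurable_fun B G ->
    (forall x, 0 <= G x) -> \int[mu]_(x in B) G x =
    (`|s| ^+ n)%:E * \int[mu]_(y in aff @^-1` B) G (aff y).
  move=> mB mG G0; rewrite integral_mkcond [in RHS]integral_mkcond.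
  have mGB : measurable_fun setT (G \_ B) by apply/(measurable_restrictT _ mB).
  have GB0 x : 0 <= (G \_ B) x by rewrite patchE; case: ifP.
  rewrite -[LHS]mul1e (_ : 1 = (`|s| ^+ n)%:E * (`|s| ^- n)%:E); last first.
    by rewrite -EFinM divff// gt_eqF.
  by rewrite -muleA -(ge0_integral_affine z s0 mGB GB0); congr *%E.
move=> mA mF; rewrite integralE [in RHS]integralE.
rewrite (ge0 _ _ mA (measurable_funepos mF))// (ge0 _ _ mA (measurable_funeneg mF))//.
pose a := \int[mu]_(y in aff @^-1` A) (F^\+ (aff y)).
pose b := \int[mu]_(y in aff @^-1` A) (F^\- (aff y)).
rewrite -[LHS]/((`|s| ^+ n)%:E * a - (`|s| ^+ n)%:E * b).
rewrite -[in RHS]/(F \o aff) funepos_comp funeneg_comp -[RHS]/((`|s| ^+ n)%:E * (a - b)).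
move: a b => [a| |] [b| |];
  rewrite ?(gt0_muley, gt0_muleNy, lte_fin) //= -?EFinB -?EFinM -?EFinB ?mulrBr//;
  by rewrite ?(gt0_muley, gt0_muleNy, lte_fin) //= ?mulrN ?mulrBr.
Qed.

Lemma eball_affine z s c r : s != 0%R ->
  (fun y => z + s *: y)%R @^-1` eball (z + s *: c)%R (`|s| * r)%R = eball c r.
Proof.
move=> s0; have s_gt0 : (0 < `|s|)%R by rewrite normr_gt0.
have E y : (z + s *: y - (z + s *: c) = s *: (y - c))%R.
  by rewrite opprD addrACA subrr add0r scalerBr.
by apply/seteqP; split => y; rewrite /eball/= E enormZ ltr_pM2l.
Qed.

Lemma integral_eball_affine z s c r F : s != 0%R ->
  measurable_fun (eball (z + s *: c)%R (`|s| * r)%R) F ->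
  \int[mu]_(x in eball (z + s *: c)%R (`|s| * r)%R) F x =
  (`|s| ^+ n)%:E * \int[mu]_(y in eball c r) F (z + s *: y)%R.
Proof.
move=> s0 mF; rewrite (@integral_affine_in z s _ _ s0 (measurable_eball _ _) mF).
by rewrite eball_affine.
Qed.

Lemma mu_eball_scale c s r : (0 < s)%R ->
  mu (eball c (s * r)) = (s ^+ n)%:E * mu (eball 0 r).
Proof.
move=> s0; have mB := @measurable_eball R n.
have s1 : s != 0%R by rewrite gt_eqF.
have := @integral_eball_affine c s 0 r (cst 1) s1 (measurable_cst _).
by rewrite scaler0 addr0 gtr0_norm// !integral_cst// !mul1e.
Qed.

(** On the ball of radius r about 0 the weight of exponent 2n is at least (1 + n r)^(-2n), and the
    weight has finite integral. *)
Lemma mu_eball_lty c r : mu (eball c r) < +oo.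
Proof.
wlog r0 : r / (0 < r)%R.
  move=> h; have [r0|r0] := ltP 0%R r; first exact: h.
  apply: le_lt_trans (h 1%R ltr01); apply: le_measure; rewrite ?inE//;
    try exact: measurable_eball.
  by move=> y /= /lt_le_trans; apply; rewrite (le_trans r0).
rewrite -[r]mul1r mu_eball_scale// expr1n mul1e.
have mB : measurable (@eball R n 0 r) by exact: measurable_eball.
have K0 : (0 <= (1 + n%:R * r) ^+ n.*2 :> R)%R.
  by rewrite exprn_ge0// addr_ge0// mulr_ge0// ltW.
rewrite -[mu _]mul1e -integral_cst// integral_mkcond.
have mw : measurable_fun setT (fun x : 'rV[R]_n => (weight n.*2 x)%:E).
  by apply/measurable_EFinP; exact: measurable_weight.
apply: (@le_lt_trans _ _ (\int[mu]_x (((1 + n%:R * r) ^+ n.*2)%:E * (weight n.*2 x)%:E))).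
  apply: ge0_le_integralT.
  - by apply/(measurable_restrictT _ mB).
  - exact: emeasurable_funM.
  - by move=> x; rewrite patchE; case: ifP.
  move=> x; rewrite patchE -EFinM; case: ifPn => [|_]; last first.
    by rewrite lee_fin mulr_ge0// weight_ge0.
  rewrite inE /eball/= subr0 => xr; rewrite lee_fin ler_pdivlMr ?exprn_gt0 ?onenorm1_gt0//.
  rewrite mul1r lerXn2r ?nnegrE ?addr_ge0 ?norm1_ge0 ?mulr_ge0 ?(ltW r0)// lerD2l.
  by rewrite (le_trans (norm1_le_enorm _))// ler_wpM2l// ltW.
rewrite ge0_integralZl//; last by move=> x _; rewrite lee_fin weight_ge0.
rewrite lte_mul_pinfty ?lee_fin//; exact: integral_weight_lty.
Qed.

(** If the unit ball were null, so would be all its dilates, and hence the whole space. *)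
Lemma mu_unit_eball_gt0 : 0 < mu (eball 0 1%R).
Proof.
rewrite lt_neqAle measure_ge0 andbT; apply/eqP => B0.
have : mu.-negligible (\bigcup_k @eball R n 0 k.+1%:R).
  apply: negligible_bigcup => k; exists (eball 0 k.+1%:R); split => //.
    exact: measurable_eball.
  by have := mu_eball_scale 0 1%R (ltr0Sn R k); rewrite mulr1 -B0 mule0.
rewrite (_ : \bigcup_k _ = setT); last first.
  rewrite -subTset => x _; exists (Num.truncn (enorm x)) => //.
  by rewrite /eball/= subr0 truncnS_gt.
move=> [A [mA A0 TA]]; have := lebesgue_rV_setT_gt0 n.
by rewrite ltNge -A0 le_measure ?inE.
Qed.

Lemma volE c r : mu (eball c r) = (vol (eball c r))%:E.
Proof. by rewrite /vol fineK// ge0_fin_numE ?mu_eball_lty. Qed.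

Lemma vol_scale c s r : (0 < s)%R ->
  vol (eball c (s * r)) = (s ^+ n * vol (@eball R n 0 r))%R.
Proof. by move=> s0; apply: EFin_inj; rewrite EFinM -!volE mu_eball_scale. Qed.

Lemma vol_center c r : vol (eball c r) = vol (@eball R n 0 r).
Proof. by have := vol_scale c r ltr01; rewrite mul1r expr1n mul1r. Qed.

Lemma vol_gt0 c r : (0 < r)%R -> (0 < vol (eball c r))%R.
Proof.
move=> r0; rewrite -[r]mulr1 vol_scale// mulr_gt0 ?exprn_gt0//.
by rewrite -lte_fin -volE mu_unit_eball_gt0.
Qed.

End balls.

(** * Complex integrals *)

Section complex_modulus.
Context {R : realType}.
Local Notation normc := (@ComplexField.Normc.normc R).
Implicit Types z w : R[i].

Lemma Re_mul z w : complex.Re (z * w) =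
  complex.Re z * complex.Re w - complex.Im z * complex.Im w.
Proof. by case: z w => [a b] [c d]. Qed.

Lemma Im_mul z w : complex.Im (z * w) =
  complex.Re z * complex.Im w + complex.Im z * complex.Re w.
Proof. by case: z w => [a b] [c d]. Qed.

Lemma complex_eq z w :
  complex.Re z = complex.Re w -> complex.Im z = complex.Im w -> z = w.
Proof. by case: z w => [a b] [c d] /= -> ->. Qed.

Lemma normcE z : normc z = Num.sqrt (complex.Re z ^+ 2 + complex.Im z ^+ 2).
Proof. by case: z. Qed.

Lemma normc_ge0 z : 0 <= normc z.
Proof. by rewrite normcE sqrtr_ge0. Qed.

Lemma normc_real (a : R) : normc (a%:C)%C = `|a|.
Proof. by rewrite normcE /= expr0n addr0 sqrtr_sqr. Qed.

Lemma normcD z w : normc (z + w) <= normc z + normc w.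
Proof. exact: (@le_normcD R z w). Qed.

Lemma normc_opp z : normc (- z) = normc z.
Proof. exact: (@normcN R z). Qed.

Lemma normcM z w : normc (z * w) = normc z * normc w.
Proof. exact: ComplexField.Normc.normcM. Qed.

Lemma normc_distD v z w : normc (z - w) <= normc (z - v) + normc (v - w).
Proof. by apply: le_trans (normcD _ _); rewrite addrA subrK. Qed.

Lemma normc_gt0 z : z != 0 -> 0 < normc z.
Proof.
move=> z0; rewrite lt_neqAle normc_ge0 andbT eq_sym.
by apply: contra z0 => /eqP /ComplexField.Normc.eq0_normc ->.
Qed.

Lemma Re_le_normc z : `|complex.Re z| <= normc z.
Proof. by rewrite normcE -sqrtr_sqr ler_sqrt ?addr_ge0 ?sqr_ge0// lerDl sqr_ge0. Qed.

Lemma Im_le_normc z : `|complex.Im z| <= normc z.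
Proof. by rewrite normcE -sqrtr_sqr ler_sqrt ?addr_ge0 ?sqr_ge0// lerDr sqr_ge0. Qed.

Lemma normc_le z : normc z <= `|complex.Re z| + `|complex.Im z|.
Proof.
rewrite normcE -[leRHS]ger0_norm ?addr_ge0// -sqrtr_sqr ler_sqrt ?sqr_ge0//.
by rewrite sqrrD !real_normK ?num_real// lerD2r lerDl mulrn_wge0 ?mulr_ge0.
Qed.

End complex_modulus.

Section cmeasurability.
Context {R : realType} {n : nat}.
Implicit Types (D : set 'rV[R]_n) (f g : 'rV[R]_n -> R[i]).
Local Notation normc := (@ComplexField.Normc.normc R).

Lemma cmeasurable_cst D (z : R[i]) : cmeasurable_fun D (fun=> z).
Proof. by split; exact: measurable_cst. Qed.

Lemma cmeasurableD D f g : cmeasurable_fun D f -> cmeasurable_fun D g ->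
  cmeasurable_fun D (fun x => f x + g x).
Proof.
move=> [f1 f2] [g1 g2]; split.
- rewrite (_ : (fun _ => _) = (fun x => complex.Re (f x) + complex.Re (g x))).
    exact: measurable_funD.
  by apply/funext => x; rewrite raddfD.
- rewrite (_ : (fun _ => _) = (fun x => complex.Im (f x) + complex.Im (g x))).
    exact: measurable_funD.
  by apply/funext => x; rewrite raddfD.
Qed.

Lemma cmeasurableN D f : cmeasurable_fun D f -> cmeasurable_fun D (fun x => - f x).
Proof.
move=> [f1 f2]; split.
- rewrite (_ : (fun _ => _) = (fun x => - complex.Re (f x))).
    exact: measurable_funN.
  by apply/funext => x; rewrite raddfN.
- rewrite (_ : (fun _ => _) = (fun x => - complex.Im (f x))).
    exact: measurable_funN.
  by apply/funext => x; rewrite raddfN.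
Qed.

Lemma cmeasurableB D f g : cmeasurable_fun D f -> cmeasurable_fun D g ->
  cmeasurable_fun D (fun x => f x - g x).
Proof. by move=> mf mg; apply: cmeasurableD => //; exact: cmeasurableN. Qed.

Lemma cmeasurableM D f g : cmeasurable_fun D f -> cmeasurable_fun D g ->
  cmeasurable_fun D (fun x => f x * g x).
Proof.
move=> [f1 f2] [g1 g2]; split.
- rewrite (_ : (fun _ => _) = (fun x => complex.Re (f x) * complex.Re (g x) -
      complex.Im (f x) * complex.Im (g x))).
    by apply: measurable_funB; exact: measurable_funM.
  by apply/funext => x; rewrite Re_mul.
- rewrite (_ : (fun _ => _) = (fun x => complex.Re (f x) * complex.Im (g x) +
      complex.Im (f x) * complex.Re (g x))).
    by apply: measurable_funD; exact: measurable_funM.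
  by apply/funext => x; rewrite Im_mul.
Qed.

Lemma cmeasurable_affine (z : 'rV[R]_n) (s : R) f : cmeasurable_fun setT f ->
  cmeasurable_fun setT (fun y => f (z + s *: y)).
Proof.
move=> [f1 f2]; split.
- exact: (measurableT_comp f1 (measurable_rV_affine z s)).
- exact: (measurableT_comp f2 (measurable_rV_affine z s)).
Qed.

Lemma cmeasurableS D f : cmeasurable_fun setT f -> cmeasurable_fun D f.
Proof. by move=> [f1 f2]; split; exact: measurable_funTS. Qed.

Lemma measurable_normc d (T : measurableType d) (D : set T) (h : T -> R[i]) :
  measurable_fun D (fun x => complex.Re (h x)) ->
  measurable_fun D (fun x => complex.Im (h x)) ->
  measurable_fun D (fun x => normc (h x)).
Proof.
move=> h1 h2; rewrite (_ : (fun _ => _) = Num.sqrt \o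
    (fun x => complex.Re (h x) ^+ 2 + complex.Im (h x) ^+ 2)); last first.
  by apply/funext => x /=; rewrite normcE.
apply: measurable_comp_continuous; first exact: sqrt_continuous.
by apply: measurable_funD; exact: measurable_funX.
Qed.

Lemma emeasurable_normc D f : cmeasurable_fun D f ->
  measurable_fun D (fun x => (normc (f x))%:E).
Proof. by move=> [f1 f2]; apply/measurable_EFinP; exact: measurable_normc. Qed.

End cmeasurability.

Section cintegral_theory.
Context {R : realType} {n : nat}.
Implicit Types (D : set 'rV[R]_n) (f g : 'rV[R]_n -> R[i]).
Local Notation normc := (@ComplexField.Normc.normc R).
Local Notation mu := (@lebesgue_rV R n).

Lemma cintegrable_measurable D f : cintegrable D f -> cmeasurable_fun D f.
Proof. by move=> [/measurable_int/measurable_EFinP ? /measurable_int/measurable_EFinP ?]. Qed.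

Lemma cintegrableP D f : measurable D -> cmeasurable_fun D f ->
  (\int[mu]_(x in D) (normc (f x))%:E < +oo)%E <-> cintegrable D f.
Proof.
move=> mD mf; have [mf1 mf2] := mf; have mnf := emeasurable_normc mf; split.
- move=> foo.
  have h : mu.-integrable D (fun x => (normc (f x))%:E).
    apply/integrableP; split => //; apply: le_lt_trans foo.
    by under eq_integral => x _ do rewrite gee0_abs ?lee_fin ?normc_ge0//.
  split; apply: le_integrable h => //; try exact/measurable_EFinP.
  + by move=> x _; rewrite /= lee_fin (le_trans (Re_le_normc _))// ger0_norm// normc_ge0.
  + by move=> x _; rewrite /= lee_fin (le_trans (Im_le_normc _))// ger0_norm// normc_ge0.
- move=> [/integrableP[_ i1] /integrableP[_ i2]].
  apply: (@le_lt_trans _ _ (\int[mu]_(x in D) (`|(complex.Re (f x))%:E| + `|(complex.Im (f x))%:E|)))%E.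
    apply: ge0_le_integral => //.
    + by move=> x _; rewrite lee_fin normc_ge0.
    + by apply: emeasurable_funD; apply: measurableT_comp => //; exact/measurable_EFinP.
    + by move=> x _; rewrite /= -EFinD lee_fin normc_le.
  rewrite ge0_integralD//; first exact: lte_add_pinfty.
  + by apply: measurableT_comp => //; exact/measurable_EFinP.
  + by apply: measurableT_comp => //; exact/measurable_EFinP.
Qed.

Lemma le_cintegrable D f (g : 'rV[R]_n -> R) : measurable D -> cmeasurable_fun D f ->
  measurable_fun D g -> (forall x, D x -> normc (f x) <= g x) ->
  (\int[mu]_(x in D) (g x)%:E < +oo)%E -> cintegrable D f.
Proof.
move=> mD mf mg fg goo; apply/cintegrableP => //; apply: le_lt_trans goo.
apply: ge0_le_integral => //.
- by move=> x _; rewrite lee_fin normc_ge0.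
- exact: emeasurable_normc.
- exact/measurable_EFinP.
Qed.

Lemma cintegralD D f g : measurable D -> cintegrable D f -> cintegrable D g ->
  cintegral D (fun x => f x + g x) = cintegral D f + cintegral D g.
Proof.
move=> mD [f1 f2] [g1 g2]; apply: complex_eq; rewrite raddfD/= -RintegralD//;
  by apply: eq_Rintegral => x _; rewrite raddfD.
Qed.

Lemma cintegralZ D (c : R[i]) f : measurable D -> cintegrable D f ->
  cintegral D (fun x => c * f x) = c * cintegral D f.
Proof.
move=> mD [f1 f2]; have Zi (a : R) h : mu.-integrable D (EFin \o h) ->
    mu.-integrable D (EFin \o (fun x => a * h x)).
  by move=> ih; rewrite (_ : _ \o _ = (fun x => a%:E * (h x)%:E)%E)//; exact: integrableZl.
apply: complex_eq; rewrite ?Re_mul ?Im_mul/=.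
- rewrite -!RintegralZl// -RintegralB//; try exact: Zi.
  by apply: eq_Rintegral => x _; rewrite Re_mul.
- rewrite -!RintegralZl// -RintegralD//; try exact: Zi.
  by apply: eq_Rintegral => x _; rewrite Im_mul.
Qed.

Lemma cintegrableZ D (c : R[i]) f : measurable D -> cintegrable D f ->
  cintegrable D (fun x => c * f x).
Proof.
move=> mD fi; have mf := cintegrable_measurable fi.
have mZ : cmeasurable_fun D (fun x => c * f x).
  by apply: cmeasurableM => //; exact: cmeasurable_cst.
apply/cintegrableP => //; under eq_integral do rewrite normcM EFinM.
rewrite ge0_integralZl_EFin//; last 3 first.
- by move=> x _; rewrite lee_fin normc_ge0.
- exact: emeasurable_normc.
- exact: normc_ge0.
by rewrite lte_mul_pinfty ?lee_fin ?normc_ge0//; apply/cintegrableP.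
Qed.

Lemma cintegralB D f g : measurable D -> cintegrable D f -> cintegrable D g ->
  cintegral D (fun x => f x - g x) = cintegral D f - cintegral D g.
Proof.
move=> mD fi gi; rewrite -mulN1r -cintegralZ// -cintegralD//; last exact: cintegrableZ.
by congr cintegral; apply/funext => x; rewrite mulN1r.
Qed.

Lemma eq_cintegral D f g : (forall x, D x -> f x = g x) -> cintegral D f = cintegral D g.
Proof.
by move=> fg; congr Complex; apply: eq_Rintegral => x; rewrite inE => Dx; rewrite fg.
Qed.

(* The constant 2 comes from estimating real and imaginary parts separately;
   it is not optimal. *)
Lemma normc_cintegral_le D f : measurable D -> cintegrable D f ->
  ((normc (cintegral D f))%:E <= 2%:E * \int[mu]_(x in D) (normc (f x))%:E)%E.
Proof.
move=> mD fi; have mf := cintegrable_measurable fi.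
have /cintegrableP foo := fi; move/(_ mD mf) in foo.
have [f1 f2] := fi.
have I0 : (0 <= \int[mu]_(x in D) (normc (f x))%:E)%E.
  by apply: integral_ge0 => x _; rewrite lee_fin normc_ge0.
have /fineK <- : (\int[mu]_(x in D) (normc (f x))%:E)%E \is a fin_num by rewrite ge0_fin_numE.
rewrite -EFinM lee_fin (le_trans (normc_le _))//= mulr_natl mulr2n.
have mn : measurable_fun D (fun x => normc (f x)).
  by case: mf => ? ?; exact: measurable_normc.
have ni : mu.-integrable D (EFin \o (fun x => normc (f x))).
  apply/integrableP; split; first exact/measurable_EFinP.
  by under eq_integral => x _ do rewrite gee0_abs ?lee_fin ?normc_ge0//.
apply: lerD; apply: (le_trans (le_normr_Rintegral _ _)) => //;
  apply: le_Rintegral => //; try exact: integrable_norm.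
- by move=> x _; exact: Re_le_normc.
- by move=> x _; exact: Im_le_normc.
Qed.

Lemma cintegral_affine_in (z : 'rV[R]_n) (s : R) D f : s != 0 -> measurable D ->
  cmeasurable_fun D f ->
  cintegral D f = ((`|s| ^+ n)%:C)%C *
    cintegral ((fun y => z + s *: y) @^-1` D) (fun y => f (z + s *: y)).
Proof.
move=> s0 mD [f1 f2].
(* [fine] vanishes at both infinities, so this also covers integrals that are not finite. *)
have fM (k : R) (x : \bar R) : fine (k%:E * x) = k * fine x.
  have [k0|k0|->] := ltgtP k 0; last by rewrite mul0e mul0r.
  - case: x => [x||] //=; rewrite ?lt0_muley ?lt0_muleNy ?lte_fin//= mulr0//.
  - case: x => [x||] //=; rewrite ?gt0_muley ?gt0_muleNy ?lte_fin//= mulr0//.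
apply: complex_eq; rewrite ?Re_mul ?Im_mul/= mul0r ?subr0 ?addr0 /Rintegral
  (@integral_affine_in _ _ z s _ _ s0 mD) ?fM//; exact/measurable_EFinP.
Qed.

End cintegral_theory.

(** * Fubini's theorem for complex functions *)

Section fubini.
Context {R : realType} {n : nat}.
Local Notation mu := (@lebesgue_rV R n).
Local Notation V := 'rV[R]_n.
Local Notation normc := (@ComplexField.Normc.normc R).

Definition cmeasurable2 (F : V -> V -> R[i]) :=
  measurable_fun [set: V * V] (fun p => complex.Re (F p.1 p.2)) /\
  measurable_fun [set: V * V] (fun p => complex.Im (F p.1 p.2)).

Lemma cmeasurable2_swap F : cmeasurable2 F -> cmeasurable2 (fun x y => F y x).
Proof.
by move=> [F1 F2]; split; [exact: (measurableT_comp F1 (@measurable_swap _ _ V V))|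
  exact: (measurableT_comp F2 (@measurable_swap _ _ V V))].
Qed.

Lemma cmeasurable2_fst (f : V -> R[i]) : cmeasurable_fun setT f ->
  cmeasurable2 (fun x _ => f x).
Proof. by move=> [f1 f2]; split; [exact: (measurableT_comp f1 (@measurable_fst _ _ V V))|
  exact: (measurableT_comp f2 (@measurable_fst _ _ V V))]. Qed.

Lemma cmeasurable2_snd (f : V -> R[i]) : cmeasurable_fun setT f ->
  cmeasurable2 (fun _ y => f y).
Proof. by move=> [f1 f2]; split; [exact: (measurableT_comp f1 (@measurable_snd _ _ V V))|
  exact: (measurableT_comp f2 (@measurable_snd _ _ V V))]. Qed.

Lemma cmeasurable2_affine (f : V -> R[i]) (s : R) : cmeasurable_fun setT f ->
  cmeasurable2 (fun x y => f (x + s *: y)).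
Proof.
move=> [f1 f2].
have maff : measurable_fun setT (fun p : V * V => p.1 + s *: p.2).
  apply: measurable_fun_rVP => i; under eq_fun do rewrite !mxE.
  apply: measurable_funD; first exact: (measurableT_comp (measurable_coor i) (@measurable_fst _ _ V V)).
  by apply: measurable_funM => //; exact: (measurableT_comp (measurable_coor i) (@measurable_snd _ _ V V)).
by split; [exact: (measurableT_comp f1 maff)|exact: (measurableT_comp f2 maff)].
Qed.

Lemma cmeasurable2M F G : cmeasurable2 F -> cmeasurable2 G ->
  cmeasurable2 (fun x y => F x y * G x y).
Proof.
move=> [F1 F2] [G1 G2]; split.
- rewrite (_ : (fun _ => _) = (fun p => complex.Re (F p.1 p.2) * complex.Re (G p.1 p.2) -
      complex.Im (F p.1 p.2) * complex.Im (G p.1 p.2))).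
    by apply: measurable_funB; exact: measurable_funM.
  by apply/funext => x; rewrite Re_mul.
- rewrite (_ : (fun _ => _) = (fun p => complex.Re (F p.1 p.2) * complex.Im (G p.1 p.2) +
      complex.Im (F p.1 p.2) * complex.Re (G p.1 p.2))).
    by apply: measurable_funD; exact: measurable_funM.
  by apply/funext => x; rewrite Im_mul.
Qed.

Lemma cmeasurable2_section1 F x : cmeasurable2 F -> cmeasurable_fun setT (F x).
Proof.
by move=> [F1 F2]; split; [exact: (measurableT_comp F1 (measurable_pair1 x))|
  exact: (measurableT_comp F2 (measurable_pair1 x))].
Qed.

Lemma emeasurable_normc2 F : cmeasurable2 F ->
  measurable_fun [set: V * V] (fun p => (normc (F p.1 p.2))%:E).
Proof. by move=> [F1 F2]; apply/measurable_EFinP; exact: measurable_normc. Qed.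

(** The parameter integrals of the positive and negative parts are measurable by Tonelli's theorem,
    and subtraction and [fine] preserve this. *)
Lemma measurable_Rintegral_param (F : V * V -> R) : measurable_fun setT F ->
  measurable_fun setT (fun x => \int[mu]_y F (x, y)).
Proof.
move=> mF; apply: (@measurableT_comp _ _ _ _ _ _ fine); first exact: fine_measurable.
have mE : measurable_fun setT (EFin \o F) by exact/measurable_EFinP.
pose E := EFin \o F : V * V -> \bar R.
rewrite (_ : (fun _ => _) = (fun x => (\int[mu]_y E^\+ (x, y) - \int[mu]_y E^\- (x, y))%E)).
  apply: emeasurable_funB.
  - exact: (@measurable_fun_fubini_tonelli_F _ _ V V R mu _ (measurable_funepos mE) (funepos_ge0 E)).
  - exact: (@measurable_fun_fubini_tonelli_F _ _ V V R mu _ (measurable_funeneg mE) (funeneg_ge0 E)).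
apply/funext => x; rewrite integralE.
under eq_integral do rewrite (funepos_comp E)/=.
by under [X in (_ - X = _)%E]eq_integral do rewrite (funeneg_comp E)/=.
Qed.

Lemma cmeasurable_cintegral F : cmeasurable2 F ->
  cmeasurable_fun setT (fun x => cintegral setT (F x)).
Proof.
move=> [F1 F2]; split; [exact: (measurable_Rintegral_param F1)|
  exact: (measurable_Rintegral_param F2)].
Qed.

(** An integrable function is finite almost everywhere. This reconciles the real-valued inner
    integrals of [Rfubini] with the extended-valued ones of Fubini's theorem. *)
Lemma integral_fine (G : V -> \bar R) : mu.-integrable setT G ->
  (\int[mu]_x (fine (G x))%:E = \int[mu]_x G x)%E.
Proof.
move=> iG; have mG := measurable_int _ iG.
apply: ae_eq_integral => //.
  by apply/measurable_EFinP; apply: measurableT_comp mG; exact: fine_measurable.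
have := integrable_ae measurableT iG.
by apply: filterS => x /= h xT; rewrite fineK// h.
Qed.

Lemma Rfubini (F : V * V -> R) : measurable_fun setT F ->
  (\int[mu]_x \int[mu]_y `|F (x, y)|%:E < +oo)%E ->
  \int[mu]_x \int[mu]_y F (x, y) = \int[mu]_y \int[mu]_x F (x, y).
Proof.
move=> mF Foo; have mE : measurable_fun setT (EFin \o F) by exact/measurable_EFinP.
have iF : (mu \x mu)%E.-integrable setT (EFin \o F) by apply/integrable12ltyP.
rewrite /Rintegral; congr fine.
rewrite (integral_fine (integrable_fubini_F iF)).
have mE' : measurable_fun [set: V * V] (fun p => (F (p.2, p.1))%:E).
  exact: (measurableT_comp mE (@measurable_swap _ _ V V)).
have iF' : (mu \x mu)%E.-integrable [set: V * V] (fun p => (F (p.2, p.1))%:E).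
  apply/integrable12ltyP => //; move: Foo.
  have /(fubini_tonelli (m1 := mu) (m2 := mu)) : measurable_fun [set: V * V] (abse \o (EFin \o F)).
    exact: measurableT_comp.
  by move=> /= <-.
rewrite (integral_fine (integrable_fubini_F iF')).
exact: (Fubini iF).
Qed.

Lemma abs_integral_lty (F : V -> V -> R[i]) (h : R[i] -> R) :
  measurable_fun [set: V * V] (fun p => h (F p.1 p.2)) -> cmeasurable2 F ->
  (forall z, `|h z| <= normc z) ->
  (\int[mu]_x \int[mu]_y (normc (F x y))%:E < +oo)%E ->
  (\int[mu]_x \int[mu]_y `|h (F x y)|%:E < +oo)%E.
Proof.
move=> mh mF hF; apply: le_lt_trans.
have mn := emeasurable_normc2 mF.
have n0 (p : V * V) : (0 <= (normc (F p.1 p.2))%:E)%E by rewrite lee_fin normc_ge0.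
have h0 (p : V * V) : (0 <= `|h (F p.1 p.2)|%:E)%E by rewrite lee_fin.
have mah : measurable_fun [set: V * V] (fun p => `|h (F p.1 p.2)|%:E).
  by apply/measurable_EFinP; exact: measurableT_comp.
apply: ge0_le_integralT.
- exact: (@measurable_fun_fubini_tonelli_F _ _ V V R mu _ mah h0).
- exact: (@measurable_fun_fubini_tonelli_F _ _ V V R mu _ mn n0).
- by move=> x; exact: integral_ge0.
move=> x; apply: ge0_le_integralT.
- exact: (measurableT_comp mah (measurable_pair1 x)).
- exact: (measurableT_comp mn (measurable_pair1 x)).
- by [].
- by move=> y; rewrite lee_fin.
Qed.

Lemma cfubini F : cmeasurable2 F ->
  (\int[mu]_x \int[mu]_y (normc (F x y))%:E < +oo)%E ->
  cintegral setT (fun x => cintegral setT (F x)) =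
  cintegral setT (fun y => cintegral setT (F ^~ y)).
Proof.
move=> mF Foo; have [F1 F2] := mF; apply: complex_eq => /=.
- apply: (Rfubini F1); exact: (abs_integral_lty F1 mF (@Re_le_normc R)).
- apply: (Rfubini F2); exact: (abs_integral_lty F2 mF (@Im_le_normc R)).
Qed.

(** The hypothesis of [cfubini] is checked in this way: the kernels split into a bound in each
    variable once [weight_peetre] has removed the shifts. *)
Lemma product_dominated_lty F (a b : V -> R) : cmeasurable2 F ->
  measurable_fun setT a -> measurable_fun setT b ->
  (forall x, 0 <= a x) -> (forall y, 0 <= b y) ->
  (forall x y, normc (F x y) <= a x * b y) ->
  (\int[mu]_x (a x)%:E < +oo)%E -> (\int[mu]_y (b y)%:E < +oo)%E ->
  (\int[mu]_x \int[mu]_y (normc (F x y))%:E < +oo)%E.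
Proof.
move=> mF /measurable_EFinP ma /measurable_EFinP mb a0 b0 Fab aoo boo.
have mn := emeasurable_normc2 mF.
have n0 (p : V * V) : (0 <= (normc (F p.1 p.2))%:E)%E by rewrite lee_fin normc_ge0.
have a0' (x : V) : (0 <= (a x)%:E)%E by rewrite lee_fin.
have b0' (x : V) : (0 <= (b x)%:E)%E by rewrite lee_fin.
apply: (@le_lt_trans _ _ (\int[mu]_x ((a x)%:E * \int[mu]_y (b y)%:E)))%E.
  apply: ge0_le_integralT.
  - exact: (@measurable_fun_fubini_tonelli_F _ _ V V R mu _ mn n0).
  - by apply: emeasurable_funM; [exact: ma|exact: measurable_cst].
  - by move=> x; apply: integral_ge0 => y _; rewrite lee_fin normc_ge0.
  move=> x; rewrite -(ge0_integralZl mu measurableT mb (fun y _ => b0' y) (a0' x)).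
  apply: ge0_le_integralT.
  - exact: (measurableT_comp mn (measurable_pair1 x)).
  - by apply: emeasurable_funM; [exact: measurable_cst|exact: mb].
  - by move=> y; rewrite lee_fin normc_ge0.
  - by move=> y; rewrite -EFinM lee_fin.
have a_ge0 : (0 <= \int[mu]_x (a x)%:E)%E by apply: integral_ge0 => x _; exact: a0'.
have b_ge0 : (0 <= \int[mu]_y (b y)%:E)%E by apply: integral_ge0 => x _; exact: b0'.
rewrite (ge0_integralZr mu measurableT ma (fun x _ => a0' x) b_ge0).
by rewrite lte_mul_pinfty// ge0_fin_numE.
Qed.

End fubini.

(** * Bounded mean oscillation *)

Section bounded_mean_oscillation.
Context {R : realType} {n : nat}.
Local Notation mu := (@lebesgue_rV R n).
Local Notation normc := (@ComplexField.Normc.normc R).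
Implicit Types (f kappa : 'rV[R]_n -> R[i]) (c z : 'rV[R]_n) (r s M : R).

(* A form of [BMO f] and [BMO_norm f <= M] that is invariant under affine changes
   of variables. *)
Definition BMO_le f M := [/\ cmeasurable_fun setT f,
  forall c r, (\int[mu]_(x in eball c r) (normc (f x))%:E < +oo)%E &
  forall c r, 0 < r -> (\int[mu]_(x in eball c r)
    (normc (f x - average f (eball c r)))%:E <= (M * vol (eball c r))%:E)%E].

Lemma cmeasurable_subcst f (a : R[i]) : cmeasurable_fun setT f ->
  cmeasurable_fun setT (fun x => f x - a).
Proof. by move=> mf; apply: cmeasurableB => //; exact: cmeasurable_cst. Qed.

Lemma BMO_le_cintegrable f M c r : BMO_le f M -> cintegrable (eball c r) f.
Proof.
move=> [mf lf _]; apply/cintegrableP; [exact: measurable_eball|exact: cmeasurableS|exact: lf].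
Qed.

(** Local integrability is stated on compact sets; the compact set here is a closed cube, a product
    of segments. *)
Lemma eball_sub_compact c r : exists2 K : set 'rV[R]_n, compact K & eball c r `<=` K.
Proof.
exists [set v : 'rV[R]_n | forall i, `[c ord0 i - r, c ord0 i + r]%classic (v ord0 i)].
  apply: (@rV_compact _ _ (fun i => `[c ord0 i - r, c ord0 i + r]%classic)).
  by move=> i; exact: segment_compact.
move=> y /= yr i; rewrite in_itv/= -ler_distlC distrC.
by have := coord_le_enorm (y - c) i; rewrite !mxE => /le_trans; apply; exact: ltW.
Qed.

Lemma BMO_leP f M : clocally_integrable f -> (BMO_norm f <= M%:E)%E -> BMO_le f M.
Proof.
move=> [mf lf] fM; split => // [c r|c r r0].
  have [K cK BK] := eball_sub_compact c r.
  have /(cintegrableP (measurable_eball c r)) : cmeasurable_fun (eball c r) f by exact: cmeasurableS.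
  move=> h; apply/h; have [i1 i2] := lf _ cK.
  have mK : measurable K.
    rewrite -[K]setCK; apply: measurableC; apply: open_measurable_rV.
    by apply: closed_openC; apply: compact_closed cK; exact: norm_hausdorff.
  have mB := measurable_eball c r.
  by split; [exact: integrableS i1|exact: integrableS i2].
have v0 := vol_gt0 c r0.
have : (mean_oscillation f (eball c r) <= M%:E)%E.
  by apply: le_trans fM; apply: ereal_sup_ubound; exists c, r.
rewrite /mean_oscillation => h.
rewrite mulrC EFinM -lee_pdivrMl//.
Qed.

Lemma average_affine f z s c r : s != 0 -> 0 < r -> cmeasurable_fun setT f ->
  average (fun y => f (z + s *: y)) (eball c r) =
  average f (eball (z + s *: c) (`|s| * r)).
Proof.
move=> s0 r0 mf; have s_gt0 : 0 < `|s| by rewrite normr_gt0.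
rewrite /average.
have -> : cintegral (eball (z + s *: c) (`|s| * r)) f =
    ((`|s| ^+ n)%:C)%C * cintegral (eball c r) (fun y => f (z + s *: y)).
  rewrite -(eball_affine z c r s0); apply: cintegral_affine_in => //.
    exact: measurable_eball.
  exact: cmeasurableS.
rewrite vol_scale// mulrA -rmorphM; congr (_ * _); congr (_ %:C)%C.
have v0 := vol_gt0 c r0.
rewrite -(vol_center c); by rewrite invfM mulrAC mulVf ?mul1r// gt_eqF// exprn_gt0.
Qed.

Lemma BMO_le_affine f M z s : s != 0 -> BMO_le f M ->
  BMO_le (fun y => f (z + s *: y)) M.
Proof.
move=> s0 [mf lf of_]; have s_gt0 : 0 < `|s| by rewrite normr_gt0.
have sn0 : (0 < (`|s| ^+ n)%:E)%E by rewrite lte_fin exprn_gt0.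
have change (h : 'rV[R]_n -> R[i]) c r : cmeasurable_fun setT h ->
    (\int[mu]_(x in eball c r) (normc (h (z + s *: x)))%:E =
     (`|s| ^- n)%:E * \int[mu]_(x in eball (z + s *: c)%R (`|s| * r)%R) (normc (h x))%:E)%E.
  move=> mh; rewrite integral_eball_affine//; last first.
    by apply: emeasurable_normc; exact: cmeasurableS.
  by rewrite muleA -EFinM mulVf ?mul1e// gt_eqF// exprn_gt0.
split; first exact: cmeasurable_affine.
- move=> c r; rewrite change// lte_mul_pinfty ?lee_fin ?invr_ge0 ?exprn_ge0//.
- move=> c r r0; rewrite average_affine//.
  rewrite (change (fun x => f x - _)); last exact: cmeasurable_subcst.
  rewrite -lee_pdivlMl ?invr_gt0 ?exprn_gt0// invrK.
  apply: (le_trans (of_ _ _ _)); first by rewrite mulr_gt0.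
  by rewrite -EFinM lee_fin vol_scale// (vol_center c) mulrCA.
Qed.

(** Meant for [A] the doubled ball and [a] the average over it. The 2 is the one of
    [normc_cintegral_le]. *)
Lemma average_sub_le f M c r (A : set 'rV[R]_n) (a : R[i]) : BMO_le f M -> 0 < r ->
  measurable A -> eball c r `<=` A ->
  ((normc (average f (eball c r) - a))%:E <=
   (2 / vol (eball c r))%:E * \int[mu]_(x in A) (normc (f x - a))%:E)%E.
Proof.
move=> fM r0 mA BA; have v0 := vol_gt0 c r0; have [mf lf _] := fM.
have mB := measurable_eball c r.
have fi := BMO_le_cintegrable c r fM.
have ai : cintegrable (eball c r) (fun=> a).
  apply/(cintegrableP mB (cmeasurable_cst _ a)).
  rewrite integral_cst// lte_mul_pinfty ?lee_fin ?normc_ge0//.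
  exact: mu_eball_lty.
have -> : average f (eball c r) - a =
    (((vol (eball c r))^-1)%:C)%C * cintegral (eball c r) (fun x => f x - a).
  rewrite cintegralB// mulrBr; congr (_ - _).
  have -> : cintegral (eball c r) (fun=> a) = ((vol (eball c r))%:C)%C * a.
    by apply: complex_eq; rewrite ?Re_mul ?Im_mul/= mul0r ?subr0 ?addr0 Rintegral_cst// mulrC.
  by rewrite mulrA -rmorphM mulVf ?gt_eqF// mul1r.
rewrite normcM normc_real gtr0_norm ?invr_gt0// EFinM.
rewrite mulrC EFinM -muleA lee_pmul2l ?lte_fin ?invr_gt0//.
have mfa := cmeasurable_subcst a mf.
apply: (le_trans (normc_cintegral_le mB _)).
  split; [rewrite (_ : (fun _ => _) = (fun x => (complex.Re (f x))%:E - (complex.Re a)%:E)%E)|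
    rewrite (_ : (fun _ => _) = (fun x => (complex.Im (f x))%:E - (complex.Im a)%:E)%E)].
  - by apply: integrableB => //; [exact: fi.1|exact: ai.1].
  - by apply/funext => x; rewrite raddfB.
  - by apply: integrableB => //; [exact: fi.2|exact: ai.2].
  - by apply/funext => x; rewrite raddfB.
rewrite lee_pmul2l//; apply: ge0_subset_integral => //.
- by apply: emeasurable_normc; exact: cmeasurableS.
- by move=> x _; rewrite lee_fin normc_ge0.
Qed.

(** The constant is the 2 of [average_sub_le] times the ratio 2^n of the volumes. *)
Lemma average_double f M c r : BMO_le f M -> 0 < r ->
  normc (average f (eball c r) - average f (eball c (2 * r))) <= 2 ^+ n.+1 * M.
Proof.
move=> fM r0; have r20 : 0 < 2 * r by rewrite mulr_gt0.
have v0 := vol_gt0 c r0.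
have := average_sub_le (average f (eball c (2 * r))) fM r0 (measurable_eball c (2 * r)).
have BB : eball c r `<=` eball c (2 * r).
  by move=> y /= /lt_trans; apply; rewrite mulr_natl mulr2n ltrDl.
move=> /(_ c BB) h; rewrite -lee_fin; apply: (le_trans h).
have [_ _ /(_ c (2 * r) r20) o2] := fM.
apply: (le_trans (lee_pmul _ _ (lexx _) o2)).
- by rewrite lee_fin divr_ge0// ltW.
- by apply: integral_ge0 => x _; rewrite lee_fin normc_ge0.
rewrite vol_center in v0 *; rewrite -EFinM lee_fin vol_scale//.
rewrite le_eqVlt; apply/orP; left; apply/eqP.
by rewrite exprS; field; rewrite gt_eqF.
Qed.

Lemma average_dyadic f M c r k : BMO_le f M -> 0 < r -> 0 <= M ->
  normc (average f (eball c r) - average f (eball c (2 ^+ k * r))) <= k%:R * (2 ^+ n.+1 * M).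
Proof.
move=> fM r0 M0; elim: k => [|k ih].
  by rewrite expr0 mul1r subrr mul0r ComplexField.Normc.normc0.
apply: (le_trans (normc_distD (average f (eball c (2 ^+ k * r))) _ _)).
rewrite -[k.+1%:R]natr1 mulrDl mul1r lerD// exprS -mulrA.
by apply: average_double => //; rewrite mulr_gt0// exprn_gt0.
Qed.

End bounded_mean_oscillation.

(** * Decaying kernels paired with functions of bounded mean oscillation *)

Section kernel_estimates.
Context {R : realType} {n : nat}.
Local Notation mu := (@lebesgue_rV R n).
Local Notation normc := (@ComplexField.Normc.normc R).
Implicit Types (f kappa : 'rV[R]_n -> R[i]) (c z : 'rV[R]_n) (r s M : R).

(* An exponent [N >= 2n] for which [weight N] is integrable, even after
   multiplication by the logarithmic growth of a BMO function. *)
Definition decay : nat := n.*2.+2.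

Local Notation w := (@weight R n decay).

Lemma integral_decay_lty : (\int[mu]_x (w x)%:E < +oo)%E.
Proof. by apply: integral_weight_lty; rewrite /decay -addn2 leq_addr. Qed.

Lemma measurable_decay : measurable_fun setT (fun x => (w x)%:E).
Proof. by apply/measurable_EFinP; exact: measurable_weight. Qed.

(** Take the least k with |y| < 2^k. Unless k = 0, minimality gives |y| >= 2^(k-1), which is where
    the factor 2^N comes from. *)
Lemma weight_dyadic N (y : 'rV[R]_n) : exists2 k,
  eball 0 (2 ^+ k) y & weight N y <= 2 ^+ N / 2 ^+ (k * N).
Proof.
have yk : exists k, enorm y < 2 ^+ k.
  exists (Num.truncn (enorm y)).+1; apply: (lt_le_trans (truncnS_gt _)).
  by rewrite -natrX ler_nat ltnW// ltn_expl.
have [k ky kmin] := ex_minnP yk; exists k; first by rewrite /eball/= subr0.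
case: k ky kmin => [|k] ky kmin.
  by rewrite mul0n expr0 divr1 (le_trans (weight_le1 _ _))// exprn_ege1// ler1n.
have yk' : 2 ^+ k <= enorm y.
  by rewrite leNgt; apply/negP => /kmin; rewrite ltnn.
rewrite mulSn exprD invfM mulrA mulfV ?mul1r ?expf_neq0//.
rewrite /weight lef_pV2 ?posrE ?exprn_gt0 ?onenorm1_gt0// exprM.
rewrite lerXn2r ?nnegrE ?exprn_ge0 ?(ltW (onenorm1_gt0 _))//.
by rewrite (le_trans yk')// (le_trans (enorm_le_norm1 _))// lerDr.
Qed.

(** The factors come from [weight_dyadic], from [average_double], from the volume of the unit ball,
    and from the sum of 2^(-k) over k >= 0. *)
Definition BMO_const : R := 2 ^+ decay * (2 ^+ n.+1 * vol (@eball R n 0 1)) * 2.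

Lemma BMO_const_ge0 : 0 <= BMO_const.
Proof.
have v0 := @vol_gt0 R n 0 _ ltr01.
by rewrite /BMO_const; repeat (apply: mulr_ge0 || apply: exprn_ge0) => //; exact: ltW.
Qed.

Lemma BMO_weight_le f M : BMO_le f M -> 0 <= M ->
  (\int[mu]_x (w x * normc (f x - average f (eball 0 1)))%:E <= (BMO_const * M)%:E)%E.
Proof.
move=> fM M0; have [mf lf of_] := fM; set a := average f _.
pose h x := (normc (f x - a))%:E.
have mfa : cmeasurable_fun setT (fun x => f x - a) by exact: cmeasurable_subcst.
have mh D : measurable_fun D h by apply: emeasurable_normc; exact: cmeasurableS.
have h0 x : (0 <= h x)%E by rewrite lee_fin normc_ge0.
pose B k : set 'rV[R]_n := eball 0 (2 ^+ k).
have mB k : measurable (B k) by exact: measurable_eball.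
have rB k : 0 < 2 ^+ k :> R by rewrite exprn_gt0.
pose v := vol (@eball R n 0 1); have v0 : 0 < v by exact: vol_gt0.
have volB k : vol (B k) = 2 ^+ (k * n) * v.
  by rewrite /B -[2 ^+ k in LHS]mulr1 vol_scale// -exprM.
(* On the k-th ball, f is compared with its own average there; the k doublings back to the unit ball
   account for the term k. *)
have oB k : (\int[mu]_(x in B k) h x <= ((1 + k%:R) * 2 ^+ n.+1 * M * vol (B k))%:E)%E.
  pose ak := average f (B k).
  have aak : normc (ak - a) <= k%:R * (2 ^+ n.+1 * M).
    by rewrite -normc_opp opprB; have := average_dyadic 0 k fM ltr01 M0; rewrite mulr1.
  have mfk : cmeasurable_fun (B k) (fun x => f x - ak).
    exact/cmeasurableS/cmeasurable_subcst.
  apply: (@le_trans _ _ (\int[mu]_(x in B k) ((normc (f x - ak))%:E + (normc (ak - a))%:E))%E).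
    apply: ge0_le_integral => //.
    - by apply: emeasurable_funD; [exact: emeasurable_normc|exact: measurable_cst].
    - by move=> x _; rewrite -EFinD lee_fin normc_distD.
  rewrite ge0_integralD//; last 3 first.
  - by move=> x _; rewrite lee_fin normc_ge0.
  - exact: emeasurable_normc.
  - by move=> x _; rewrite lee_fin normc_ge0.
  rewrite integral_cst// [X in (_ + _ * X)%E]volE -EFinM.
  apply: (le_trans (leeD2r _ (of_ _ _ (rB k)))); rewrite -EFinD lee_fin.
  rewrite -/(B k) -mulrDl ler_wpM2r ?volB ?mulr_ge0 ?exprn_ge0 ?(ltW v0)//.
  rewrite -mulrA mulrDl mul1r lerD// ler_peMl// exprn_ege1// ler1n//.
pose u k x := ((2 ^+ decay / 2 ^+ (k * decay))%:E * (h \_ (B k)) x)%E.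
have c0 k : 0 <= 2 ^+ decay / 2 ^+ (k * decay) :> R by rewrite divr_ge0// exprn_ge0.
have hB0 k x : (0 <= (h \_ (B k)) x)%E by rewrite patchE; case: ifP.
have mhB k : measurable_fun setT (h \_ (B k)) by apply/(measurable_restrictT _ (mB k)).
have u0 k x : (0 <= u k x)%E by rewrite mule_ge0// lee_fin.
have mu_ k : measurable_fun setT (u k).
  by apply: emeasurable_funM => //; exact: measurable_cst.
apply: (@le_trans _ _ (\int[mu]_x (\sum_(k <oo) u k x)))%E.
  apply: ge0_le_integralT.
  - under eq_fun do rewrite EFinM; apply: emeasurable_funM; last exact: mh.
    exact: measurable_decay.
  - by apply: ge0_emeasurable_sum => // k x _ _; exact: u0.
  - by move=> x; rewrite lee_fin mulr_ge0 ?weight_ge0 ?normc_ge0.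
  (* At each point a single term of the series dominates the integrand, so nested balls serve as
     well as disjoint annuli. *)
  move=> x; have [k Bx wx] := weight_dyadic decay x.
  apply: (@le_trans _ _ (u k x)).
    by rewrite /u patchE mem_set// /h -EFinM lee_fin ler_wpM2r// normc_ge0.
  have := @nneseries_lim_ge R (u ^~ x) xpredT 0 k.+1 (fun _ _ _ => u0 _ _).
  move=> us; refine (@le_trans _ _ (\sum_(0 <= i < k.+1) u i x)%E _ _ _ us).
  by rewrite big_nat_recr//= leeDr// sume_ge0.
rewrite integral_nneseries//.
apply: (@le_trans _ _ (\sum_(k <oo) ((BMO_const * M) / (2 ^ k.+1)%:R)%:E)%E); last first.
  by apply: epsilon_trick0; rewrite mulr_ge0// BMO_const_ge0.
apply: lee_nneseries => [k _ _|k _]; first by apply: integral_ge0 => x _; exact: u0.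
rewrite /u (ge0_integralZl_EFin _ measurableT)//.
rewrite -integral_mkcond; apply: (le_trans (lee_wpmul2l _ (oB k))); first by rewrite lee_fin.
rewrite -EFinM lee_fin volB /BMO_const -/v.
(* One of the two spare factors 2^(-k) absorbs the linear growth; the other makes the series
   geometric. *)
have k2 : 1 + k%:R <= 2 ^+ k :> R by rewrite -natrX -[1 + _]/(1%:R + _) -natrD add1n ler_nat ltn_expl.
have -> : 2 ^+ (k * decay) = 2 ^+ (k * n) * 2 ^+ (k * n) * (2 ^+ k * 2 ^+ k) :> R.
  by rewrite -!exprD; congr (_ ^+ _); rewrite /decay -addn2 -addnn !mulnDr muln2 -[k.*2]addnn.
have e1 : 0 < 2 ^+ (k * n) :> R by rewrite exprn_gt0.
have e1' : 1 <= 2 ^+ (k * n) :> R by rewrite exprn_ege1// ler1n.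
rewrite natrX [2 ^+ k.+1]exprS.
have := rB k; move: k2 e1 e1'.
move: (2 ^+ (k * n)) (2 ^+ k) (1 + k%:R) (2 ^+ decay) (2 ^+ n.+1) (exprn_ge0 decay (ler0n R 2))
  (exprn_ge0 n.+1 (ler0n R 2)) => p q t D E D0 E0 tq p0 p1 q0.
rewrite [leLHS](_ : _ = D * E * M * v * (t / (p * (q * q)))); last first.
  by field; rewrite !gt_eqF.
rewrite [leRHS](_ : _ = D * E * M * v * q^-1); last by field; rewrite gt_eqF.
apply: ler_wpM2l; first by rewrite !mulr_ge0// ltW.
rewrite ler_pdivrMr ?mulr_gt0// mulrCA mulKf ?gt_eqF//.
by rewrite (le_trans tq)// ler_peMl// ltW.
Qed.

Lemma BMO_weight_lty f M : BMO_le f M -> 0 <= M ->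
  (\int[mu]_x (w x * normc (f x))%:E < +oo)%E.
Proof.
move=> fM M0; have [mf _ _] := fM; set a := average f (eball 0 1).
have mfa : cmeasurable_fun setT (fun x => f x - a) by exact: cmeasurable_subcst.
have mw := measurable_decay.
have mwh g : cmeasurable_fun setT g -> measurable_fun setT (fun x => (w x * normc (g x))%:E).
  move=> mg; under eq_fun do rewrite EFinM; apply: emeasurable_funM => //.
  exact: emeasurable_normc.
have w0 x : 0 <= w x by exact: weight_ge0.
have mZw (k : R) : measurable_fun setT (fun x => (k * w x)%:E).
  by apply/measurable_EFinP/measurable_funM => //; exact: measurable_weight.
apply: (@le_lt_trans _ _ (\int[mu]_x ((w x * normc (f x - a))%:E + (normc a * w x)%:E)))%E.
  apply: ge0_le_integralT.
  - exact: mwh.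
  - apply: emeasurable_funD; first exact: mwh.
    exact: mZw.
  - by move=> x; rewrite lee_fin mulr_ge0 ?normc_ge0.
  - move=> x; rewrite -EFinD lee_fin [X in _ + X]mulrC -mulrDr ler_wpM2l//.
    by apply: le_trans (normcD _ _); rewrite subrK.
have h1 x : setT x -> (0 <= (w x * normc (f x - a))%:E)%E.
  by rewrite lee_fin mulr_ge0 ?normc_ge0.
have h2 x : setT x -> (0 <= (normc a * w x)%:E)%E.
  by rewrite lee_fin mulr_ge0 ?normc_ge0.
rewrite (ge0_integralD mu measurableT h1 (mwh _ mfa) h2 (mZw _)).
apply: lte_add_pinfty.
  by apply: (le_lt_trans (BMO_weight_le fM M0)); exact: ltry.
rewrite ge0_integralZ_EFin//; last exact: normc_ge0.
rewrite lte_mul_pinfty ?lee_fin ?normc_ge0//; exact: integral_decay_lty.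
Qed.

Lemma kernel_bound_ge0 kappa A : (forall x, normc (kappa x) <= A * w x) -> 0 <= A.
Proof.
move=> kA; have := kA 0; rewrite -ler_pdivrMr ?weight_gt0//; apply: le_trans.
by rewrite divr_ge0 ?normc_ge0 ?weight_ge0.
Qed.

Lemma kernel_cintegrable kappa A : cmeasurable_fun setT kappa ->
  (forall x, normc (kappa x) <= A * w x) -> cintegrable setT kappa.
Proof.
move=> mk kA; have mw := @measurable_weight R n decay.
apply: (le_cintegrable measurableT mk _ (fun x _ => kA x)).
  exact: measurable_funM.
have A0 := kernel_bound_ge0 kA.
rewrite ge0_integralZ_EFin//; [|exact: weight_ge0|exact: measurable_decay].
by rewrite lte_mul_pinfty ?lee_fin//; exact: integral_decay_lty.
Qed.

Lemma kernelM_cintegrable kappa A f M : cmeasurable_fun setT kappa ->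
  (forall x, normc (kappa x) <= A * w x) -> BMO_le f M -> 0 <= M ->
  cintegrable setT (fun x => kappa x * f x).
Proof.
move=> mk kA fM M0; have [mf _ _] := fM.
have A0 := kernel_bound_ge0 kA.
apply: (@le_cintegrable _ _ _ _ (fun x => A * (w x * normc (f x)))) => //.
- exact: cmeasurableM.
- apply: measurable_funM => //; apply: measurable_funM; first exact: measurable_weight.
  by case: mf => *; exact: measurable_normc.
- by move=> x _; rewrite normcM mulrA ler_wpM2r ?normc_ge0.
rewrite ge0_integralZ_EFin//; last 2 first.
- by move=> x; rewrite mulr_ge0 ?weight_ge0 ?normc_ge0.
- under eq_fun do rewrite EFinM; apply: emeasurable_funM; first exact: measurable_decay.
  exact: emeasurable_normc.
by rewrite lte_mul_pinfty ?lee_fin ?(BMO_weight_lty fM)// integral_ge0// => x _;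
  rewrite lee_fin mulr_ge0 ?weight_ge0 ?normc_ge0.
Qed.

(** The difference is the integral of [kappa] against f minus its average, to which [BMO_weight_le]
    applies. *)
Lemma kernel_average_unit kappa A f M : cmeasurable_fun setT kappa ->
  (forall x, normc (kappa x) <= A * w x) -> BMO_le f M -> 0 <= M ->
  normc (cintegral setT (fun x => kappa x * f x) -
    average f (eball 0 1) * cintegral setT kappa) <= 2 * A * (BMO_const * M).
Proof.
move=> mk kA fM M0; have [mf _ _] := fM; set a := average f (eball 0 1).
have A0 := kernel_bound_ge0 kA.
have mfa : cmeasurable_fun setT (fun x => f x - a) by exact: cmeasurable_subcst.
have ki := kernel_cintegrable mk kA.
have kfi := kernelM_cintegrable mk kA fM M0.
rewrite -cintegralZ// -cintegralB//; last exact: cintegrableZ.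
have kE x : kappa x * f x - a * kappa x = kappa x * (f x - a) by rewrite mulrBr [a * _]mulrC.
rewrite (eq_cintegral (fun x _ => kE x)).
have mkfa : cmeasurable_fun setT (fun x => kappa x * (f x - a)) by exact: cmeasurableM.
have wle x : normc (kappa x * (f x - a)) <= A * (w x * normc (f x - a)).
  by rewrite normcM mulrA ler_wpM2r ?normc_ge0.
have mwa : measurable_fun setT (fun x => (w x * normc (f x - a))%:E).
  under eq_fun do rewrite EFinM; apply: emeasurable_funM; first exact: measurable_decay.
  exact: emeasurable_normc.
have wa0 x : 0 <= w x * normc (f x - a) by rewrite mulr_ge0 ?weight_ge0 ?normc_ge0.
have I : (\int[mu]_x (normc (kappa x * (f x - a)))%:E <= (A * (BMO_const * M))%:E)%E.
  apply: (@le_trans _ _ (\int[mu]_x (A * (w x * normc (f x - a)))%:E))%E.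
    apply: ge0_le_integralT.
    - exact: emeasurable_normc.
    - under eq_fun do rewrite EFinM; apply: emeasurable_funM => //.
    - by move=> x; rewrite lee_fin normc_ge0.
    - by move=> x; rewrite lee_fin.
  rewrite ge0_integralZ_EFin// EFinM.
  by apply: lee_wpmul2l; [rewrite lee_fin|exact: BMO_weight_le].
have kfai : cintegrable setT (fun x => kappa x * (f x - a)).
  by apply/cintegrableP => //; apply: le_lt_trans I (ltry _).
rewrite -lee_fin; apply: (le_trans (normc_cintegral_le measurableT kfai)).
by rewrite -mulrA EFinM; apply: lee_wpmul2l => //; rewrite lee_fin.
Qed.

(** The scale [s] is signed: convolutions use s = -t, pairings with Gaussians use s = r. *)
Lemma kernel_average kappa A f M z s : s != 0 -> cmeasurable_fun setT kappa ->
  (forall x, normc (kappa x) <= A * w x) -> BMO_le f M -> 0 <= M ->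
  normc (cintegral setT (fun y => kappa y * f (z + s *: y)) -
    average f (eball z `|s|) * cintegral setT kappa) <= 2 * A * (BMO_const * M).
Proof.
move=> s0 mk kA fM M0; have [mf _ _] := fM.
have := kernel_average_unit mk kA (BMO_le_affine z s0 fM) M0.
by rewrite average_affine// scaler0 addr0 mulr1.
Qed.

End kernel_estimates.

(** * Schwartz functions and the decay of their Fourier transforms *)

Section slices.
Context {R : realType} {n : nat}.
Implicit Types (F : 'rV[R]_n -> R) (x v : 'rV[R]_n).

Lemma slice_quotient F x v (t : R) :
  (fun h : R => h^-1 *: (F (x + (h *: 1 + t) *: v) - F (x + t *: v))) =
  (fun h : R => h^-1 *: (F (h *: v + (x + t *: v)) - F (x + t *: v))).
Proof.
apply/funext => h; congr (_ *: (F _ - _)).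
by rewrite scalerDl [h *: 1]mulr1 addrCA.
Qed.

Lemma derivable_slice F x v (t : R) : derivable F (x + t *: v) v ->
  derivable (fun t : R => F (x + t *: v)) t 1.
Proof. by rewrite /derivable; rewrite [X in _ -> cvg (X @ _)]slice_quotient. Qed.

Lemma derive_slice F x v (t : R) :
  'D_1 (fun t : R => F (x + t *: v)) t = 'D_v F (x + t *: v).
Proof. by rewrite /derive [X in lim (X @ _)]slice_quotient. Qed.

(** Reduces a directional derivative to one real variable, where the differentiation rules compute
    it. *)
Lemma is_derive_sliceP F x v (d : R) :
  is_derive (0 : R) 1 (fun t : R => F (x + t *: v)) d -> is_derive x v F d.
Proof.
have E : (fun h : R => h^-1 *: (F (x + (h *: 1 + 0) *: v) - F (x + 0 *: v))) =
    (fun h : R => h^-1 *: (F (h *: v + x) - F x)).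
  by rewrite slice_quotient scale0r addr0.
move=> [d1 d2]; split.
- by move: d1; rewrite /derivable [X in cvg (X @ _) -> _]E.
- by move: d2; rewrite /derive [X in lim (X @ _) = _ -> _]E.
Qed.

End slices.

Section schwartz_theory.
Context {R : realType} {n : nat}.
Implicit Types (u : 'rV[R]_n -> R) (psi : 'rV[R]_n -> R[i]) (x : 'rV[R]_n) (j : 'I_n).
Local Notation mu := (@lebesgue_rV R n).
Local Notation normc := (@ComplexField.Normc.normc R).
Local Notation e_ j := (delta_mx ord0 j : 'rV[R]_n).

(** With m the maximum of 1 and the |x_j|, one has 1 + |x|_1 <= (n+1) m, while m^N is one of the
    terms on the right. *)
Lemma onenorm1_exp_le N x :
  (1 + norm1 x) ^+ N <= n.+1%:R ^+ N * (1 + \sum_(j < n) `|x ord0 j| ^+ N).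
Proof.
pose m := \big[Num.max/1]_(j < n) `|x ord0 j|.
have m1 : 1 <= m by exact: bigmax_ge_id.
have mN : m ^+ N <= 1 + \sum_(j < n) `|x ord0 j| ^+ N.
  rewrite /m; apply: (big_ind (fun m => m ^+ N <= _)).
  - by rewrite expr1n lerDl sumr_ge0// => j _; rewrite exprn_ge0.
  - by move=> a b ha hb; rewrite /Order.max; case: ifP.
  - move=> j _; rewrite (bigD1 j)//= addrCA lerDl addr_ge0//.
    by apply: sumr_ge0 => k _; exact: exprn_ge0.
apply: (@le_trans _ _ ((n.+1%:R * m) ^+ N)); last by rewrite exprMn ler_wpM2l// exprn_ge0.
rewrite lerXn2r ?nnegrE ?mulr_ge0 ?(ltW (onenorm1_gt0 _)) ?ler0n ?(le_trans ler01)//.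
rewrite -[n.+1%:R]natr1 mulrDl mul1r [leLHS]addrC lerD//.
rewrite mulr_natl (_ : _ *+ n = \sum_(i < n) m); last by rewrite sumr_const card_ord.
by apply: ler_sum => j _; exact: le_bigmax.
Qed.

(** Decay can thus be tested on pure powers of single coordinates, with no mixed monomials. *)
Lemma weight_bound N (g : 'rV[R]_n -> R) :
  (exists C, forall x, `|g x| <= C) ->
  (forall j, exists C, forall x, `|x ord0 j| ^+ N * `|g x| <= C) ->
  exists2 C, 0 <= C & forall x, `|g x| <= C * weight N x.
Proof.
move=> [C0 g0] /choice[C gC].
exists (n.+1%:R ^+ N * (C0 + \sum_j C j)) => [|x].
  rewrite mulr_ge0 ?exprn_ge0// addr_ge0 ?(le_trans _ (g0 0))// sumr_ge0// => j _.
  by rewrite (le_trans _ (gC j 0))// mulr_ge0 ?exprn_ge0.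
rewrite /weight ler_pdivlMr ?exprn_gt0 ?onenorm1_gt0//.
apply: (le_trans (ler_wpM2l (normr_ge0 _) (onenorm1_exp_le N x))).
rewrite mulrCA ler_wpM2l ?exprn_ge0// mulrDr mulr1 lerD// mulr_sumr.
by apply: ler_sum => j _; rewrite mulrC.
Qed.

Lemma schwartz_real_continuous u : schwartz_real u -> continuous u.
Proof. by move=> [/(_ [::])[]]. Qed.

Lemma schwartz_real_measurable u : schwartz_real u -> measurable_fun setT u.
Proof. by move=> su; apply: continuous_measurable_rV; exact: schwartz_real_continuous. Qed.

Lemma schwartz_real_derivable u j x : schwartz_real u -> derivable u x (e_ j).
Proof. by move=> [/(_ [::])[_]]. Qed.

Lemma schwartz_real_partial u j : schwartz_real u -> schwartz_real (fun x => 'D_(e_ j) u x).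
Proof.
have E s : partials s (fun x => 'D_(e_ j) u x) = partials (rcons s j) u.
  by rewrite /partials foldr_rcons.
move=> [su bu]; split => [s|a s]; rewrite E; [exact: su|exact: bu].
Qed.

Lemma schwartz_real_bound N u : schwartz_real u ->
  exists2 C, 0 <= C & forall x, `|u x| <= C * weight N x.
Proof.
move=> [_ bu]; apply: weight_bound.
  have [C uC] := bu (fun=> 0%N) [::]; exists C => x.
  by have := uC x; rewrite big1 ?mul1r.
move=> j; have [C uC] := bu (fun i => if i == j then N else 0%N) [::]; exists C => x.
have := uC x; rewrite (bigD1 j)//= eqxx big1 => [|i /negbTE ->//].
by rewrite mulr1 normrM normrX.
Qed.

Lemma schwartz_bound N psi : schwartz psi ->
  exists2 C, 0 <= C & forall x, normc (psi x) <= C * weight N x.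
Proof.
move=> [/(schwartz_real_bound N)[C1 C10 h1] /(schwartz_real_bound N)[C2 C20 h2]].
exists (C1 + C2) => [|x]; first exact: addr_ge0.
by rewrite (le_trans (normc_le _))// mulrDl lerD.
Qed.

Lemma schwartz_cmeasurable psi : schwartz psi -> cmeasurable_fun setT psi.
Proof. by move=> [s1 s2]; split; exact: schwartz_real_measurable. Qed.

Lemma schwartz_cintegrable psi : schwartz psi -> cintegrable setT psi.
Proof.
move=> sp; have [C _ pC] := schwartz_bound (@decay n) sp.
exact: kernel_cintegrable (schwartz_cmeasurable sp) pC.
Qed.

Lemma integrable_weight_bound (u : 'rV[R]_n -> R) C : measurable_fun setT u ->
  (forall x, `|u x| <= C * weight (@decay n) x) -> mu.-integrable setT (EFin \o u).
Proof.
move=> mu_ uC; pose U x := (u x)%:C%C.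
have mU : cmeasurable_fun setT U by split => //; exact: measurable_cst.
have UC x : normc (U x) <= C * weight (@decay n) x by rewrite normc_real.
by have [] := kernel_cintegrable mU UC.
Qed.

Lemma Rintegral_translate (u : 'rV[R]_n -> R) z : measurable_fun setT u ->
  \int[mu]_x u (x + z) = \int[mu]_x u x.
Proof.
move=> mu_; rewrite /Rintegral; congr fine.
have := @integral_affine_in _ _ z 1 setT (EFin \o u) (oner_neq0 _) measurableT.
rewrite normr1 expr1n mul1e preimage_setT => ->; last exact/measurable_EFinP.
by apply: eq_integral => x _; rewrite /= scale1r addrC.
Qed.

(* The integral of [u (x + t v)] does not depend on [t]. *)
Lemma integral_derive0 u v C : measurable_fun setT u ->
  (forall x, derivable u x v) ->
  (forall x, `|u x| <= C * weight (@decay n) x) ->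
  (forall x, `|'D_v u x| <= C * weight (@decay n) x) ->
  \int[mu]_x 'D_v u x = 0.
Proof.
move=> mu_ du uC DuC; pose N := @decay n.
have C0 : 0 <= C.
  by have := uC 0; rewrite -ler_pdivrMr ?weight_gt0//; apply: le_trans;
    rewrite divr_ge0 ?weight_ge0.
pose f (t : R) y := u (y + t *: v).
(* For |t| < 1 the translates have a common integrable majorant, as differentiation under the
   integral requires. *)
have wle (t : R) y : `]-1, 1[%classic t -> weight N (y + t *: v) <= (1 + norm1 v) ^+ N * weight N y.
  rewrite /= in_itv/= => /andP[t1 t2].
  apply: (le_trans (weight_peetre _ _ _)); rewrite ler_wpM2r ?weight_ge0//.
  rewrite lerXn2r ?nnegrE ?(ltW (onenorm1_gt0 _))// norm1Z.
  have : `|t| <= 1 by rewrite ler_norml !ltW.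
  by have := norm1_ge0 v; have := normr_ge0 t; nra.
have mf t : measurable_fun setT (f t).
  rewrite (_ : f t = fun y => u (t *: v + 1 *: y)); last first.
    by apply/funext => y; rewrite scale1r addrC.
  exact: (measurableT_comp mu_ (measurable_rV_affine _ _)).
have mG := @measurable_weight R n N.
have intf t : `]-1, 1[%classic t -> mu.-integrable setT (EFin \o f t).
  move=> t1; apply: (@integrable_weight_bound _ (C * (1 + norm1 v) ^+ N)) => // x.
  by apply: (le_trans (uC _)); rewrite -mulrA ler_wpM2l// wle.
have df t y : derivable (f ^~ y) t 1 by exact: derivable_slice.
pose G (y : 'rV[R]_n) := C * ((1 + norm1 v) ^+ N * weight N y).
have G0 y : 0 <= G y.
  by apply: mulr_ge0 => //; apply: mulr_ge0; [apply: exprn_ge0; exact/ltW/onenorm1_gt0|exact: weight_ge0].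
have intG : mu.-integrable setT (EFin \o G).
  apply: (@integrable_weight_bound _ (C * (1 + norm1 v) ^+ N)).
    by apply: measurable_funM => //; exact: measurable_funM.
  by move=> x; rewrite ger0_norm// /G mulrA.
have d1E t y : partial1of2 f t y = 'D_v u (y + t *: v).
  by rewrite partial1of2E derive_slice.
have I0 : `]-1, 1[%classic (0 : R) by rewrite /= in_itv/= ltrN10 ltr01.
have Gub t y : `]-1, 1[%classic t -> setT y -> `|partial1of2 f t y| <= G y.
  by move=> t1 _; rewrite d1E (le_trans (DuC _))// ler_wpM2l// wle.
have := differentiation_under_integral measurableT I0 intf (fun t y _ _ => df t y) G0 intG Gub.
rewrite (_ : (fun t => _) = cst (\int[mu]_x u x)); last first.
  by apply/funext => t; exact: Rintegral_translate.
rewrite derive1_cst => /esym <-; apply: eq_Rintegral => y _.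
by rewrite d1E scale0r addr0.
Qed.

End schwartz_theory.

(** * Decay of Fourier transforms of Schwartz functions *)

Section fourier_decay.
Context {R : realType} {n : nat}.
Implicit Types (u : 'rV[R]_n -> R) (psi : 'rV[R]_n -> R[i]) (x y : 'rV[R]_n) (j : 'I_n).
Local Notation mu := (@lebesgue_rV R n).
Local Notation normc := (@ComplexField.Normc.normc R).
Local Notation e_ j := (delta_mx ord0 j : 'rV[R]_n).

Lemma dotrvC x y : dotrv x y = dotrv y x.
Proof. by apply: eq_bigr => i _; rewrite mulrC. Qed.

Lemma dotrvDl x y z : dotrv (x + y) z = dotrv x z + dotrv y z.
Proof. by rewrite -big_split/=; apply: eq_bigr => i _; rewrite mxE mulrDl. Qed.

Lemma dotrvZl (a : R) x y : dotrv (a *: x) y = a * dotrv x y.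
Proof. by rewrite /dotrv mulr_sumr; apply: eq_bigr => i _; rewrite mxE mulrA. Qed.

Lemma dotrvDr x y z : dotrv z (x + y) = dotrv z x + dotrv z y.
Proof. by rewrite dotrvC dotrvDl !(dotrvC z). Qed.

Lemma dotrvZr (a : R) x y : dotrv y (a *: x) = a * dotrv y x.
Proof. by rewrite dotrvC dotrvZl (dotrvC y). Qed.

Lemma dotrv_delta j x : dotrv (e_ j) x = x ord0 j.
Proof.
rewrite /dotrv (bigD1 j)//= !mxE !eqxx mul1r big1 ?addr0// => i /negbTE ij.
by rewrite !mxE ij andbF mul0r.
Qed.

Lemma measurable_dotrv x : measurable_fun setT (fun y => dotrv y x).
Proof.
apply: measurable_sum => i; apply: measurable_funM => //; exact: measurable_coor.
Qed.

Lemma measurable_cosdot x : measurable_fun setT (fun y => cos (dotrv y x)).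
Proof. exact: (measurable_comp_continuous (@continuous_cos R) (measurable_dotrv x)). Qed.

Lemma measurable_sindot x : measurable_fun setT (fun y => sin (dotrv y x)).
Proof. exact: (measurable_comp_continuous (@continuous_sin R) (measurable_dotrv x)). Qed.

Lemma norm_cos_le1 (t : R) : `|cos t| <= 1.
Proof. by rewrite ler_norml cos_geN1 cos_le1. Qed.

Lemma norm_sin_le1 (t : R) : `|sin t| <= 1.
Proof. by rewrite ler_norml sin_geN1 sin_le1. Qed.

Lemma dotrv_slice x y v (t : R) : dotrv (y + t *: v) x = dotrv y x + dotrv v x * t.
Proof. by rewrite dotrvDl dotrvZl mulrC. Qed.

Lemma is_derive_cosdot x y v :
  is_derive y v (fun y => cos (dotrv y x)) (- dotrv v x * sin (dotrv y x)).
Proof.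
apply: is_derive_sliceP.
rewrite (_ : (fun t : R => _) = (fun t => cos (dotrv y x + dotrv v x * t))); last first.
  by apply/funext => t; rewrite dotrv_slice.
apply: is_derive_eq; rewrite /= /GRing.scale/= ?mulr0 ?addr0 ?mulr1 ?add0r.
ring.
Qed.

Lemma is_derive_sindot x y v :
  is_derive y v (fun y => sin (dotrv y x)) (dotrv v x * cos (dotrv y x)).
Proof.
apply: is_derive_sliceP.
rewrite (_ : (fun t : R => _) = (fun t => sin (dotrv y x + dotrv v x * t))); last first.
  by apply/funext => t; rewrite dotrv_slice.
apply: is_derive_eq; rewrite /= /GRing.scale/= ?mulr0 ?addr0 ?mulr1 ?add0r.
ring.
Qed.

(** Apply [integral_derive0] to the product [u * g], which inherits the decay of [u] since [g] and
    [dg] are bounded. *)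
Lemma integral_by_parts u (g dg : 'rV[R]_n -> R) j (B : R) : schwartz_real u ->
  measurable_fun setT g -> measurable_fun setT dg ->
  (forall y, is_derive y (e_ j) g (dg y)) ->
  (forall y, `|g y| <= 1) -> (forall y, `|dg y| <= B) ->
  \int[mu]_y ('D_(e_ j) u y * g y) = - \int[mu]_y (u y * dg y).
Proof.
move=> su mg mdg hg g1 dgB.
have sdu := schwartz_real_partial j su.
have [C1 C10 uC] := schwartz_real_bound (@decay n) su.
have [C2 C20 duC] := schwartz_real_bound (@decay n) sdu.
have mu_ := schwartz_real_measurable su; have mdu := schwartz_real_measurable sdu.
have B0 : 0 <= B by apply: le_trans (dgB 0).
have w0 y := @weight_ge0 R n (@decay n) y.
have h1 y : `|u y * g y| <= C1 * weight (@decay n) y.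
  by rewrite normrM -[leRHS]mulr1 ler_pM.
have h2 y : `|'D_(e_ j) u y * g y| <= C2 * weight (@decay n) y.
  by rewrite normrM -[leRHS]mulr1 ler_pM.
have h3 y : `|u y * dg y| <= (C1 * B) * weight (@decay n) y.
  by rewrite normrM mulrAC ler_pM.
have dE y : is_derive y (e_ j) (fun y => u y * g y) ('D_(e_ j) u y * g y + u y * dg y).
  have du : is_derive y (e_ j) u ('D_(e_ j) u y).
    exact/derivableP/schwartz_real_derivable.
  have hgy := hg y.
  rewrite (_ : (fun y => _) = u * g)//.
  by apply: is_derive_eq; rewrite /GRing.scale/= addrC [g y * _]mulrC.
have := @integral_derive0 R n (fun y => u y * g y) (e_ j) (C1 + (C2 + C1 * B)).
have -> : (fun y => 'D_(e_ j) (fun y => u y * g y) y) =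
    (fun y => 'D_(e_ j) u y * g y + u y * dg y).
  by apply/funext => y; have := dE y => ?; rewrite derive_val.
rewrite RintegralD//; last 2 first.
- by apply: integrable_weight_bound h2; exact: measurable_funM.
- by apply: integrable_weight_bound h3; exact: measurable_funM.
move=> main; apply/eqP; rewrite -addr_eq0; apply/eqP; apply: main.
- exact: measurable_funM.
- by move=> y; have := dE y => -[].
- move=> y; apply: (le_trans (h1 y)).
  by rewrite ler_wpM2r// lerDl addr_ge0// mulr_ge0.
- move=> y; have := dE y => -[_ ->].
  apply: (le_trans (ler_normD _ _)); apply: (le_trans (lerD (h2 y) (h3 y))).
  by rewrite -mulrDl ler_wpM2r// lerDr.
Qed.

(** The cosine and sine transforms keep the calculus real; [fourierE] reassembles the complex
    transform. *)
Definition cos_transform u x : R := \int[mu]_y (u y * cos (dotrv y x)).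
Definition sin_transform u x : R := \int[mu]_y (u y * sin (dotrv y x)).

Lemma Rintegral_opp (g : 'rV[R]_n -> R) : mu.-integrable setT (EFin \o g) ->
  \int[mu]_y (- g y) = - \int[mu]_y g y.
Proof.
move=> ig; rewrite -[RHS]mulN1r -RintegralZl//.
by apply: eq_Rintegral => y _; rewrite mulN1r.
Qed.

Lemma trig_integrable u (g : 'rV[R]_n -> R) (B : R) : schwartz_real u ->
  measurable_fun setT g -> (forall y, `|g y| <= B) ->
  mu.-integrable setT (EFin \o (fun y => u y * g y)).
Proof.
move=> su mg gB; have [C C0 uC] := schwartz_real_bound (@decay n) su.
have mu_ := schwartz_real_measurable su.
apply: (@integrable_weight_bound _ _ _ (C * B)); first exact: measurable_funM.
move=> y; rewrite normrM mulrAC ler_pM// (le_trans _ (gB 0))//.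
Qed.

Lemma cos_transform_partial u x j : schwartz_real u ->
  cos_transform (fun y => 'D_(e_ j) u y) x = x ord0 j * sin_transform u x.
Proof.
move=> su; have si := trig_integrable su (measurable_sindot x) (fun y => norm_sin_le1 _).
have hd y : is_derive y (e_ j) (fun y => cos (dotrv y x)) (- x ord0 j * sin (dotrv y x)).
  by rewrite -(dotrv_delta j x); exact: is_derive_cosdot.
have mds : measurable_fun setT (fun y => - x ord0 j * sin (dotrv y x)).
  by apply: measurable_funM => //; exact: measurable_sindot.
have dsB y : `|- x ord0 j * sin (dotrv y x)| <= `|x ord0 j|.
  by rewrite normrM normrN ler_piMr// norm_sin_le1.
rewrite /cos_transform (integral_by_parts su (measurable_cosdot x) mds
  hd (fun y => norm_cos_le1 _) dsB).
rewrite /sin_transform -[RHS]opprK -mulNr; congr (- _); rewrite -[in RHS]RintegralZl//.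
by apply: eq_Rintegral => y _; ring.
Qed.

Lemma sin_transform_partial u x j : schwartz_real u ->
  sin_transform (fun y => 'D_(e_ j) u y) x = - (x ord0 j * cos_transform u x).
Proof.
move=> su; have ci := trig_integrable su (measurable_cosdot x) (fun y => norm_cos_le1 _).
have hd y : is_derive y (e_ j) (fun y => sin (dotrv y x)) (x ord0 j * cos (dotrv y x)).
  by rewrite -(dotrv_delta j x); exact: is_derive_sindot.
have mdc : measurable_fun setT (fun y => x ord0 j * cos (dotrv y x)).
  by apply: measurable_funM => //; exact: measurable_cosdot.
have dcB y : `|x ord0 j * cos (dotrv y x)| <= `|x ord0 j|.
  by rewrite normrM ler_piMr// norm_cos_le1.
rewrite /sin_transform (integral_by_parts su (measurable_sindot x) mdc
  hd (fun y => norm_sin_le1 _) dcB).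
congr (- _); rewrite /cos_transform -[in RHS]RintegralZl//.
by apply: eq_Rintegral => y _; ring.
Qed.

Lemma trig_transform_bounded u : schwartz_real u -> exists C, forall x,
  `|cos_transform u x| + `|sin_transform u x| <= C.
Proof.
move=> su; have [A A0 uA] := schwartz_real_bound (@decay n) su.
have mu_ := schwartz_real_measurable su.
have ui := integrable_weight_bound mu_ uA.
exists ((\int[mu]_y `|u y|) *+ 2) => x; rewrite mulr2n.
have b (g : 'rV[R]_n -> R) : measurable_fun setT g -> (forall y, `|g y| <= 1) ->
    `|\int[mu]_y (u y * g y)| <= \int[mu]_y `|u y|.
  move=> mg g1; have ig := trig_integrable su mg g1.
  apply: (le_trans (le_normr_Rintegral measurableT ig)).
  apply: le_Rintegral => //; [exact: integrable_norm|exact: integrable_norm|].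
  by move=> y _; rewrite normrM ler_piMr.
apply: lerD; apply: b.
- exact: measurable_cosdot.
- by move=> y; exact: norm_cos_le1.
- exact: measurable_sindot.
- by move=> y; exact: norm_sin_le1.
Qed.

(** Differentiating [u] multiplies by x_j and exchanges the two transforms. Their sum of moduli is
    stable under the exchange, so induction on k applies to it. *)
Lemma trig_transform_decay k u j : schwartz_real u -> exists C, forall x,
  `|x ord0 j| ^+ k * (`|cos_transform u x| + `|sin_transform u x|) <= C.
Proof.
elim: k u => [|k ih] u su.
  have [C uC] := trig_transform_bounded su.
  by exists C => x; rewrite expr0 mul1r.
have [C uC] := ih _ (schwartz_real_partial j su); exists C => x.
have := uC x; rewrite cos_transform_partial// sin_transform_partial//.
by rewrite normrN !normrM -mulrDr mulrA -exprSr [X in `|cos_transform u x| + X]lock addrC -lock.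
Qed.

Lemma cos_transform_bound N u : schwartz_real u ->
  exists2 C, 0 <= C & forall x, `|cos_transform u x| <= C * weight N x.
Proof.
move=> su; apply: weight_bound.
  have [C uC] := trig_transform_bounded su; exists C => x.
  by apply: le_trans (uC x); rewrite lerDl.
move=> j; have [C uC] := trig_transform_decay N j su; exists C => x.
by apply: le_trans (uC x); rewrite ler_wpM2l ?exprn_ge0// lerDl.
Qed.

Lemma sin_transform_bound N u : schwartz_real u ->
  exists2 C, 0 <= C & forall x, `|sin_transform u x| <= C * weight N x.
Proof.
move=> su; apply: weight_bound.
  have [C uC] := trig_transform_bounded su; exists C => x.
  by apply: le_trans (uC x); rewrite lerDr.
move=> j; have [C uC] := trig_transform_decay N j su; exists C => x.
by apply: le_trans (uC x); rewrite ler_wpM2l ?exprn_ge0// lerDr.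
Qed.

Lemma fourierE psi x : schwartz psi -> fourier psi x =
  ((cos_transform (fun y => complex.Re (psi y)) x + sin_transform (fun y => complex.Im (psi y)) x) +i*
   (cos_transform (fun y => complex.Im (psi y)) x - sin_transform (fun y => complex.Re (psi y)) x))%C.
Proof.
move=> [s1 s2]; have c1 t := norm_cos_le1 t; have c2 t := norm_sin_le1 t.
apply: complex_eq => /=.
- rewrite -RintegralD//; last 2 first.
  + exact: trig_integrable s1 (measurable_cosdot x) (fun y => c1 _).
  + exact: trig_integrable s2 (measurable_sindot x) (fun y => c2 _).
  by apply: eq_Rintegral => y _; rewrite Re_mul/= cosN sinN mulrN opprK.
- rewrite -RintegralB//; last 2 first.
  + exact: trig_integrable s2 (measurable_cosdot x) (fun y => c1 _).
  + exact: trig_integrable s1 (measurable_sindot x) (fun y => c2 _).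
  by apply: eq_Rintegral => y _; rewrite Im_mul/= cosN sinN mulrN addrC.
Qed.

Lemma fourier_bound N psi : schwartz psi ->
  exists2 C, 0 <= C & forall x, normc (fourier psi x) <= C * weight N x.
Proof.
move=> sp; have [s1 s2] := sp.
have [A A0 hA] := cos_transform_bound N s1; have [B B0 hB] := sin_transform_bound N s2.
have [C C0 hC] := cos_transform_bound N s2; have [D D0 hD] := sin_transform_bound N s1.
exists (A + B + (C + D)) => [|x]; first by rewrite !addr_ge0.
rewrite fourierE// (le_trans (normc_le _))//= mulrDl lerD// (le_trans (ler_normD _ _))//.
- by rewrite mulrDl lerD.
- by rewrite normrN mulrDl lerD.
Qed.

End fourier_decay.

(** * Multipliers applied to functions of bounded mean oscillation *)

Section multipliers.
Context {R : realType} {n : nat}.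
Implicit Types (Phi psi f g : 'rV[R]_n -> R[i]) (x y z : 'rV[R]_n) (t : R).
Local Notation mu := (@lebesgue_rV R n).
Local Notation normc := (@ComplexField.Normc.normc R).
Local Notation w := (@weight R n (@decay n)).

Lemma normc_expi t : normc (expi t) = 1.
Proof. by rewrite normcE /= cos2Dsin2 sqrtr1. Qed.

Lemma expiD (a b : R) : expi (a + b) = expi a * expi b.
Proof.
by apply: complex_eq; rewrite ?Re_mul ?Im_mul/= ?cosD ?sinD// addrC.
Qed.

Lemma cmeasurable2_expi x t : cmeasurable2 (fun xi y => expi (- dotrv xi (x + t *: y))).
Proof.
have m : measurable_fun [set: 'rV[R]_n * 'rV[R]_n] (fun p => - dotrv p.1 (x + t *: p.2)).
  apply: measurable_funN; apply: measurable_sum => i.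
  have -> : (fun p : 'rV[R]_n * 'rV[R]_n => p.1 ord0 i * (x + t *: p.2) ord0 i) =
      (fun p => p.1 ord0 i * (x ord0 i + t * p.2 ord0 i)).
    by apply/funext => p; rewrite !mxE.
  apply: measurable_funM.
    exact: (measurableT_comp (measurable_coor i) (@measurable_fst _ _ 'rV[R]_n 'rV[R]_n)).
  apply: measurable_funD => //; apply: measurable_funM => //.
  exact: (measurableT_comp (measurable_coor i) (@measurable_snd _ _ 'rV[R]_n 'rV[R]_n)).
by split; [exact: (measurable_comp_continuous (@continuous_cos R) m)|
  exact: (measurable_comp_continuous (@continuous_sin R) m)].
Qed.

Lemma cmeasurable_expi x : cmeasurable_fun setT (fun xi => expi (- dotrv xi x)).
Proof.
have m : measurable_fun setT (fun xi : 'rV[R]_n => - dotrv xi x).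
  by apply: measurable_funN; exact: measurable_dotrv.
by split; [exact: (measurable_comp_continuous (@continuous_cos R) m)|
  exact: (measurable_comp_continuous (@continuous_sin R) m)].
Qed.

Lemma schwartz_expi_cintegrable psi x : schwartz psi ->
  cintegrable setT (fun y => psi y * expi (- dotrv y x)).
Proof.
move=> sp; have [C _ pC] := schwartz_bound (@decay n) sp.
apply: (@kernel_cintegrable _ _ _ C).
  by apply: cmeasurableM; [exact: schwartz_cmeasurable|exact: cmeasurable_expi].
by move=> y; rewrite normcM normc_expi mulr1.
Qed.

Lemma fourier_cmeasurable psi : schwartz psi -> cmeasurable_fun setT (fourier psi).
Proof.
move=> sp; apply: (@cmeasurable_cintegral _ _ (fun x y => psi y * expi (- dotrv y x))).
apply: cmeasurable2M; first exact/cmeasurable2_snd/schwartz_cmeasurable.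
have := @cmeasurable2_expi 0 1 => /cmeasurable2_swap.
by under eq_fun do under eq_fun do rewrite add0r scale1r.
Qed.

(** After Fubini, the exponential inside the transform of [Phi] merges with the outer one and shifts
    the frequency argument by t y. *)
Lemma fourier_dilation_mul Phi psi t x : schwartz Phi -> schwartz psi ->
  fourier (fun xi => fourier Phi (t *: xi) * psi xi) x =
  cintegral setT (fun y => Phi y * fourier psi (x + t *: y)).
Proof.
move=> sP sp.
pose F xi y := Phi y * (psi xi * expi (- dotrv xi (x + t *: y))).
have mF : cmeasurable2 F.
  apply: cmeasurable2M; first exact/cmeasurable2_snd/schwartz_cmeasurable.
  apply: cmeasurable2M; first exact/cmeasurable2_fst/schwartz_cmeasurable.
  exact: cmeasurable2_expi.
have [C1 C10 PC] := schwartz_bound (@decay n) sP.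
have [C2 C20 pC] := schwartz_bound (@decay n) sp.
have Cw (C : R) : 0 <= C -> (\int[mu]_x (C * w x)%:E < +oo)%E.
  move=> C0; rewrite ge0_integralZ_EFin//; [|exact: weight_ge0|exact: measurable_decay].
  by rewrite lte_mul_pinfty ?lee_fin//; exact: integral_decay_lty.
have Foo : (\int[mu]_xi \int[mu]_y (normc (F xi y))%:E < +oo)%E.
  have mw (C : R) : measurable_fun setT (fun x => C * w x).
    by apply: measurable_funM => //; exact: measurable_weight.
  have w0 (C : R) : 0 <= C -> forall x, 0 <= C * w x.
    by move=> C0 y; rewrite mulr_ge0 ?weight_ge0.
  apply: (@product_dominated_lty _ _ F (fun x => C2 * w x) (fun x => C1 * w x)) => //.
  - exact: w0.
  - exact: w0.
  - move=> xi y; rewrite /F normcM normcM normc_expi mulr1 mulrC.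
    by apply: ler_pM; rewrite ?normc_ge0.
  - exact: Cw.
  - exact: Cw.
transitivity (cintegral setT (fun xi => cintegral setT (F xi))).
  apply: eq_cintegral => xi _.
  rewrite mulrAC -mulrA mulrC -cintegralZ//; last exact: schwartz_expi_cintegrable.
  apply: eq_cintegral => y _; rewrite /F dotrvDr opprD expiD !dotrvZr (dotrvC y).
  by rewrite (mulrCA _ (Phi y)) -!mulrA; congr (_ * _); rewrite mulrCA mulrA.
rewrite (cfubini mF Foo); apply: eq_cintegral => y _.
by rewrite -cintegralZ//; exact: schwartz_expi_cintegrable.
Qed.

Lemma tempered_BMO f M : BMO_le f M -> 0 <= M -> tempered f.
Proof.
move=> fM M0; have [mf _ _] := fM; split => // psi sp.
have [C _ pC] := schwartz_bound (@decay n) sp.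
have := kernelM_cintegrable (schwartz_cmeasurable sp) pC fM M0.
by under eq_fun do rewrite mulrC.
Qed.

Lemma tempered_bounded g K : cmeasurable_fun setT g -> (forall z, normc (g z) <= K) ->
  tempered g.
Proof.
move=> mg gK; split => // psi sp.
have [C C0 pC] := schwartz_bound (@decay n) sp.
apply: (@kernel_cintegrable _ _ _ (K * C)).
  by apply: cmeasurableM => //; exact: schwartz_cmeasurable.
move=> x; rewrite normcM -mulrA; apply: ler_pM => //; exact: normc_ge0.
Qed.

(** The pairing with a transform becomes a double integral; for fixed y the translation z = x + t y
    moves the shift from f to the transform of psi, where [fourier_dilation_mul] recognises it. The
    bound [K] makes the convolution tempered. *)
Lemma is_fourier_multiplier_convolution Phi f M t K : t != 0 -> schwartz Phi -> BMO_le f M -> 0 <= M ->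
  (forall z, normc (cintegral setT (fun y => Phi y * f (z + (- t) *: y))) <= K) ->
  is_fourier_multiplier (fun xi => fourier Phi (t *: xi)) f
    (fun z => cintegral setT (fun y => Phi y * f (z + (- t) *: y))).
Proof.
move=> t0 sP fM M0 gK; have [mf _ _] := fM.
have mP := schwartz_cmeasurable sP.
have mg : cmeasurable_fun setT (fun z => cintegral setT (fun y => Phi y * f (z + (- t) *: y))).
  apply: (@cmeasurable_cintegral _ _ (fun z y => Phi y * f (z + (- t) *: y))).
  by apply: cmeasurable2M; [exact: cmeasurable2_snd|exact: cmeasurable2_affine].
split; [exact: tempered_BMO fM M0|exact: tempered_bounded mg gK|] => psi sp.
have mp := fourier_cmeasurable sp.
pose F x y := f x * (Phi y * fourier psi (x + t *: y)).
pose G y z := f (z + (- t) *: y) * (Phi y * fourier psi z).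
have mF : cmeasurable2 F.
  apply: cmeasurable2M; first exact: cmeasurable2_fst.
  by apply: cmeasurable2M; [exact: cmeasurable2_snd|exact: cmeasurable2_affine].
have mG : cmeasurable2 G.
  apply: cmeasurable2M; first exact/cmeasurable2_swap/cmeasurable2_affine.
  by apply: cmeasurable2M; [exact: cmeasurable2_fst|exact: cmeasurable2_snd].
have [C1 C10 pC] := fourier_bound (@decay n) sp.
(* Twice the decay: one factor pays for the shift by t y in [weight_peetre], the other makes the
   bound integrable in y. *)
have [C2 C20 PC] := schwartz_bound (@decay n + @decay n) sP.
pose C := C1 * C2 * (1 + `|t|) ^+ @decay n.
have T0 : 0 <= (1 + `|t|) ^+ @decay n by apply: exprn_ge0; exact: addr_ge0.
have C0 : 0 <= C by apply: mulr_ge0 => //; exact: mulr_ge0.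
have FC x y : normc (F x y) <= (w x * normc (f x)) * (C * w y).
  pose q := (1 + norm1 y) ^+ @decay n.
  have qw : q * w y = 1 by rewrite /weight mulfV// expf_neq0// gt_eqF// onenorm1_gt0.
  have h1 : normc (fourier psi (x + t *: y)) <= C1 * ((1 + `|t|) ^+ @decay n * q * w x).
    apply: (le_trans (pC _)); rewrite ler_wpM2l// (le_trans (weight_peetre _ _ _))//.
    rewrite ler_wpM2r ?weight_ge0// /q -exprMn.
    have abst0 := normr_ge0 t; have y0 := norm1_ge0 y.
    rewrite lerXn2r ?nnegrE ?(ltW (onenorm1_gt0 _)) ?mulr_ge0 ?addr_ge0//.
    exact: norm1_scale_le.
  have h2 : normc (Phi y) <= C2 * (w y * w y) by rewrite -weightD.
  rewrite /F normcM normcM.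
  apply: (le_trans (ler_wpM2l (normc_ge0 _) (ler_pM (normc_ge0 _) (normc_ge0 _) h2 h1))).
  rewrite le_eqVlt; apply/orP; left; apply/eqP.
  transitivity (w x * normc (f x) * (C1 * C2 * (1 + `|t|) ^+ @decay n * (q * w y) * w y)).
    by ring.
  by rewrite qw mulr1.
have mw : measurable_fun setT w by exact: measurable_weight.
have Foo : (\int[mu]_x \int[mu]_y (normc (F x y))%:E < +oo)%E.
  apply: (product_dominated_lty mF _ _ _ _ FC).
  - by apply: measurable_funM => //; case: mf => *; exact: measurable_normc.
  - by apply: measurable_funM => //; exact: mw.
  - by move=> x; rewrite mulr_ge0 ?weight_ge0 ?normc_ge0.
  - by move=> y; rewrite mulr_ge0 ?weight_ge0.
  - exact: BMO_weight_lty fM M0.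
  - rewrite ge0_integralZ_EFin//; [|exact: weight_ge0|exact: measurable_decay].
    by rewrite lte_mul_pinfty ?lee_fin//; exact: integral_decay_lty.
have PC' y : normc (Phi y) <= C2 * w y.
  by apply: (le_trans (PC y)); rewrite ler_wpM2l// weight_le// leq_addr.
have GF y z : G y z = F (z + (- t) *: y) y.
  by rewrite /G /F scaleNr subrK.
(* Absolute integrability passes from [F] to [G] by Tonelli and translation in x for fixed y. *)
have Goo : (\int[mu]_y \int[mu]_z (normc (G y z))%:E < +oo)%E.
  rewrite (_ : (\int[mu]_y _)%E = (\int[mu]_y \int[mu]_x (normc (F x y))%:E)%E).
    have n0 (p : 'rV[R]_n * 'rV[R]_n) : (0 <= (normc (F p.1 p.2))%:E)%E.
      by rewrite lee_fin normc_ge0.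
    have := fubini_tonelli (m1 := mu) (m2 := mu) _ (emeasurable_normc2 mF) n0.
    by move=> /= <-.
  apply: eq_integral => y _.
  have mFy : measurable_fun setT (fun x => (normc (F x y))%:E).
    have /emeasurable_normc := cmeasurable2_section1 y (cmeasurable2_swap mF); exact.
  have := @ge0_integral_affine _ _ (- t *: y) 1 _ (oner_neq0 _) mFy.
  rewrite normr1 expr1n invr1 mul1e => <- => [|x]; last by rewrite lee_fin normc_ge0.
  by apply: eq_integral => z _; rewrite GF scale1r addrC.
transitivity (cintegral setT (fun z => cintegral setT (G ^~ z))).
  apply: eq_cintegral => z _; rewrite mulrC -cintegralZ//; last first.
    by apply: (kernelM_cintegrable mP PC' (BMO_le_affine z _ fM) M0); rewrite oppr_eq0.
  by apply: eq_cintegral => y _; rewrite /G mulrC -mulrA mulrCA mulrA.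
rewrite -(cfubini mG Goo).
transitivity (cintegral setT (fun y => cintegral setT (F ^~ y))).
  apply: eq_cintegral => y _.
  have mFy := cmeasurable2_section1 y (cmeasurable2_swap mF).
  rewrite (@cintegral_affine_in _ _ (- t *: y) 1 _ _ (oner_neq0 _) measurableT mFy).
  rewrite normr1 expr1n mul1r preimage_setT; apply: eq_cintegral => z _.
  by rewrite GF scale1r addrC.
rewrite -(cfubini mF Foo); apply: eq_cintegral => x _.
rewrite fourier_dilation_mul// -cintegralZ//.
apply: (@kernel_cintegrable _ _ _ (C2 * C1)).
  by apply: cmeasurableM => //; exact: cmeasurable_affine.
move=> y; rewrite normcM mulrAC; apply: ler_pM; rewrite ?normc_ge0//.
by apply: (le_trans (pC _)); rewrite ler_piMr// weight_le1.
Qed.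

Lemma multiplier_Linfty_le Phi : schwartz Phi -> exists2 A, 0 <= A &
  forall f M t S, t != 0 -> BMO_le f M -> 0 <= M ->
  (forall z, normc (average f (eball z `|t|)) <= S) ->
  (multiplier_Linfty (fun xi => fourier Phi (t *: xi)) f <= (A * (S + M))%:E)%E.
Proof.
move=> sP; have [C C0 PC] := schwartz_bound (@decay n) sP.
pose I := normc (cintegral setT Phi).
have I0 : 0 <= I by exact: normc_ge0.
have K0 : 0 <= 2 * C * @BMO_const R n.
  by apply: mulr_ge0; [exact: mulr_ge0|exact: BMO_const_ge0].
(* [I] multiplies the average in the main term; the rest is the error in [kernel_average]. *)
exists (I + 2 * C * @BMO_const R n) => [|f M t S t0 fM M0 fS]; first exact: addr_ge0.
have S0 : 0 <= S by apply: le_trans (fS 0); exact: normc_ge0.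
have Nt0 : - t != 0 by rewrite oppr_eq0.
have gK z : normc (cintegral setT (fun y => Phi y * f (z + (- t) *: y))) <=
    (I + 2 * C * @BMO_const R n) * (S + M).
  have := kernel_average z Nt0 (schwartz_cmeasurable sP) PC fM M0.
  rewrite normrN => h; rewrite -[X in normc X](subrK (average f (eball z `|t|) * cintegral setT Phi)).
  apply: (le_trans (normcD _ _)); rewrite normcM.
  apply: (le_trans (lerD h (ler_wpM2r I0 (fS z)))).
  rewrite -/I; have := BMO_const_ge0 (R := R) (n := n); nra.
apply: ge_ereal_inf; eexists.
  eexists; first exact: is_fourier_multiplier_convolution t0 sP fM M0 gK.
  by [].
rewrite /Linfty_norm; apply/ess_supP; apply: aeW => z; rewrite lee_fin; exact: gK.
Qed.

End multipliers.

(** * Gaussian test functions *)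

Section gaussian_schwartz.
Context {R : realType} {n : nat}.
Implicit Types (u : 'rV[R]_n -> R) (x y c : 'rV[R]_n) (j : 'I_n) (a : R).
Local Notation e_ j := (delta_mx ord0 j : 'rV[R]_n).

Definition gaussian a x : R := expR (- (a * dotrv x x)).

Lemma gaussian_gt0 a x : 0 < gaussian a x.
Proof. exact: expR_gt0. Qed.

Lemma is_derive_gaussian a x (v : 'rV[R]_n) :
  is_derive x v (gaussian a) (- (2 * a * dotrv x v) * gaussian a x).
Proof.
apply: is_derive_sliceP.
rewrite (_ : (fun t : R => _) = (fun t => expR (- (a * (dotrv x x + (2 * dotrv x v) * t +
    dotrv v v * (t * t)))))); last first.
  apply/funext => t; rewrite /gaussian dotrvDl !dotrvDr !dotrvZl !dotrvZr (dotrvC v x).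
  by congr (expR (- (a * _))); ring.
apply: is_derive_eq; rewrite /= /GRing.scale/= ?mulr0 ?mul0r ?addr0 ?mulr1 ?add0r.
by rewrite /gaussian; ring.
Qed.

(* The functions by which iterated derivatives multiply a modulated Gaussian. *)
Inductive poly_trig c : ('rV[R]_n -> R) -> Prop :=
| poly_trig_cst (b : R) : poly_trig c (fun=> b)
| poly_trig_coord j : poly_trig c (fun x => x ord0 j)
| poly_trig_cos : poly_trig c (fun x => cos (dotrv x c))
| poly_trig_sin : poly_trig c (fun x => sin (dotrv x c))
| poly_trig_add (u v : 'rV[R]_n -> R) : poly_trig c u -> poly_trig c v -> poly_trig c (fun x => u x + v x)
| poly_trig_mul (u v : 'rV[R]_n -> R) : poly_trig c u -> poly_trig c v -> poly_trig c (fun x => u x * v x).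

Lemma poly_trig_derive c u j : poly_trig c u ->
  exists2 du, poly_trig c du & forall x, is_derive x (e_ j) u (du x).
Proof.
elim=> {u} [b|i|||u v _ [du pu hu] _ [dv pv hv]|u v ptu [du pu hu] ptv [dv pv hv]].
- by exists (fun=> 0) => [|x]; [exact: poly_trig_cst|exact: is_derive_cst].
- exists (fun=> (e_ j) ord0 i) => [|x]; first exact: poly_trig_cst.
  apply: is_derive_sliceP.
  rewrite (_ : (fun t : R => _) = (fun t => x ord0 i + (e_ j) ord0 i * t)); last first.
    by apply/funext => t; rewrite mxE [X in _ + X]mxE mulrC.
  by apply: is_derive_eq; rewrite /= /GRing.scale/= ?mulr0 ?addr0 ?mulr1 ?add0r mul1r.
- exists (fun x => - dotrv (e_ j) c * sin (dotrv x c)); last by move=> x; exact: is_derive_cosdot.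
  by apply: poly_trig_mul; [exact: poly_trig_cst|exact: poly_trig_sin].
- exists (fun x => dotrv (e_ j) c * cos (dotrv x c)); last by move=> x; exact: is_derive_sindot.
  by apply: poly_trig_mul; [exact: poly_trig_cst|exact: poly_trig_cos].
- exists (fun x => du x + dv x) => [|x]; first exact: poly_trig_add.
  by have := hu x; have := hv x => ? ?; exact: is_deriveD.
- exists (fun x => u x * dv x + v x * du x) => [|x].
    by apply: poly_trig_add; exact: poly_trig_mul.
  by have := hu x; have := hv x => ? ?; exact: is_deriveM.
Qed.

Lemma dotrv_continuous (g h : 'rV[R]_n -> 'rV[R]_n) : 
  (forall i, continuous (fun x => g x ord0 i)) -> (forall i, continuous (fun x => h x ord0 i)) ->
  continuous (fun x => dotrv (g x) (h x)).
Proof.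
move=> cg ch; rewrite /dotrv; elim: (index_enum _) => [|i l ih].
  rewrite (_ : (fun x => _) = fun=> 0); first exact: cst_continuous.
  by apply/funext => x; rewrite big_nil.
rewrite (_ : (fun x => _) = (fun x => g x ord0 i * h x ord0 i +
    \sum_(j <- l) g x ord0 j * h x ord0 j)).
  by move=> x; apply: cvgD (ih x); apply: cvgM; [exact: cg|exact: ch].
by apply/funext => x; rewrite big_cons.
Qed.

Lemma poly_trig_continuous c u : poly_trig c u -> continuous u.
Proof.
have cd : continuous (fun x => dotrv x c).
  by apply: dotrv_continuous => i; [exact: coord_continuous|exact: cst_continuous].
elim=> {u} [b|i|||u v _ cu _ cv|u v _ cu _ cv] x.
- exact: cst_continuous.
- exact: coord_continuous.
- by apply: continuous_comp; [exact: cd|exact: continuous_cos].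
- by apply: continuous_comp; [exact: cd|exact: continuous_sin].
- exact: (continuousD (cu x) (cv x)).
- exact: (continuousM (cu x) (cv x)).
Qed.

Lemma gaussian_continuous a : continuous (gaussian a).
Proof.
have cq : continuous (fun x => dotrv x x).
  by apply: dotrv_continuous => i; exact: coord_continuous.
have ce : continuous (fun s : R => expR (- (a * s))).
  move=> s; apply: (@continuous_comp _ _ _ (fun s => - (a * s)) expR).
    by apply: (@continuous_comp _ _ _ (fun s => a * s) -%R);
      [exact: mulrl_continuous|exact: opp_continuous].
  exact: continuous_expR.
move=> x; apply: (@continuous_comp _ _ _ (fun x => dotrv x x) (fun s => expR (- (a * s)))).
  exact: cq.
exact: ce.
Qed.

Lemma poly_trig_growth c u : poly_trig c u ->
  exists k, exists2 C, 0 <= C & forall x, `|u x| <= C * (1 + norm1 x) ^+ k.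
Proof.
have one_le k x : 1 <= (1 + norm1 x) ^+ k by rewrite exprn_ege1// onenorm1_ge1.
have g0 k x : 0 <= (1 + norm1 x) ^+ k by rewrite (le_trans ler01).
elim=> {u} [b|i|||u v _ [k [C C0 uC]] _ [l [D D0 vD]]|u v _ [k [C C0 uC]] _ [l [D D0 vD]]].
- by exists 0%N, `|b| => // x; rewrite expr0 mulr1.
- exists 1%N, 1 => // x; rewrite mul1r expr1 (le_trans (coord_le_norm1 _ _))// lerDr//.
- by exists 0%N, 1 => // x; rewrite expr0 mulr1 norm_cos_le1.
- by exists 0%N, 1 => // x; rewrite expr0 mulr1 norm_sin_le1.
- exists (k + l)%N, (C + D) => [|x]; first exact: addr_ge0.
  rewrite (le_trans (ler_normD _ _))// mulrDl lerD// exprD.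
    by rewrite (le_trans (uC x))// ler_wpM2l// ler_peMr.
  by rewrite (le_trans (vD x))// ler_wpM2l// ler_peMl.
- exists (k + l)%N, (C * D) => [|x]; first exact: mulr_ge0.
  by rewrite normrM exprD mulrACA ler_pM.
Qed.

(** The bound 1 + u <= exp u makes 1 + |x|_1 at most a multiple of exp(a |x|^2/(k+1)); then take
    k-th powers. *)
Lemma gaussian_decay a k : 0 < a -> exists2 C, 0 <= C & forall x,
  (1 + norm1 x) ^+ k * gaussian a x <= C.
Proof.
(* This [d] ensures d (1 + s^2) <= 1 + a s^2/(k+1); dividing by k+1 rather than k includes k = 0. *)
move=> a0; pose d := Num.min 1 (a / k.+1%:R).
have d0 : 0 < d by rewrite lt_min ltr01 divr_gt0.
pose K := (n.+1%:R * 2) / d.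
have K0 : 0 <= K by rewrite divr_ge0// ltW.
exists (K ^+ k) => [|x]; first exact: exprn_ge0.
have s0 := enorm_ge0 x; set s := enorm x in s0 *.
have sE : dotrv x x = s ^+ 2 by rewrite sqr_sqrtr// dotrv_ge0.
have h1 : 1 + norm1 x <= n.+1%:R * 2 * (1 + s ^+ 2).
  apply: (@le_trans _ _ (n.+1%:R * (1 + s))).
    have := norm1_le_enorm x; rewrite -/s -[n.+1%:R]natr1.
    have : 0 <= n%:R :> R by []. move: (n%:R) => m m0 h; nra.
  by rewrite -mulrA ler_wpM2l//; nra.
have h2 : d * (1 + s ^+ 2) <= expR (a / k.+1%:R * s ^+ 2).
  apply: le_trans (expR_ge1Dx _).
  have d1 : d <= 1 by rewrite ge_min lexx.
  have d2 : d <= a / k.+1%:R by rewrite ge_min lexx orbT.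
  by rewrite mulrDr mulr1 lerD// ler_wpM2r// sqr_ge0.
have h3 : 1 + norm1 x <= K * expR (a / k.+1%:R * s ^+ 2).
  apply: (le_trans h1); rewrite /K -[leRHS]mulrA ler_wpM2l ?mulr_ge0//.
  by rewrite ler_pdivlMl.
have h4 : (1 + norm1 x) ^+ k <= K ^+ k * expR (a * s ^+ 2).
  apply: (@le_trans _ _ ((K * expR (a / k.+1%:R * s ^+ 2)) ^+ k)).
    apply: lerXn2r => //; rewrite nnegrE; first exact/ltW/onenorm1_gt0.
    by apply: mulr_ge0 => //; exact: expR_ge0.
  rewrite exprMn ler_wpM2l ?exprn_ge0// -expRM_natl ler_expR.
  rewrite mulrA ler_wpM2r ?sqr_ge0// mulrCA ler_piMr ?(ltW a0)//.
  by rewrite ler_pdivrMr// mul1r ler_nat.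
apply: (le_trans (ler_wpM2r (ltW (gaussian_gt0 a x)) h4)).
by rewrite /gaussian sE -mulrA -expRD subrr expR0 mulr1.
Qed.

(** The class [poly_trig] contains the monomials and is stable under the map that differentiation
    induces on the cofactor of the Gaussian, so each seminorm reduces to polynomial growth against
    [gaussian_decay]. *)
Lemma poly_trig_gaussian_schwartz c u a : 0 < a -> poly_trig c u ->
  schwartz_real (fun x => u x * gaussian a x).
Proof.
move=> a0; pose D j (w : 'rV[R]_n -> R) := fun x => 'D_(e_ j) w x.
have dg w dw j x : poly_trig c w -> is_derive x (e_ j) w (dw x) ->
    is_derive x (e_ j) (fun x => w x * gaussian a x)
      ((dw x + - (2 * a) * (w x * x ord0 j)) * gaussian a x).
  move=> _ hw; have hg := is_derive_gaussian a x (e_ j).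
  rewrite (_ : (fun x => _) = w * gaussian a)//; apply: is_derive_eq.
  by rewrite /GRing.scale/= dotrvC dotrv_delta; ring.
have partialsE s w : poly_trig c w -> exists2 v, poly_trig c v &
    partials s (fun x => w x * gaussian a x) = (fun x => v x * gaussian a x).
  move=> pw; elim: s => [|j s [v pv sE]]; first by exists w.
  have [dv pdv hv] := poly_trig_derive j pv.
  exists (fun x => dv x + - (2 * a) * (v x * x ord0 j)).
    apply: poly_trig_add => //; apply: poly_trig_mul; first exact: poly_trig_cst.
    by apply: poly_trig_mul => //; exact: poly_trig_coord.
  rewrite /= -/(partials s _) sE; apply/funext => x.
  by have := dg _ _ _ _ pv (hv x) => ?; rewrite derive_val.
move=> pu; split => [s|b s]; have [v pv ->] := partialsE s u pu.
- split => [|j x].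
    have cv : continuous v := poly_trig_continuous pv.
    by move=> x; apply: continuousM; [exact: cv|exact: gaussian_continuous].
  have [dv pdv hv] := poly_trig_derive j pv.
  by have [] := dg _ _ _ _ pv (hv x).
- have pm : poly_trig c (fun x => \prod_(i < n) x ord0 i ^+ b i * v x).
    apply: poly_trig_mul pv.
    have pX i k : poly_trig c (fun x => x ord0 i ^+ k).
      elim: k => [|k ih]; first exact: poly_trig_cst.
      rewrite (_ : (fun x => _) = (fun x : 'rV[R]_n => x ord0 i * x ord0 i ^+ k)).
        by apply: poly_trig_mul => //; exact: poly_trig_coord.
      by apply/funext => x; rewrite exprS.
    elim: (index_enum _) => [|i l ih].
      rewrite (_ : (fun x => _) = fun=> 1); first exact: poly_trig_cst.
      by apply/funext => x; rewrite big_nil.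
    rewrite (_ : (fun x => _) = (fun x : 'rV[R]_n => x ord0 i ^+ b i * \prod_(j <- l) x ord0 j ^+ b j)).
      by apply: poly_trig_mul.
    by apply/funext => x; rewrite big_cons.
  have [k [C C0 mC]] := poly_trig_growth pm.
  have [K K0 gK] := gaussian_decay k a0.
  exists (C * K) => x; rewrite mulrA normrM [X in _ * X <= _]gtr0_norm ?gaussian_gt0//.
  apply: (le_trans (ler_wpM2r (ltW (gaussian_gt0 a x)) (mC x))).
  by rewrite -mulrA ler_wpM2l.
Qed.

End gaussian_schwartz.

(** * The Fourier transform of a Gaussian *)

Section gaussian_fourier.
Context {R : realType} {n : nat}.
Implicit Types (x y c : 'rV[R]_n) (r s : R).
Local Notation mu := (@lebesgue_rV R n).
Local Notation normc := (@ComplexField.Normc.normc R).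
Local Notation w := (@weight R n (@decay n)).
Local Notation gauss := (@gaussian R n 2^-1).

Lemma poly_trig_dotrv c x : poly_trig c (fun y => dotrv y x).
Proof.
rewrite /dotrv; elim: (index_enum _) => [|i l ih].
  rewrite (_ : (fun y => _) = fun=> 0); first exact: poly_trig_cst.
  by apply/funext => y; rewrite big_nil.
rewrite (_ : (fun y => _) = (fun y : 'rV[R]_n => y ord0 i * x ord0 i +
    \sum_(j <- l) y ord0 j * x ord0 j)).
  apply: poly_trig_add ih; apply: poly_trig_mul; first exact: poly_trig_coord.
  exact: poly_trig_cst.
by apply/funext => y; rewrite big_cons.
Qed.

Lemma half_gt0 : 0 < 2^-1 :> R. Proof. by rewrite invr_gt0. Qed.

Lemma gauss_schwartz : schwartz_real gauss.
Proof.
have := poly_trig_gaussian_schwartz half_gt0 (@poly_trig_cst R n 0 1).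
by rewrite (_ : (fun x => _) = gauss)//; apply/funext => y; rewrite mul1r.
Qed.

Lemma measurable_gaussian (a : R) : measurable_fun setT (@gaussian R n a).
Proof. by apply: continuous_measurable_rV; exact: gaussian_continuous. Qed.

(** Classically (2 pi)^(n/2); it enters only through its positivity. *)
Definition gauss_mass : R := \int[mu]_y gauss y.

Lemma gauss_integrable : mu.-integrable setT (EFin \o gauss).
Proof.
have [C _ gC] := schwartz_real_bound (@decay n) gauss_schwartz.
exact: integrable_weight_bound (measurable_gaussian _) gC.
Qed.

Lemma integral_gaussE : (\int[mu]_y (gauss y)%:E = gauss_mass%:E)%E.
Proof. by rewrite /gauss_mass /Rintegral fineK// integrable_fin_num// gauss_integrable. Qed.

Lemma gauss_mass_gt0 : 0 < gauss_mass.
Proof.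
have mB := @measurable_eball R n 0 1.
have v0 := @vol_gt0 R n 0 _ ltr01.
have mg : measurable_fun setT (fun y => (gauss y)%:E).
  by apply/measurable_EFinP; exact: measurable_gaussian.
rewrite -lte_fin -integral_gaussE.
apply: (@lt_le_trans _ _ (\int[mu]_(y in eball 0 1) (expR (- 2^-1))%:E)%E).
  by rewrite integral_cst// [X in (_ * X)%E]volE -EFinM lte_fin mulr_gt0// expR_gt0.
apply: (@le_trans _ _ (\int[mu]_(y in eball 0 1) (gauss y)%:E)%E).
  apply: ge0_le_integral => //.
  - exact: measurable_funTS.
  - move=> y; rewrite /eball/= subr0 => y1; rewrite lee_fin ler_expR lerN2.
    rewrite ler_piMr ?invr_ge0// -[dotrv y y]sqr_sqrtr ?dotrv_ge0// -/(enorm y).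
    by rewrite expr_le1 ?enorm_ge0// ltW.
by apply: ge0_subset_integral => // y _; rewrite lee_fin expR_ge0.
Qed.

(** The derivative in direction x of sin(s y.x) times the Gaussian integrates to 0; the two sides
    are the two terms of the product rule. *)
Lemma gauss_derive_identity x (s : R) :
  \int[mu]_y (gauss y * (dotrv y x * sin (dotrv y (s *: x)))) =
  s * dotrv x x * cos_transform gauss (s *: x).
Proof.
pose u y := sin (dotrv y (s *: x)) * gauss y.
pose U1 y := (s * dotrv x x * cos (dotrv y (s *: x))) * gauss y.
pose U2 y := (dotrv y x * sin (dotrv y (s *: x))) * gauss y.
have su : schwartz_real u := poly_trig_gaussian_schwartz half_gt0 (poly_trig_sin (s *: x)).
have s1 : schwartz_real U1.
  apply: (poly_trig_gaussian_schwartz (c := s *: x) half_gt0).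
  by apply: poly_trig_mul; [exact: poly_trig_cst|exact: poly_trig_cos].
have s2 : schwartz_real U2.
  apply: (poly_trig_gaussian_schwartz (c := s *: x) half_gt0).
  by apply: poly_trig_mul; [exact: poly_trig_dotrv|exact: poly_trig_sin].
have [C C0 uC] := schwartz_real_bound (@decay n) su.
have [C1 C10 U1C] := schwartz_real_bound (@decay n) s1.
have [C2 C20 U2C] := schwartz_real_bound (@decay n) s2.
have du y : is_derive y x u (U1 y - U2 y).
  have h1 := is_derive_sindot (s *: x) y x; have h2 := is_derive_gaussian 2^-1 y x.
  rewrite (_ : u = (fun y => sin (dotrv y (s *: x))) * gauss)//; apply: is_derive_eq.
  by rewrite /GRing.scale/= /U1 /U2 !dotrvZr; field.
have i1 := integrable_weight_bound (schwartz_real_measurable s1) U1C.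
have i2 := integrable_weight_bound (schwartz_real_measurable s2) U2C.
have w0 y := @weight_ge0 R n (@decay n) y.
have := @integral_derive0 R n u x (C + (C1 + C2)) (schwartz_real_measurable su).
have -> : (fun y => 'D_x u y) = (fun y => U1 y - U2 y).
  by apply/funext => y; have := du y => ?; rewrite derive_val.
rewrite RintegralB// => main.
have /eqP : \int[mu]_y U1 y - \int[mu]_y U2 y = 0.
  apply: main.
  - by move=> y; have [] := du y.
  - by move=> y; apply: (le_trans (uC y)); rewrite ler_wpM2r// lerDl addr_ge0.
  - move=> y; have [_ ->] := du y.
    apply: (le_trans (ler_normB _ _)); apply: (le_trans (lerD (U1C y) (U2C y))).
    by rewrite -mulrDl ler_wpM2r// lerDr.
rewrite subr_eq0 => /eqP E.
transitivity (\int[mu]_y U2 y); first by apply: eq_Rintegral => y _; rewrite /U2 mulrC.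
rewrite -E /cos_transform -RintegralZl//.
  by apply: eq_Rintegral => y _; rewrite /U1; ring.
exact: trig_integrable gauss_schwartz (measurable_cosdot _) (fun y => norm_cos_le1 _).
Qed.

(** Differentiation under the integral brings down -(y.x) sin, which [gauss_derive_identity] turns
    back into the transform itself: a linear equation along the ray through x. *)
Lemma is_derive_cos_transform_gauss x (a : R) :
  is_derive a 1 (fun s => cos_transform gauss (s *: x))
    (- (a * dotrv x x * cos_transform gauss (a *: x))).
Proof.
pose f (s : R) y := gauss y * cos (s * dotrv y x).
have fE s : cos_transform gauss (s *: x) = \int[mu]_y f s y.
  by apply: eq_Rintegral => y _; rewrite dotrvZr.
have [C C0 dC] := schwartz_real_bound (@decay n)
  (poly_trig_gaussian_schwartz half_gt0 (poly_trig_dotrv 0 x)).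
have df s y : is_derive s 1 (f ^~ y) (- (gauss y * (dotrv y x * sin (s * dotrv y x)))).
  by apply: is_derive_eq; rewrite /= /GRing.scale/=; ring.
have d1E s y : partial1of2 f s y = - (gauss y * (dotrv y x * sin (s * dotrv y x))).
  by rewrite partial1of2E; have := df s y => ?; rewrite derive_val.
pose G y := C * w y.
have G0 y : 0 <= G y by rewrite mulr_ge0// weight_ge0.
have mG : measurable_fun setT G.
  by apply: measurable_funM => //; exact: measurable_weight.
have intG : mu.-integrable setT (EFin \o G).
  by apply: (@integrable_weight_bound _ _ _ C) => // y; rewrite ger0_norm.
have intf s : mu.-integrable setT (EFin \o f s).
  have := trig_integrable gauss_schwartz (measurable_cosdot (s *: x)) (fun y => norm_cos_le1 _).
  rewrite (_ : (fun y => _) = f s)//.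
  by apply/funext => y; rewrite dotrvZr.
have Gub s y : `]a - 1, a + 1[%classic s -> setT y -> `|partial1of2 f s y| <= G y.
  move=> _ _; rewrite d1E normrN mulrA normrM [gauss y * _]mulrC.
  apply: le_trans (dC y); rewrite ler_piMr// norm_sin_le1//.
have Ia : `]a - 1, a + 1[%classic a by rewrite /= in_itv/= ltrBlDr ltrDl ltr01.
have fd s y : `]a - 1, a + 1[%classic s -> setT y -> derivable (f ^~ y) s 1.
  by move=> _ _; have [] := df s y.
have D := @derivable_under_integral _ _ _ mu f setT measurableT a _ _ Ia (fun s _ => intf s) fd G G0 intG Gub.
have E := @differentiation_under_integral _ _ _ mu f setT measurableT a _ _ Ia (fun s _ => intf s) fd G G0 intG Gub.
rewrite (_ : (fun s => _) = (fun s => \int[mu]_y f s y)); last first.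
  by apply/funext => s; exact: fE.
split => //; rewrite -derive1E E -gauss_derive_identity -Rintegral_opp; last first.
  have := poly_trig_gaussian_schwartz half_gt0 (poly_trig_dotrv 0 x).
  move=> /trig_integrable/(_ (measurable_sindot (a *: x)) (fun y => norm_sin_le1 _)).
  rewrite [X in mu.-integrable _ X -> _](_ : _ =
    EFin \o (fun y => gauss y * (dotrv y x * sin (dotrv y (a *: x)))))//.
  by apply/funext => y /=; congr EFin; ring.
by apply: eq_Rintegral => y _; rewrite d1E dotrvZr.
Qed.

Lemma cos_transform_gauss x : cos_transform gauss x = gauss_mass * gauss x.
Proof.
pose q := dotrv x x.
(* Multiplied by the integrating factor, the solution is constant; its values at s = 0 and s = 1 are
   compared. *)
pose k (s : R) := cos_transform gauss (s *: x) * expR (s * s * (q / 2)).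
have dk s : is_derive s 1 k 0.
  have h := is_derive_cos_transform_gauss x s.
  have he : is_derive s 1 (fun s : R => expR (s * s * (q / 2))) (s * q * expR (s * s * (q / 2))).
    by apply: is_derive_eq; rewrite /= /GRing.scale/=; field.
  rewrite (_ : k = (fun s => cos_transform gauss (s *: x)) * (fun s => expR (s * s * (q / 2))))//.
  by apply: is_derive_eq; rewrite /GRing.scale/= -/q; ring.
have := is_derive_0_is_cst 1 0 dk; rewrite /k scale1r scale0r !mul1r !mul0r expR0 mulr1.
have -> : cos_transform gauss 0 = gauss_mass.
  apply: eq_Rintegral => y _; rewrite (_ : dotrv y 0 = 0) ?cos0 ?mulr1//.
  by rewrite -(scale0r 0) dotrvZr mul0r.
by move=> <-; rewrite /gaussian -/q -mulrA -expRD [2^-1 * q]mulrC subrr expR0 mulr1.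
Qed.

Lemma Rintegral_reflect (u : 'rV[R]_n -> R) : measurable_fun setT u ->
  \int[mu]_x u (- x) = \int[mu]_x u x.
Proof.
move=> mu_; rewrite /Rintegral; congr fine.
have := @integral_affine_in _ _ 0 (-1) setT (EFin \o u) _ measurableT.
rewrite normrN normr1 expr1n mul1e preimage_setT => -> //; last exact/measurable_EFinP.
by apply: eq_integral => x _; rewrite /= scaleN1r add0r.
Qed.

Lemma sin_transform_gauss x : sin_transform gauss x = 0.
Proof.
have m : measurable_fun setT (fun y => gauss y * sin (dotrv y x)).
  by apply: measurable_funM; [exact: measurable_gaussian|exact: measurable_sindot].
have si := trig_integrable gauss_schwartz (measurable_sindot x) (fun y => norm_sin_le1 _).
have : sin_transform gauss x = - sin_transform gauss x.
  rewrite -[in RHS]Rintegral_opp// -[LHS]Rintegral_reflect//.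
  apply: eq_Rintegral => y _; rewrite -scaleN1r dotrvZl mulN1r sinN mulrN.
  by rewrite /gaussian dotrvZl dotrvZr !mulN1r opprK.
by move=> /eqP; rewrite -subr_eq0 opprK -mulr2n mulrn_eq0 => /eqP.
Qed.

(** Written on the frequency side: modulation by +c moves the centre of the transform to c, and the
    narrow Gaussian of parameter r^2/2 gives it width r. *)
Definition bump c r : 'rV[R]_n -> R[i] :=
  fun xi => ((gaussian (r ^+ 2 / 2) xi)%:C)%C * expi (dotrv xi c).

Lemma bump_schwartz c r : 0 < r -> schwartz (bump c r).
Proof.
move=> r0; have a0 : 0 < r ^+ 2 / 2 by rewrite divr_gt0// exprn_gt0.
split.
- have := poly_trig_gaussian_schwartz a0 (poly_trig_cos c).
  rewrite (_ : (fun x => _) = (fun x => complex.Re (bump c r x)))//.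
  by apply/funext => x; rewrite /bump Re_mul/= mul0r subr0 mulrC.
- have := poly_trig_gaussian_schwartz a0 (poly_trig_sin c).
  rewrite (_ : (fun x => _) = (fun x => complex.Im (bump c r x)))//.
  by apply/funext => x; rewrite /bump Im_mul/= mul0r addr0 mulrC.
Qed.

Lemma fourier_bump c r x : 0 < r -> fourier (bump c r) x =
  ((r ^- n * (gauss_mass * gauss (r^-1 *: (x - c))))%:C)%C.
Proof.
move=> r0; have rn0 : r != 0 by rewrite gt_eqF.
set p := r^-1 *: (x - c).
pose H y := ((gauss y)%:C)%C * expi (- dotrv y p).
have mH : cmeasurable_fun setT H.
  apply: cmeasurableM; last exact: cmeasurable_expi.
  by split; [exact: measurable_gaussian|exact: measurable_cst].
have IH : cintegral setT H = ((gauss_mass * gauss p)%:C)%C.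
  apply: complex_eq.
  - rewrite -[LHS]/(\int[mu]_y complex.Re (H y)) -[RHS]/(gauss_mass * gauss p).
    rewrite -cos_transform_gauss; apply: eq_Rintegral => y _.
    by rewrite /H Re_mul/= mul0r subr0 cosN.
  - rewrite -[LHS]/(\int[mu]_y complex.Im (H y)) -[RHS]/(0 : R).
    rewrite -[RHS]oppr0 -(sin_transform_gauss p) -Rintegral_opp; last first.
      exact: trig_integrable gauss_schwartz (measurable_sindot p) (fun y => norm_sin_le1 _).
    by apply: eq_Rintegral => y _; rewrite /H Im_mul/= mul0r addr0 sinN mulrN.
have -> : ((r ^- n * (gauss_mass * gauss p))%:C = (r ^- n)%:C * (gauss_mass * gauss p)%:C)%C.
  exact: rmorphM.
rewrite -IH (@cintegral_affine_in _ _ 0 r _ _ rn0 measurableT mH) preimage_setT.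
rewrite mulrA -rmorphM gtr0_norm// mulVf ?expf_neq0// mul1r.
apply: eq_cintegral => y _; rewrite add0r /H /bump -mulrA -expiD; congr (_ * expi _).
  by congr (_%:C)%C; rewrite /gaussian dotrvZl dotrvZr; congr (expR (- _)); ring.
have -> : dotrv (r *: y) p = r * (r^-1 * dotrv y (x - c)).
  by rewrite dotrvZl; congr (r * _); exact: dotrvZr.
have dN : dotrv y (- c) = - dotrv y c by rewrite -scaleN1r dotrvZr mulN1r.
by rewrite mulrA mulfV// mul1r dotrvDr dN; ring.
Qed.

End gaussian_fourier.

(** * Averages controlled by the multiplier norm *)

Section multiplier_lower_bound.
Context {R : realType} {n : nat}.
Implicit Types (Phi psi f g : 'rV[R]_n -> R[i]) (x y z c : 'rV[R]_n) (t r M : R).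
Local Notation mu := (@lebesgue_rV R n).
Local Notation normc := (@ComplexField.Normc.normc R).
Local Notation w := (@weight R n (@decay n)).
Local Notation gauss := (@gaussian R n 2^-1).
Local Notation gm := (@gauss_mass R n).
Local Notation cgauss := (fun x => ((gauss x)%:C)%C).

Lemma cmeasurable_gauss : cmeasurable_fun setT cgauss.
Proof. by split; [exact: measurable_gaussian|exact: measurable_cst]. Qed.

Lemma cintegral_gauss : cintegral setT cgauss = (gm%:C)%C.
Proof.
by apply: complex_eq => //=; rewrite /Rintegral integral0.
Qed.

Lemma ge0_integral_linear_gauss c r : 0 < r ->
  (\int[mu]_x (gauss (r^-1 *: (x - c)))%:E = (r ^+ n * gm)%:E)%E.
Proof.
move=> r0; have rV0 : r^-1 != 0 by rewrite invr_eq0 gt_eqF.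
have mg : measurable_fun setT (fun x => (gauss x)%:E).
  by apply/measurable_EFinP; exact: measurable_gaussian.
have := @ge0_integral_affine _ _ (- (r^-1 *: c)) r^-1 _ rV0 mg.
rewrite integral_gaussE gtr0_norm ?invr_gt0// exprVn invrK EFinM => <-.
  by apply: eq_integral => x _; rewrite scalerBr addrC.
by move=> x; rewrite lee_fin expR_ge0.
Qed.

(* [tau <= 1] is the ratio of the scale of [Phi] to that of the Gaussian. *)
Definition smoothed Phi (tau : R) x : R[i] :=
  cintegral setT (fun y => Phi y * ((gauss (x + tau *: y))%:C)%C).

(** Uniformity in [tau] comes from |tau y| <= |y|: the cost of the shift is absorbed by half of the
    decay of [Phi]. *)
Lemma smoothed_dominated Phi : schwartz Phi -> exists2 A, 0 <= A &
  forall tau x y, 0 <= tau <= 1 ->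
  normc (Phi y * ((gauss (x + tau *: y))%:C)%C) <= w x * (A * w y).
Proof.
move=> sP.
have [C1 C10 gC] := schwartz_real_bound (@decay n) (@gauss_schwartz R n).
have [C2 C20 PC] := schwartz_bound (@decay n + @decay n) sP.
exists (C2 * C1) => [|tau x y /andP[t0 t1]]; first exact: mulr_ge0.
pose q := (1 + norm1 y) ^+ @decay n.
have qw : q * w y = 1 by rewrite /weight mulfV// expf_neq0// gt_eqF// onenorm1_gt0.
have h1 : `|gauss (x + tau *: y)| <= C1 * (q * w x).
  apply: (le_trans (gC _)); rewrite ler_wpM2l// (le_trans (weight_peetre _ _ _))//.
  rewrite ler_wpM2r ?weight_ge0// /q lerXn2r ?nnegrE ?(ltW (onenorm1_gt0 _))//.
  by rewrite lerD2l norm1Z ger0_norm// ler_piMl// norm1_ge0.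
have h2 : normc (Phi y) <= C2 * (w y * w y) by rewrite -weightD.
rewrite normcM normc_real.
apply: (le_trans (ler_pM (normc_ge0 _) (normr_ge0 _) h2 h1)).
rewrite le_eqVlt; apply/orP; left; apply/eqP.
transitivity (w x * (C2 * C1 * (q * w y) * w y)); first by ring.
by rewrite qw mulr1.
Qed.

Lemma smoothed_cmeasurable2 Phi tau : schwartz Phi ->
  cmeasurable2 (fun x y => Phi y * ((gauss (x + tau *: y))%:C)%C).
Proof.
move=> sP; apply: cmeasurable2M; first exact/cmeasurable2_snd/schwartz_cmeasurable.
exact: cmeasurable2_affine cmeasurable_gauss.
Qed.

Lemma smoothed_cintegrable Phi tau x : schwartz Phi -> 0 <= tau <= 1 ->
  cintegrable setT (fun y => Phi y * ((gauss (x + tau *: y))%:C)%C).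
Proof.
move=> sP t01; have [A A0 hA] := smoothed_dominated sP.
apply: (@kernel_cintegrable _ _ _ (w x * A)).
  exact: cmeasurable2_section1 x (smoothed_cmeasurable2 tau sP).
by move=> y; rewrite -mulrA; exact: hA.
Qed.

(** By Fubini and translation invariance the mean does not depend on [tau], so it cannot degenerate
    as t/r varies. *)
Lemma smoothed_bound Phi : schwartz Phi -> exists2 A, 0 <= A &
  forall tau, 0 <= tau <= 1 -> [/\ cmeasurable_fun setT (smoothed Phi tau),
    forall x, normc (smoothed Phi tau x) <= A * w x &
    cintegral setT (smoothed Phi tau) = (gm%:C)%C * cintegral setT Phi].
Proof.
move=> sP; have [A A0 hA] := smoothed_dominated sP.
pose W := fine (\int[mu]_x (w x)%:E)%E.
have WE : (\int[mu]_x (w x)%:E = W%:E)%E.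
  rewrite fineK// ge0_fin_numE ?integral_decay_lty// integral_ge0// => x _.
  by rewrite lee_fin weight_ge0.
have W0 : 0 <= W.
  by apply: fine_ge0; apply: integral_ge0 => x _; rewrite lee_fin weight_ge0.
exists (2 * (A * W)) => [|tau t01]; first by rewrite !mulr_ge0.
have mF := smoothed_cmeasurable2 tau sP.
have mAw : measurable_fun setT (fun y => A * w y).
  by apply: measurable_funM => //; exact: measurable_weight.
have Aw0 y : 0 <= A * w y by rewrite mulr_ge0// weight_ge0.
have Foo : (\int[mu]_x \int[mu]_y (normc (Phi y * ((gauss (x + tau *: y))%:C)%C))%:E < +oo)%E.
  apply: (product_dominated_lty mF _ mAw _ Aw0 (fun x y => hA tau x y t01)).
  - exact: measurable_weight.
  - by move=> x; exact: weight_ge0.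
  - exact: integral_decay_lty.
  - rewrite ge0_integralZ_EFin//; [|exact: weight_ge0|exact: measurable_decay].
    by rewrite WE -EFinM ltry.
have Fi x := smoothed_cintegrable x sP t01.
split; first exact: cmeasurable_cintegral mF.
- move=> x; rewrite -lee_fin.
  apply: (le_trans (normc_cintegral_le measurableT (Fi x))).
  have -> : 2 * (A * W) * w x = 2 * ((w x * A) * W) by ring.
  rewrite EFinM lee_pmul2l//.
  apply: (@le_trans _ _ (\int[mu]_y ((w x * A) * w y)%:E))%E.
    apply: ge0_le_integralT.
    - by apply: emeasurable_normc; exact: cmeasurable2_section1 x mF.
    - apply/measurable_EFinP; apply: measurable_funM => //; exact: measurable_weight.
    - by move=> y; rewrite lee_fin normc_ge0.
    - by move=> y; rewrite lee_fin -mulrA; exact: hA.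
  rewrite ge0_integralZ_EFin//.
  - by rewrite WE -EFinM.
  - by rewrite mulr_ge0// weight_ge0.
  - by move=> y; exact: weight_ge0.
  - exact: measurable_decay.
rewrite /smoothed (cfubini mF Foo) -cintegralZ//; last exact: schwartz_cintegrable.
apply: eq_cintegral => y _.
have gi : cintegrable setT (fun x => ((gauss (x + tau *: y))%:C)%C).
  have [C1 C10 gC] := schwartz_real_bound (@decay n) (@gauss_schwartz R n).
  apply: (@kernel_cintegrable _ _ _ (C1 * (1 + norm1 (tau *: y)) ^+ @decay n)).
    by have := cmeasurable2_section1 y (cmeasurable2_swap (cmeasurable2_affine tau cmeasurable_gauss)).
  move=> x; rewrite normc_real; apply: (le_trans (gC _)).
  by rewrite -mulrA ler_wpM2l// weight_peetre.
rewrite cintegralZ// mulrC; congr (_ * _).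
rewrite -cintegral_gauss.
rewrite [RHS](@cintegral_affine_in _ _ (tau *: y) 1 _ _ (oner_neq0 _) measurableT cmeasurable_gauss).
rewrite normr1 expr1n mul1r preimage_setT; apply: eq_cintegral => x _.
by rewrite scale1r addrC.
Qed.

(** The transform of [bump c r] has L^1 norm [gm * gm] for all c and r, since its height r^(-n)
    cancels the Jacobian; the 2 is that of [normc_cintegral_le]. *)
Lemma bump_pairing_le g L c r : cmeasurable_fun setT g -> 0 <= L -> 0 < r ->
  (Linfty_norm g <= L%:E)%E ->
  normc (cintegral setT (fun x => g x * fourier (bump c r) x)) <= 2 * gm * (gm * L).
Proof.
move=> mg L0 r0 gL; have rn0 : r != 0 by rewrite gt_eqF.
have gm0 : 0 < gm := @gauss_mass_gt0 R n.
have mgb : cmeasurable_fun setT (fun x => g x * fourier (bump c r) x).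
  exact: (cmeasurableM mg (fourier_cmeasurable (bump_schwartz c r0))).
pose H x := L * (r ^- n * gm * gauss (r^-1 *: (x - c))).
have mga : measurable_fun setT (fun x => gauss (r^-1 *: (x - c))).
  rewrite (_ : (fun x => _) = gauss \o (fun x => - (r^-1 *: c) + r^-1 *: x)).
    exact: (measurableT_comp (measurable_gaussian _) (measurable_rV_affine _ _)).
  by apply/funext => x /=; rewrite scalerBr addrC.
have mH : measurable_fun setT (fun x => (H x)%:E).
  by apply/measurable_EFinP; apply: measurable_funM => //; apply: measurable_funM.
have g0 x : 0 <= gauss (r^-1 *: (x - c)) by exact: expR_ge0.
have rgm0 : 0 <= r ^- n * gm by rewrite mulr_ge0 ?(ltW gm0)// invr_ge0 exprn_ge0// ltW.
have H0 x : 0 <= H x by rewrite /H mulr_ge0// mulr_ge0.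
have gH : (\int[mu]_x (normc (g x * fourier (bump c r) x))%:E <= (gm * (gm * L))%:E)%E.
  apply: (@le_trans _ _ (\int[mu]_x (H x)%:E)%E).
    apply: ae_ge0_le_integral => //.
    - by move=> x _; rewrite lee_fin normc_ge0.
    - exact: emeasurable_normc.
    - by move=> x _; rewrite lee_fin.
    move/ess_supP : gL; apply: filterS => x gx _.
    rewrite lee_fin normcM fourier_bump// normc_real ger0_norm; last first.
      by rewrite mulrA mulr_ge0.
    by rewrite /H -[r ^- n * gm * _]mulrA ler_wpM2r// mulrA mulr_ge0.
  rewrite ge0_integralZ_EFin//; last 2 first.
  - by move=> x; rewrite mulr_ge0.
  - by apply/measurable_EFinP; exact: measurable_funM.
  rewrite ge0_integralZ_EFin//; last exact/measurable_EFinP.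
  rewrite ge0_integral_linear_gauss// -!EFinM lee_fin.
  rewrite le_eqVlt; apply/orP; left; apply/eqP; field.
  by rewrite expf_neq0.
have gi : cintegrable setT (fun x => g x * fourier (bump c r) x).
  by apply/cintegrableP => //; apply: le_lt_trans gH (ltry _).
rewrite -lee_fin; apply: (le_trans (normc_cintegral_le measurableT gi)).
by rewrite -mulrA EFinM lee_pmul2l.
Qed.

Lemma fourier_smoothed Phi c t r x : schwartz Phi -> 0 < r -> 0 <= t / r <= 1 ->
  fourier (fun xi => fourier Phi (t *: xi) * bump c r xi) x =
  ((r ^- n * gm)%:C)%C * smoothed Phi (t / r) (r^-1 *: (x - c)).
Proof.
move=> sP r0 t01.
rewrite (fourier_dilation_mul t x sP (bump_schwartz c r0)) /smoothed.
rewrite -(cintegralZ _ measurableT (smoothed_cintegrable _ sP t01)).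
apply: eq_cintegral => y _; rewrite (fourier_bump _ _ r0) [RHS]mulrCA; congr (_ * _).
rewrite mulrA.
have -> : r^-1 *: (x - c) + (t / r) *: y = r^-1 *: (x + t *: y - c).
  by rewrite -scalerA scalerA [t / r]mulrC -scalerA -scalerDr addrAC.
exact: rmorphM.
Qed.

(** Substituting c + r x for x brings the pairing to the form treated by [kernel_average], with a
    kernel bounded uniformly in t <= r. *)
Lemma smoothed_pairing Phi f M c t r : schwartz Phi -> 0 < t -> t <= r ->
  BMO_le f M -> 0 <= M ->
  cintegral setT (fun x => f x * fourier (fun xi => fourier Phi (t *: xi) * bump c r xi) x) =
  (gm%:C)%C * cintegral setT (fun x => smoothed Phi (t / r) x * f (c + r *: x)).
Proof.
move=> sP t0 tr fM M0; have r0 : 0 < r by exact: lt_le_trans tr.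
have rn0 : r != 0 by rewrite gt_eqF.
have t01 : 0 <= t / r <= 1.
  apply/andP; split; first by apply: divr_ge0; exact: ltW.
  by rewrite (ler_pdivrMr _ _ r0) mul1r.
have [A A0 hA] := smoothed_bound sP; have [mk kA _] := hA _ t01.
have [mf _ _] := fM.
rewrite (eq_cintegral (fun x _ => congr1 ( *%R (f x)) (fourier_smoothed c x sP r0 t01))).
have mS : cmeasurable_fun setT (fun x => f x * (((r ^- n * gm)%:C)%C *
    smoothed Phi (t / r) (r^-1 *: (x - c)))).
  apply: (cmeasurableM mf); apply: cmeasurableM; first exact: cmeasurable_cst.
  rewrite (_ : (fun x => _) = (fun x => smoothed Phi (t / r) (- (r^-1 *: c) + r^-1 *: x))).
    exact: cmeasurable_affine.
  by apply/funext => x; rewrite scalerBr addrC.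
have Xi : cintegrable setT (fun y => smoothed Phi (t / r) y * f (c + r *: y)).
  exact: kernelM_cintegrable mk kA (BMO_le_affine c rn0 fM) M0.
rewrite (@cintegral_affine_in _ _ c r _ _ rn0 measurableT mS) preimage_setT (gtr0_norm r0).
transitivity (((r ^+ n)%:C)%C * cintegral setT (fun y =>
    ((r ^- n * gm)%:C)%C * (smoothed Phi (t / r) y * f (c + r *: y)))).
  congr (_ * _); apply: eq_cintegral => y _.
  rewrite (addrC c) addrK scalerA mulVf// scale1r.
  by rewrite mulrCA [f _ * _]mulrC.
rewrite (cintegralZ _ measurableT Xi) mulrA; congr (_ * _).
have <- : (((r ^+ n) * (r ^- n * gm))%:C = (r ^+ n)%:C * (r ^- n * gm)%:C)%C by exact: rmorphM.
by rewrite mulrA mulfV ?mul1r// expf_neq0.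
Qed.

Lemma average_le_multiplier Phi : schwartz Phi -> cintegral setT Phi != 0 ->
  exists2 A, 0 <= A & forall f g M L t r c, BMO_le f M -> 0 <= M -> 0 <= L ->
    0 < t -> t <= r -> is_fourier_multiplier (fun xi => fourier Phi (t *: xi)) f g ->
    (Linfty_norm g <= L%:E)%E -> normc (average f (eball c r)) <= A * (L + M).
Proof.
move=> sP IP; have [A A0 hA] := smoothed_bound sP.
have gm0 : 0 < gm := @gauss_mass_gt0 R n.
have I0 : 0 < normc (cintegral setT Phi) by exact: normc_gt0.
(* The modulus of the common mean of all smoothed kernels; the nonzero integral of [Phi] allows
   division by it. *)
pose D := gm * normc (cintegral setT Phi).
have D0 : 0 < D by exact: mulr_gt0.
have bc0 := @BMO_const_ge0 R n.
exists ((2 * gm + 2 * A * @BMO_const R n) / D) => [|f g M L t r c fM M0 L0 t0 tr].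
  by apply: (divr_ge0 _ (ltW D0)); apply: addr_ge0; do ?apply: mulr_ge0 => //; exact: ltW.
move=> [tf tg E] gL; have r0 : 0 < r by exact: lt_le_trans tr.
have rn0 : r != 0 by rewrite gt_eqF.
have [mf _ _] := fM; have [mg _] := tg.
have sb := bump_schwartz c r0.
have {}E := E _ sb.
have t01 : 0 <= t / r <= 1.
  apply/andP; split; first by apply: divr_ge0; exact: ltW.
  by rewrite (ler_pdivrMr _ _ r0) mul1r.
have [mk kA Ik] := hA _ t01.
have smallL := bump_pairing_le c mg L0 r0 gL.
have E2 := etrans E (smoothed_pairing c sP t0 tr fM M0).
have := kernel_average c rn0 mk kA fM M0.
rewrite (gtr0_norm r0) Ik.
set X := cintegral setT (fun x => smoothed Phi (t / r) x * f (c + r *: x)) in E2 *; set a := average f _ => K.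
have XL : normc X <= 2 * (gm * L).
  rewrite -(ler_pM2l gm0) -[X in X * normc _](gtr0_norm gm0) -normc_real -normcM -E2.
  by apply: (le_trans smallL); rewrite -mulrA mulrCA.
have aD : normc a * D = normc (a * ((gm%:C)%C * cintegral setT Phi)).
  by rewrite !normcM normc_real (gtr0_norm gm0).
clear E E2 smallL mk kA Ik hA gL tf tg mg sb mf fM sP; clearbody X a.
(* The left side is the modulus of the main term in [kernel_average], hence at most the error plus
   the modulus of the pairing [X]. *)
have aX : normc a * D <= 2 * A * (@BMO_const R n * M) + 2 * (gm * L).
  rewrite aD -[X in normc X](subrK X) (le_trans (normcD _ _))// lerD//.
  by rewrite -normc_opp opprB.
rewrite mulrAC ler_pdivlMr//; apply: (le_trans aX).
have h1 : 0 <= gm * M := mulr_ge0 (ltW gm0) M0.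
have h2 : 0 <= A * @BMO_const R n * L := mulr_ge0 (mulr_ge0 A0 bc0) L0.
rewrite [leRHS](_ : _ = 2 * A * (@BMO_const R n * M) + 2 * (gm * L) +
  (2 * (gm * M) + 2 * (A * @BMO_const R n * L))); last by ring.
by rewrite lerDl addr_ge0// mulr_ge0.
Qed.

End multiplier_lower_bound.

(** * Comparison of the norms *)

Section norm_comparison.
Context {R : realType} {n : nat}.
Implicit Types (Phi f : 'rV[R]_n -> R[i]) (c z : 'rV[R]_n) (t r M : R).
Local Notation mu := (@lebesgue_rV R n).
Local Notation normc := (@ComplexField.Normc.normc R).
Local Notation lw := (@log_weight R).

Lemma log_weight_ge1 t : 1 <= lw t.
Proof. by rewrite /log_weight lerDl le_max lexx orbT. Qed.

Lemma log_weight_gt0 t : 0 < lw t.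
Proof. exact: lt_le_trans (log_weight_ge1 t). Qed.

Lemma BMO_norm_ge0 f : (0 <= BMO_norm f)%E.
Proof.
apply: (@le_trans _ _ (mean_oscillation f (eball 0 1))).
  rewrite /mean_oscillation mule_ge0//.
    by rewrite lee_fin invr_ge0 ltW// vol_gt0.
  by apply: integral_ge0 => x _; rewrite lee_fin normc_ge0.
by apply: ereal_sup_ubound; exists 0, 1.
Qed.

Lemma BMO_normE f : BMO f ->
  exists M, [/\ 0 <= M, BMO_norm f = M%:E & BMO_le f M].
Proof.
move=> [lf foo]; exists (fine (BMO_norm f)).
have E : BMO_norm f = (fine (BMO_norm f))%:E.
  by rewrite fineK// ge0_fin_numE// BMO_norm_ge0.
split => //; first by apply: fine_ge0; exact: BMO_norm_ge0.
by apply: BMO_leP => //; rewrite -E.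
Qed.

Lemma Linfty_norm_ge0 (g : 'rV[R]_n -> R[i]) : (0 <= Linfty_norm g)%E.
Proof.
apply: ess_sup_gee; first exact: lebesgue_rV_setT_gt0.
by apply: aeW => x; rewrite lee_fin normc_ge0.
Qed.

Lemma multiplier_Linfty_ge0 (m f : 'rV[R]_n -> R[i]) : (0 <= multiplier_Linfty m f)%E.
Proof. by apply: le_ereal_inf_tmp => _ [g _ <-]; exact: Linfty_norm_ge0. Qed.

(** A function g nearly attaining the infimum is used. The slack is e/(A + 1), which remains
    meaningful when A = 0. *)
Lemma average_le_multiplier_Linfty Phi : schwartz Phi -> cintegral setT Phi != 0 ->
  exists2 A, 0 <= A & forall f M L t r c, BMO_le f M -> 0 <= M -> 0 <= L ->
    0 < t -> t <= r -> (multiplier_Linfty (fun xi => fourier Phi (t *: xi)) f <= L%:E)%E ->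
    normc (average f (eball c r)) <= A * (L + M).
Proof.
move=> sP IP; have [A A0 hA] := average_le_multiplier sP IP.
exists A => // f M L t r c fM M0 L0 t0 tr fL.
apply/ler_addgt0Pr => e e0.
have A1 : 0 < A + 1 by rewrite ltr_wpDl.
have : (multiplier_Linfty (fun xi => fourier Phi (t *: xi)) f < (L + e / (A + 1))%:E)%E.
  by apply: (le_lt_trans fL); rewrite lte_fin ltrDl divr_gt0.
move=> /ereal_inf_lt[_ [g gm <-]] gL.
have Le0 : 0 <= L + e / (A + 1) by rewrite addr_ge0// ltW// divr_gt0.
apply: (le_trans (hA _ _ _ _ _ _ c fM M0 Le0 t0 tr gm (ltW gL))).
rewrite addrAC mulrDr lerD2l mulrCA ler_piMr ?(ltW e0)//.
by rewrite ler_pdivrMr// mul1r lerDl.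
Qed.

(** Each norm is the BMO norm plus a second term. This leaves only finite values of the second term
    to treat, the comparison being trivial at +oo. *)
Lemma add_norm_le (M C : R) (x y : \bar R) : 0 <= M -> 0 <= C -> (0 <= x)%E ->
  (forall b : R, 0 <= b -> x = b%:E -> (y <= (C * (b + M))%:E)%E) ->
  (M%:E + y <= (1 + C)%:E * (M%:E + x))%E.
Proof.
move=> M0 C0; case: x => [b b0 h|_ _|//]; last first.
  by rewrite addey// gt0_muley ?leey// lte_fin ltr_pwDl.
rewrite lee_fin in b0; apply: (le_trans (leeD2l _ (h _ b0 erefl))).
rewrite -!EFinD -EFinM lee_fin mulrDl mul1r (addrC b) lerD2r lerDl//.
Qed.

Lemma sup_ball_ge0 f : (0 <= sup_ball lw f)%E.
Proof.
apply: (@le_trans _ _ (((lw 1 * vol (@eball R n 0 1))^-1 *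
    normc (cintegral (eball 0 1) f))%:E)%E).
  rewrite lee_fin mulr_ge0 ?normc_ge0// invr_ge0 mulr_ge0 ?(ltW (log_weight_gt0 _))//.
  exact/ltW/vol_gt0.
by apply: ereal_sup_ubound; exists 0, 1.
Qed.

Lemma ball_average f c r : 0 < r ->
  (lw r * vol (eball c r))^-1 * normc (cintegral (eball c r) f) =
  (lw r)^-1 * normc (average f (eball c r)).
Proof.
move=> r0; have v0 := vol_gt0 c r0.
by rewrite /average normcM normc_real gtr0_norm ?invr_gt0// invfM mulrA.
Qed.

Lemma sup_ball_leP f B :
  (forall c r, 0 < r -> normc (average f (eball c r)) <= lw r * B) <->
  (sup_ball lw f <= B%:E)%E.
Proof.
split => [h|h c r r0].
  apply: ge_ereal_sup => _ [c [r [r0 ->]]]; rewrite lee_fin ball_average//.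
  by rewrite mulrC ler_pdivrMr ?log_weight_gt0// mulrC; exact: h.
have : (((lw r * vol (eball c r))^-1 * normc (cintegral (eball c r) f))%:E <= B%:E)%E.
  by apply: le_trans h; apply: ereal_sup_ubound; exists c, r.
by rewrite lee_fin ball_average// mulrC ler_pdivrMr ?log_weight_gt0// mulrC.
Qed.

Lemma P_Linfty_le_ball Phi : schwartz Phi -> exists2 A, 0 <= A & forall f M B t,
  BMO_le f M -> 0 <= M -> 0 <= B -> 0 < t -> (sup_ball lw f <= B%:E)%E ->
  (P_Linfty Phi t f <= (lw t * (A * (B + M)))%:E)%E.
Proof.
move=> sP; have [A A0 hA] := multiplier_Linfty_le sP.
exists A => // f M B t fM M0 B0 t0 /sup_ball_leP fB.
have tn0 : t != 0 by rewrite gt_eqF.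
have fB' z : normc (average f (eball z `|t|)) <= lw t * B.
  by rewrite (gtr0_norm t0); exact: fB.
apply: (le_trans (hA f M t _ tn0 fM M0 fB')).
(* Since w >= 1, the BMO error also fits under the factor w(t). *)
by rewrite lee_fin mulrCA ler_wpM2l// mulrDr lerD2l ler_peMl// log_weight_ge1.
Qed.

Lemma X_norm_le_ball Phi : schwartz Phi -> exists2 C, 0 < C & forall f, BMO f ->
  (X_norm lw Phi f <= C%:E * ball_norm lw f)%E.
Proof.
move=> sP; have [A A0 hA] := P_Linfty_le_ball sP.
exists (1 + A) => [|f /BMO_normE[M [M0 E fM]]]; first by rewrite ltr_pwDl.
rewrite /X_norm /ball_norm E; apply: add_norm_le => //; first exact: sup_ball_ge0.
move=> B B0 EB; apply: ge_ereal_sup => _ [t t0 ->].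
have fB : (sup_ball lw f <= B%:E)%E by rewrite EB.
apply: (le_trans (lee_wpmul2r _ (hA f M B t fM M0 B0 t0 fB))).
  by rewrite lee_fin invr_ge0 ltW// log_weight_gt0.
by rewrite -EFinM lee_fin mulrAC mulfV ?mul1r// gt_eqF// log_weight_gt0.
Qed.

Lemma log_weight1 : lw 1 = 1.
Proof. by rewrite /log_weight invr1 ln1 maxxx addr0. Qed.

(** Makes the low-frequency term of the bmo norm an instance of [P_Linfty], at t = 1 where the
    weight is 1. *)
Lemma multiplier_at1 Phi f :
  multiplier_Linfty (fourier Phi) f = P_Linfty Phi 1 f.
Proof.
rewrite /P_Linfty.
have -> : (fun xi => fourier Phi (1 *: xi)) = fourier Phi.
  by apply/funext => x; rewrite scale1r.
reflexivity.
Qed.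

Lemma bmo_norm_le_ball Theta : schwartz Theta -> exists2 C, 0 < C & forall f, BMO f ->
  (bmo_norm Theta f <= C%:E * ball_norm lw f)%E.
Proof.
move=> sT; have [A A0 hA] := P_Linfty_le_ball sT.
exists (1 + A) => [|f /BMO_normE[M [M0 E fM]]]; first by rewrite ltr_pwDl.
rewrite /bmo_norm /ball_norm E multiplier_at1; apply: add_norm_le => //.
  exact: sup_ball_ge0.
move=> B B0 EB; have fB : (sup_ball lw f <= B%:E)%E by rewrite EB.
by have := hA f M B 1 fM M0 B0 ltr01 fB; rewrite log_weight1 mul1r.
Qed.

Lemma ball_norm_le_X Phi : schwartz Phi -> cintegral setT Phi != 0 ->
  exists2 C, 0 < C & forall f, BMO f -> (ball_norm lw f <= C%:E * X_norm lw Phi f)%E.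
Proof.
move=> sP IP; have [A A0 hA] := average_le_multiplier_Linfty sP IP.
exists (1 + A) => [|f /BMO_normE[M [M0 E fM]]]; first by rewrite ltr_pwDl.
rewrite /X_norm /ball_norm E; apply: add_norm_le => //.
  apply: (@le_trans _ _ (P_Linfty Phi 1 f * ((lw 1)^-1)%:E)%E).
    rewrite mule_ge0 ?multiplier_Linfty_ge0// lee_fin invr_ge0 ltW//.
    exact: log_weight_gt0.
  by apply: ereal_sup_ubound; exists 1.
move=> P P0 EP; apply/sup_ball_leP => c r r0.
have lr := log_weight_gt0 r.
have Pr : (P_Linfty Phi r f <= (lw r * P)%:E)%E.
  have : (P_Linfty Phi r f * ((lw r)^-1)%:E <= P%:E)%E.
    by rewrite -EP; apply: ereal_sup_ubound; exists r.
  by rewrite muleC lee_pdivrMl// -EFinM.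
have lP : 0 <= lw r * P by rewrite mulr_ge0// ltW.
apply: (le_trans (hA f M (lw r * P) r r c fM M0 lP r0 (lexx r) Pr)).
rewrite mulrCA ler_wpM2l// mulrDr lerD2l ler_peMl//; exact: log_weight_ge1.
Qed.

Lemma ball_norm_le_bmo Theta : schwartz Theta -> cintegral setT Theta != 0 ->
  exists2 C, 0 < C & forall f, BMO f -> (ball_norm lw f <= C%:E * bmo_norm Theta f)%E.
Proof.
move=> sT IT; have [A A0 hA] := average_le_multiplier_Linfty sT IT.
have ln2_gt0 : 0 < ln 2 :> R by rewrite ln_gt0// ltr1n.
(* The first factor bounds the number of doublings relative to w(r), the second is the cost of one
   doubling. *)
pose K : R := (1 + (ln 2)^-1) * 2 ^+ n.+1.
have K0 : 0 <= K by rewrite mulr_ge0 ?exprn_ge0// addr_ge0// invr_ge0 ltW.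
exists (1 + (A + K)) => [|f /BMO_normE[M [M0 E fM]]]; first by rewrite ltr_pwDl// addr_ge0.
rewrite /bmo_norm /ball_norm E multiplier_at1; apply: add_norm_le => //.
- exact: addr_ge0.
- exact: multiplier_Linfty_ge0.
move=> T T0 ET; have fT : (P_Linfty Theta 1 f <= T%:E)%E by rewrite ET.
apply/sup_ball_leP => c r r0.
have [k kr kK] : exists2 k, 1 <= 2 ^+ k * r & k%:R <= (1 + (ln 2)^-1) * lw r.
  have : exists k, 1 <= 2 ^+ k * r.
    exists (Num.truncn r^-1).+1; rewrite -ler_pdivrMr// mul1r.
    apply: (le_trans (ltW (truncnS_gt _))).
    by rewrite -natrX ler_nat ltnW// ltn_expl.
  move=> /ex_minnP[k kr kmin]; exists k => //.
  case: k kr kmin => [|k] kr kmin.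
    by rewrite mulr_ge0 ?(ltW (log_weight_gt0 _))// addr_ge0// invr_ge0 ltW.
  (* Minimality: one doubling fewer leaves the radius below 1, so that number of doublings is at
     most log(1/r)/log 2. *)
  have rk : 2 ^+ k * r < 1 by rewrite ltNge; apply/negP => /kmin; rewrite ltnn.
  have h : k%:R * ln 2 <= lw r - 1.
    rewrite /log_weight [1 + _]addrC addrK le_max mulr_natl.
    rewrite -lnXn// ler_ln ?posrE ?exprn_gt0 ?invr_gt0//.
    by rewrite -[r^-1]mul1r ler_pdivlMr// ltW.
  have h' : k%:R <= (ln 2)^-1 * (lw r - 1) by rewrite mulrC ler_pdivlMr.
  have := log_weight_ge1 r; rewrite -[k.+1%:R]natr1 => lr1.
  rewrite mulrDl mul1r addrC lerD// (le_trans h')// ler_wpM2l ?invr_ge0 ?(ltW ln2_gt0)//.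
  by rewrite lerBlDr lerDl.
have far : normc (average f (eball c (2 ^+ k * r))) <= A * (T + M).
  exact: (hA f M T 1 _ c fM M0 T0 ltr01 kr fT).
have near := average_dyadic c k fM r0 M0.
rewrite -[X in normc X](subrK (average f (eball c (2 ^+ k * r)))).
apply: (le_trans (normcD _ _)); apply: (le_trans (lerD near far)).
have lr1 := log_weight_ge1 r; have lr0 := ltW (log_weight_gt0 r).
rewrite addrC [leRHS](_ : _ = lw r * (A * (T + M)) + lw r * (K * (T + M))); last by ring.
apply: lerD; first by rewrite ler_peMl// mulr_ge0// addr_ge0.
apply: (@le_trans _ _ (((1 + (ln 2)^-1) * lw r) * (2 ^+ n.+1 * M))).
  by rewrite ler_wpM2r// mulr_ge0// exprn_ge0.
rewrite [leLHS](_ : _ = lw r * (K * M)); last by rewrite /K; ring.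
by rewrite ler_wpM2l// ler_wpM2l// lerDr.
Qed.

Lemma bmo_BMO Theta f : bmo Theta f -> BMO f.
Proof.
move=> [lf foo]; split => //; apply: le_lt_trans foo.
by rewrite /bmo_norm leeDl// multiplier_Linfty_ge0.
Qed.

End norm_comparison.

(** Turns the normalisation of [Theta] at frequency 0 into the nonvanishing integral that the lower
    bound requires. *)
Lemma fourier0 {R : realType} {n : nat} (phi : 'rV[R]_n -> R[i]) :
  fourier phi 0 = cintegral setT phi.
Proof.
apply: eq_cintegral => x _; rewrite -(scale0r 0) dotrvZr mul0r oppr0.
by rewrite /expi cos0 sin0 mulr1.
Qed.

Lemma le_trans_scaled {T : Type} {R : realType} (S : set T) (x y z : T -> \bar R) :
  (exists2 C, 0 < C & forall f, S f -> (x f <= C%:E * y f)%E) ->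
  (exists2 C, 0 < C & forall f, S f -> (y f <= C%:E * z f)%E) ->
  exists2 C, 0 < C & forall f, S f -> (x f <= C%:E * z f)%E.
Proof.
move=> [C C0 xy] [D D0 yz]; exists (C * D) => [|f Sf]; first exact: mulr_gt0.
apply: (le_trans (xy _ Sf)); rewrite EFinM -muleA.
by apply: lee_wpmul2l; [rewrite lee_fin ltW|exact: yz].
Qed.

(** The one-sided estimates live on [S] = BMO, since the equality of the spaces uses them before
    membership in bmo is known; comparability is then restricted to [S']. *)
Lemma comparable_onP {T : Type} {R : realType} (S S' : set T) (x y : T -> \bar R) :
  S' `<=` S -> (forall f, S f -> 0 <= x f)%E -> (forall f, S f -> 0 <= y f)%E ->
  (exists2 C, 0 < C & forall f, S f -> (x f <= C%:E * y f)%E) ->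
  (exists2 C, 0 < C & forall f, S f -> (y f <= C%:E * x f)%E) ->
  comparable_on S' x y.
Proof.
move=> SS x0 y0 [C C0 xy] [D D0 yx]; exists (C + D); first exact: addr_gt0.
move=> f /SS Sf; split.
- apply: (le_trans (xy _ Sf)); apply: lee_wpmul2r; first exact: y0.
  by rewrite lee_fin lerDl ltW.
- apply: (le_trans (yx _ Sf)); apply: lee_wpmul2r; first exact: x0.
  by rewrite lee_fin lerDr ltW.
Qed.

Theorem theorem4p3 (R : realType) (n : nat) (n_gt0 : (0 < n)%N)
    (phi : 'rV[R]_n -> R[i]) (phi_schwartz : schwartz phi)
    (phi_supp : bounded_support (fourier phi))
    (phi_int : cintegral setT phi != 0)
    (Theta : 'rV[R]_n -> R[i]) (Theta_schwartz : schwartz Theta)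
    (Theta_supp : bounded_support (fourier Theta))
    (Theta_1 : \forall xi \near (0 : 'rV[R]_n), fourier Theta xi = 1) :
  [/\ X_space log_weight phi = bmo Theta,
      comparable_on (bmo Theta) (bmo_norm Theta) (X_norm log_weight phi) &
      comparable_on (bmo Theta) (X_norm log_weight phi) (ball_norm log_weight)].
Proof.
have Theta_int : cintegral setT Theta != 0.
  by rewrite -fourier0 (nbhs_singleton Theta_1) oner_neq0.
have X_ball := X_norm_le_ball phi_schwartz.
have bmo_ball := bmo_norm_le_ball Theta_schwartz.
have ball_X := ball_norm_le_X phi_schwartz phi_int.
have ball_bmo := ball_norm_le_bmo Theta_schwartz Theta_int.
have X_bmo := le_trans_scaled X_ball ball_bmo.
have bmo_X := le_trans_scaled bmo_ball ball_X.
have lty (a b : \bar R) (C : R) : (a <= C%:E * b)%E -> (0 <= b < +oo)%E -> 0 < C -> (a < +oo)%E.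
  move=> ab /andP[b0 boo] C0; apply: (le_lt_trans ab).
  by rewrite lte_mul_pinfty ?lee_fin ?(ltW C0).
have ball0 (f : 'rV[R]_n -> R[i]) : BMO f -> (0 <= ball_norm (@log_weight R) f)%E.
  by move=> _; rewrite adde_ge0 ?BMO_norm_ge0 ?sup_ball_ge0.
have bmo0 (f : 'rV[R]_n -> R[i]) : BMO f -> (0 <= bmo_norm Theta f)%E.
  by move=> _; rewrite adde_ge0 ?BMO_norm_ge0 ?multiplier_Linfty_ge0.
(* A positive multiple of this norm dominates the nonnegative ball norm. *)
have X0 (f : 'rV[R]_n -> R[i]) : BMO f -> (0 <= X_norm log_weight phi f)%E.
  move=> fB; have [C C0 /(_ f fB)] := ball_X.
  move=> /(le_trans (ball0 f fB)); rewrite pmule_rge0//.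
have sub : bmo Theta `<=` BMO by move=> f; exact: bmo_BMO.
split.
- apply/seteqP; split => f.
  + move=> [fB fX]; split; first by case: fB.
    have [C C0 /(_ f fB)] := bmo_X; move=> /lty; apply => //.
    by rewrite fX X0.
  + move=> fb; have fB := bmo_BMO fb; split => //.
    have [C C0 /(_ f fB)] := X_bmo; move=> /lty; apply => //.
    by rewrite bmo0//; case: fb.
- exact: comparable_onP sub bmo0 X0 bmo_X X_bmo.
- exact: comparable_onP sub X0 ball0 X_ball ball_X.
Qed.
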